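(* Let $T\in\{BS,B,S\}$ and let $\Sigma$ be a finite alphabet. For a language $L\subseteq\Sigma^\omega$ the following are equivalent: (1) $L$ is $\omega T$-regular; (2) $L$ is recognized by a hierarchical $\omega T$-automaton; (3) $L$ is recognized by an $\omega T$-automaton.
   Context: Regular expressions with bounds: a word sequence over $\Sigma$ is a finite or infinite sequence $\vec u=\langle u_0,u_1,\dots\rangle$ of finite words, of length $|\vec u|\in\mathbb N\cup\{\infty\}$. An infinite sequence of naturals is bounded if $\limsup<\infty$, strongly unbounded if $\liminf=+\infty$. For non-decreasing $g$ (finite or infinite), $g'(i)=g(i+1)-g(i)$ for $i+1<|g|$; $g$ has bounded (resp. strongly unbounded) difference if $g'$ is finite or bounded (resp. finite or strongly unbounded). For languages $K,L$ of word sequences: $K\cdot L=\{\langle u_0v_0,u_1v_1,\dots\rangle:\vec u\in K,\vec v\in L,|\vec u|=|\vec v|\}$; mix $K+L$ = set of $\vec w$ with $|\vec w|=\max(|\vec u|,|\vec v|)$ and $w_i\in\{u_i\}\cup\{v_i\}$ for all $i<|\vec w|$, for some $\vec u\in K,\vec v\in L$ (with $\{u_i\}=\emptyset$ if $i\ge|\vec u|$, same for $v$); $L^*=\{\langle u_0\cdots u_{g(0)-1},u_{g(0)}\cdots u_{g(1)-1},\dots\rangle:\vec u\in L, g$ non-decreasing with values $\le|\vec u|\}$; $L^B$, $L^S$ likewise with $g$ of bounded, resp. strongly unbounded, difference. $BS$-regular expressions $e::=\emptyset\mid\varepsilon\mid\bar\varepsilon\mid a\mid e\cdot e\mid e+e\mid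 e^*\mid e^B\mid e^S$ with $[\![\emptyset]\!]=\{\langle\rangle\}$, $[\![\bar\varepsilon]\!]$ = finite sequences of empty words, $[\![\varepsilon]\!]=[\![\bar\varepsilon]\!]\cup\{\langle\varepsilon,\varepsilon,\dots\rangle\}$, $[\![a]\!]$ = all finite or infinite sequences of the word $a$, other constructors by the operations above; $B$-regular = no $S$, $S$-regular = no $B$. $\langle u_0,u_1,\dots\rangle^\omega=u_0u_1\cdots$ (defined when infinitely many $u_i$ nonempty). An $\omega BS$-regular expression $\sum_{i=1}^n e_i\cdot f_i^\omega$ ($e_i$ ordinary regular expressions, $f_i$ $BS$-regular) denotes $\bigcup_i[\![e_i]\!]\cdot[\![f_i]\!]^\omega$; it is $\omega B$- (resp. $\omega S$-) regular if all $f_i$ are $B$- (resp. $S$-) regular; $\omega T$-regular languages are those denoted by such expressions. Automata: an $\omega BS$-automaton is $(Q,\Sigma,q_I,\Gamma_B,\Gamma_S,\delta)$ with $Q$ finite, $q_I\in Q$, $\Gamma_B,\Gamma_S$ disjoint finite sets of counters, $\Gamma=\Gamma_B\cup\Gamma_S$, and $\delta_a\subseteq Q\times\{\mathrm i,\mathrm r,\epsilon\}^\Gamma\times Q$ for each $a\in\Sigma$. A run over $a_1a_2\cdots$ is a sequence of transitions $t_1t_2\cdots$ with $t_j\in\delta_{a_j}$ and the target of $t_j$ equal to the source of $t_{j+1}$. For a counter $\alpha$, write $\rho=\rho_1t_{n_1}\rho_2t_{n_2}\cdots$ where the $t_{n_j}$ are exactly the transitions with action $\mathrm r$ on $\alpha$;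 $\alpha(\rho)$ is the sequence whose $j$-th term is the number of transitions in $\rho_j$ with action $\mathrm i$ on $\alpha$. The run is accepting if it starts in $q_I$ and for every counter $\alpha$, $\alpha(\rho)$ is infinite, bounded if $\alpha\in\Gamma_B$, strongly unbounded if $\alpha\in\Gamma_S$. An $\omega B$-automaton has $\Gamma_S=\emptyset$, an $\omega S$-automaton has $\Gamma_B=\emptyset$. An automaton is hierarchical if $\Gamma=\{1,\dots,n\}$ and in every transition, whenever a counter $k>1$ has action $\mathrm i$ or $\mathrm r$, the counters $1,\dots,k-1$ all have action $\mathrm r$. *)

(* Defs.v *)
From HB Require Import structures.
From mathcomp Require Import all_boot.

Set Implicit Arguments.
Unset Strict Implicit.
Unset Printing Implicit Defensive.

(* limsup x < oo and liminf x = +oo for sequences of natural numbers, with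
   limsup and liminf unfolded. *)
Definition bounded (x : nat -> nat) : Prop :=
  exists K N, forall i, N <= i -> x i <= K.

Definition strongly_unbounded (x : nat -> nat) : Prop :=
  forall K, exists N, forall i, N <= i -> K <= x i.

Inductive fiseq (T : Type) : Type :=
  | Fin of seq T
  | Inf of nat -> T.

(* Lengths live in N + {oo}, with None standing for oo. *)
Definition len (T : Type) (u : fiseq T) : option nat :=
  match u with Fin s => Some (size s) | Inf _ => None end.

Definition lt_len (i : nat) (l : option nat) : bool :=
  if l is Some n then i < n else true.

Definition le_len (i : nat) (l : option nat) : bool :=
  if l is Some n then i <= n else true.

Definition max_len (l1 l2 : option nat) : option nat :=
  match l1, l2 with Some m, Some n => Some (maxn m n) | _, _ => None end.

(* The default x0 is only returned at indices i >= |u|. *)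
Definition term (T : Type) (x0 : T) (u : fiseq T) (i : nat) : T :=
  match u with Fin s => nth x0 s i | Inf f => f i end.

Definition nondecreasing (g : fiseq nat) : Prop :=
  forall i, lt_len i.+1 (len g) -> term 0 g i <= term 0 g i.+1.

Definition bounded_diff (g : fiseq nat) : Prop :=
  match g with
  | Fin _ => True
  | Inf f => bounded (fun i => f i.+1 - f i)
  end.

Definition strongly_unbounded_diff (g : fiseq nat) : Prop :=
  match g with
  | Fin _ => True
  | Inf f => strongly_unbounded (fun i => f i.+1 - f i)
  end.

Section WordSequences.
Variable Sigma : finType.

Definition word := seq Sigma.
Definition wseq := fiseq word.
Definition wlang := wseq -> Prop.

Definition wterm (u : wseq) (i : nat) : word := term [::] u i.

(* u_a u_(a+1) ... u_(b-1) *)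
Definition block (u : wseq) (a b : nat) : word :=
  \big[cat/[::]]_(a <= j < b) wterm u j.

Definition constant_wseq (x : word) (w : wseq) : Prop :=
  forall i, lt_len i (len w) -> wterm w i = x.

Definition wconcat (K L : wlang) : wlang := fun w =>
  exists u v, [/\ K u, L v, len u = len v, len w = len u
    & forall i, lt_len i (len w) -> wterm w i = wterm u i ++ wterm v i].

Definition wmix (K L : wlang) : wlang := fun w =>
  exists u v, [/\ K u, L v, len w = max_len (len u) (len v)
    & forall i, lt_len i (len w) ->
        (lt_len i (len u) /\ wterm w i = wterm u i) \/
        (lt_len i (len v) /\ wterm w i = wterm v i)].

(* Common shape of the three exponents: D is the condition on g. *)
Definition wgroup (D : fiseq nat -> Prop) (L : wlang) : wlang := fun w =>
  exists u g,
    [/\ L u, nondecreasing g,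
        forall i, lt_len i (len g) -> le_len (term 0 g i) (len u)
      & D g] /\
    [/\ len w = len g
      & forall i, lt_len i (len w) ->
          wterm w i = block u (if i is i'.+1 then term 0 g i' else 0)
                              (term 0 g i)].

Definition wstar : wlang -> wlang := wgroup (fun _ => True).
Definition wBexp : wlang -> wlang := wgroup bounded_diff.
Definition wSexp : wlang -> wlang := wgroup strongly_unbounded_diff.

Inductive bsexp : Type :=
  | BSempty
  | BSeps
  | BSepsbar
  | BSletter of Sigma
  | BSconcat of bsexp & bsexp
  | BSmix of bsexp & bsexp
  | BSstar of bsexp
  | BSexpB of bsexp
  | BSexpS of bsexp.

Fixpoint bs_lang (e : bsexp) : wlang :=
  match e with
  | BSempty => fun w => w = Fin [::]
  | BSeps => constant_wseq [::]
  | BSepsbar => fun w => len w <> None /\ constant_wseq [::] w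
  | BSletter a => constant_wseq [:: a]
  | BSconcat e1 e2 => wconcat (bs_lang e1) (bs_lang e2)
  | BSmix e1 e2 => wmix (bs_lang e1) (bs_lang e2)
  | BSstar e1 => wstar (bs_lang e1)
  | BSexpB e1 => wBexp (bs_lang e1)
  | BSexpS e1 => wSexp (bs_lang e1)
  end.

Inductive regexp : Type :=
  | Rempty
  | Reps
  | Rletter of Sigma
  | Rconcat of regexp & regexp
  | Rplus of regexp & regexp
  | Rstar of regexp.

Fixpoint reg_lang (e : regexp) : word -> Prop :=
  match e with
  | Rempty => fun _ => False
  | Reps => fun x => x = [::]
  | Rletter a => fun x => x = [:: a]
  | Rconcat e1 e2 => fun x =>
      exists y z, [/\ reg_lang e1 y, reg_lang e2 z & x = y ++ z]
  | Rplus e1 e2 => fun x => reg_lang e1 x \/ reg_lang e2 x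
  | Rstar e1 => fun x =>
      exists ys : seq word,
        (forall y, y \in ys -> reg_lang e1 y) /\ x = flatten ys
  end.

Definition omega_word := nat -> Sigma.

Definition prefix_of (x : word) (w : omega_word) : Prop :=
  mkseq w (size x) = x.

(* w = u_0 u_1 ... is expressed by saying that each u_0 ... u_(n-1) is a
   prefix of w, which determines w as infinitely many u_i are nonempty. *)
Definition omega_power (L : wlang) (w : omega_word) : Prop :=
  exists u : nat -> word,
    [/\ L (Inf u),
        forall n, exists2 i, n <= i & u i != [::]
      & forall n, prefix_of (block (Inf u) 0 n) w].

Definition omega_concat (K : word -> Prop) (L : omega_word -> Prop)
    (w : omega_word) : Prop :=
  exists x, [/\ K x, prefix_of x w & L (fun i => w (size x + i))].

End WordSequences.

Arguments BSempty {Sigma}.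
Arguments BSeps {Sigma}.
Arguments BSepsbar {Sigma}.
Arguments Rempty {Sigma}.
Arguments Reps {Sigma}.

Inductive kind : Type := KindBS | KindB | KindS.

Definition allows_B (T : kind) : bool := if T is KindS then false else true.
Definition allows_S (T : kind) : bool := if T is KindB then false else true.

Fixpoint T_regular (Sigma : finType) (T : kind) (e : bsexp Sigma) : bool :=
  match e with
  | BSempty | BSeps | BSepsbar | BSletter _ => true
  | BSconcat e1 e2 | BSmix e1 e2 => T_regular T e1 && T_regular T e2
  | BSstar e1 => T_regular T e1
  | BSexpB e1 => allows_B T && T_regular T e1
  | BSexpS e1 => allows_S T && T_regular T e1
  end.

Definition omega_T_regular (Sigma : finType) (T : kind)
    (L : omega_word Sigma -> Prop) : Prop :=
  exists (n : nat) (e : 'I_n -> regexp Sigma) (f : 'I_n -> bsexp Sigma),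
    (forall i, T_regular T (f i)) /\
    (forall w, L w <-> exists i : 'I_n,
       omega_concat (reg_lang (e i)) (omega_power (bs_lang (f i))) w).

Inductive action : Type := Incr | Reset | NoAct.

Definition action_to_ord (a : action) : 'I_3 :=
  match a with Incr => inord 0 | Reset => inord 1 | NoAct => inord 2 end.

Definition ord_to_action (i : 'I_3) : action :=
  match val i with 0 => Incr | 1 => Reset | _ => NoAct end.

Lemma action_to_ordK : cancel action_to_ord ord_to_action.
Proof. by case; rewrite /ord_to_action /= inordK. Qed.

HB.instance Definition _ := Finite.copy action (can_type action_to_ordK).

Definition transition (Q Gamma : finType) : finType :=
  (Q * {ffun Gamma -> action} * Q)%type.

Record automaton (Sigma Gamma : finType) : Type := Automaton {
  state : finType;
  init : state;
  Gamma_B : {set Gamma};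
  Gamma_S : {set Gamma};
  Gamma_disjoint : [disjoint Gamma_B & Gamma_S];
  Gamma_cover : Gamma_B :|: Gamma_S = [set: Gamma];
  delta : Sigma -> {set transition state Gamma}
}.

Section Runs.
Variables (Sigma Gamma : finType) (A : automaton Sigma Gamma).
Local Notation transition := (transition (state A) Gamma).

Definition source (t : transition) : state A := t.1.1.
Definition act (t : transition) (c : Gamma) : action := t.1.2 c.
Definition target (t : transition) : state A := t.2.

Definition is_run (w : omega_word Sigma) (rho : nat -> transition) : Prop :=
  forall j, rho j \in delta A (w j) /\ target (rho j) = source (rho j.+1).

(* The counter sequence c(rho) is infinite and equal to x; n enumerates
   increasingly the positions of the resets of c along rho. *)
Definition infinite_counter_seq (rho : nat -> transition) (c : Gamma)
    (x : nat -> nat) : Prop :=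
  exists n : nat -> nat,
    [/\ forall j, n j < n j.+1,
        forall k, act (rho k) c = Reset <-> exists j, n j = k
      & forall j, x j =
          \sum_((if j is j'.+1 then (n j').+1 else 0) <= k < n j)
             (act (rho k) c == Incr)].

Definition accepting (rho : nat -> transition) : Prop :=
  source (rho 0) = init A /\
  forall c : Gamma, exists x,
    [/\ infinite_counter_seq rho c x,
        c \in Gamma_B A -> bounded x
      & c \in Gamma_S A -> strongly_unbounded x].

Definition recognizes (L : omega_word Sigma -> Prop) : Prop :=
  forall w, L w <-> exists rho, is_run w rho /\ accepting rho.

Definition is_T_automaton (T : kind) : Prop :=
  match T with
  | KindBS => True
  | KindB => Gamma_S A = set0
  | KindS => Gamma_B A = set0
  end.

End Runs.

(* The counters 1, ..., n are numbered 0, ..., n-1 here. *)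
Definition hierarchical (Sigma : finType) (n : nat)
    (A : automaton Sigma 'I_n) : Prop :=
  forall (a : Sigma) (t : transition (state A) 'I_n), t \in delta A a ->
  forall k : 'I_n, act t k = Incr \/ act t k = Reset ->
  forall j : 'I_n, j < k -> act t j = Reset.

(* Main.v *)
Require Import Defs.
From mathcomp Require Import all_boot.
From mathcomp Require Import zify.
From Stdlib Require Import ClassicalEpsilon.

(* For thresholds k and l, let a BS-expression denote the language of finite
   words in which B-iterations have length at most k and S-iterations length at
   least l. A word sequence belongs to the expression iff, for some k, all its
   terms lie at level (k, 0) and, for every l, almost all of them at level
   (k, l). The theorem thus reduces to languages of finite words graded by
   (k, l), considered up to a change of thresholds.

   From automata to expressions. The finite runs with given endpoints and given
   type (the set of counters that are incremented, the set of those that are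
   reset) are expressible, by induction on the type: a run is cut greedily into
   minimal factors having the full type, followed by a rest of smaller type, and
   the factors are iterated by Kleene's algorithm with *, B or S. An interval
   between two resets that crosses a cut has many increments iff one of its two
   sides has, so the endpoints also carry, for each counter, the claim of which
   side it is. An accepting run is finally cut at positions with a recurrent
   state and recurrent claims.

   From expressions to hierarchical automata. The words of an expression are
   projections of words over an alphabet of letters with hierarchical counter
   operations. As an S-counter may not be reset when it is unused, words are
   classified by the number of S-counters they use, and each iteration is
   stratified by this level: (X + Y)^B is built from X^B and (X^B Y)^B, while in
   (X + Y)^S it suffices to count either the words of Y along (X^* Y)^S, or the
   words of X in a long factor X^S. *)

Set Implicit Arguments.
Unset Strict Implicit.
Unset Printing Implicit Defensive.

(** * Sequences and infinite concatenations *)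

(** Changing thresholds is delicate in two ways. The bound k must be chosen before l, since one k
    serves a whole sequence. Moreover a translation may succeed only at high levels, so that
    finitely many terms are lost. Hence [approx] is exact in l for soundness and only eventual for
    completeness, and the omega-power has two forms, [om] and [eom]: lost factors move into the
    finite prefix, a regular language once all exponents are read as stars. The obstacle for
    expressions is the S-counter. A cut halves the number of increments guaranteed on one side of
    it, which is affordable for a bounded number of cuts but not along an iteration. There, either
    every factor resets the counter, and all cuts together cost one factor 2, or no factor does, and
    the length of the iteration supplies the increments. The obstacle for automata is that each
    counter must be reset infinitely often, and an S-counter only after many increments. The words
    that recur in an omega-power may use few counters; they are wrapped in further iterations, which
    leave the omega-power unchanged, until all counters are in use. *)

Lemma fun_choice (A B : Type) (R : A -> B -> Prop) :
  (forall x, exists y, R x y) -> exists f, forall x, R x (f x).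
Proof.
move=> H; exists (fun x => proj1_sig (constructive_indefinite_description _ (H x))).
by move=> x; case: constructive_indefinite_description.
Qed.

Lemma nat_minimal (P : nat -> Prop) :
  (exists n, P n) -> exists n, P n /\ forall i, P i -> n <= i.
Proof.
case=> n Pn; apply: NNPP => H.
suff F : forall b i, i < b -> ~ P i by exact: (F n.+1 n).
elim=> // b IH i; rewrite ltnS leq_eqVlt => /orP[/eqP -> Pb|]; last exact: IH.
apply: H; exists b; split=> // i' Pi'; rewrite leqNgt; apply/negP => /IH.
exact.
Qed.

(** Each term is the least element of [D] beyond the previous one, so none is skipped: if [D t]
    holds, the first term that is at least t equals t. *)
Lemma enum_infinite (D : nat -> Prop) :
  (forall n, exists2 i, n <= i & D i) ->
  exists g : nat -> nat,
    [/\ forall i, g i < g i.+1, forall i, D (g i)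
      & forall t, D t <-> exists i, g i = t].
Proof.
move=> H.
have /fun_choice [nx nxP] : forall n, exists m, [/\ n <= m, D m
    & forall i, n <= i -> D i -> m <= i].
  move=> n; have [|i [[ni Di] Hm]] := @nat_minimal (fun i => n <= i /\ D i).
    by have [i] := H n; exists i.
  by exists i; split=> // i' ? ?; apply: Hm.
pose g := fix g i := if i is i'.+1 then nx (g i').+1 else nx 0.
have gS i : g i < g i.+1 by rewrite /=; case: (nxP (g i).+1).
have gD i : D (g i) by case: i => [|i] /=; [case: (nxP 0)|case: (nxP (g i).+1)].
exists g; split=> // t; split=> [Dt|[i <-] //].
have ti i : i <= g i by elim: i => // i IH; apply: leq_ltn_trans (gS i).
have [i [Hi Hm]] := @nat_minimal (fun i => t <= g i) (ex_intro _ t (ti t)).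
exists i; apply/eqP; rewrite eqn_leq Hi andbT.
case: i Hi Hm => [|i] Hi Hm /=; first by case: (nxP 0) => _ _; apply.
case: (nxP (g i).+1) => _ _; apply=> //; rewrite ltnNge; apply/negP => /Hm.
by rewrite ltnn.
Qed.

Lemma strict_mono_le (g : nat -> nat) : (forall i, g i < g i.+1) ->
  forall i j, i <= j -> g i <= g j.
Proof.
move=> H i j /subnK <-; elim: (j - i) => // d IH; rewrite addSn.
exact: leq_trans IH (ltnW (H _)).
Qed.

Lemma strict_mono_ge (g : nat -> nat) : (forall i, g i < g i.+1) ->
  forall i, i <= g i.
Proof. by move=> H; elim=> // i IH; apply: leq_ltn_trans IH (H _). Qed.

Lemma infinite_pigeonhole (I : finType) (f : nat -> I) (D : nat -> Prop) :
  (forall n, exists2 i, n <= i & D i) ->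
  exists c, forall n, exists2 i, n <= i & D i /\ f i = c.
Proof.
move=> H; apply: NNPP => Hn.
have /fin_all_exists [b Hb] : forall c, exists n, forall i, n <= i -> D i -> f i <> c.
  move=> c; apply: NNPP => Hc; apply: Hn; exists c => n; apply: NNPP => Hd.
  apply: Hc; exists n => i ni Di fi; apply: Hd; by exists i.
have [i Hi Di] := H (\max_c b c).
exact: (Hb (f i) i (leq_trans (leq_bigmax _) Hi) Di).
Qed.

Definition seg (A : Type) (s : nat -> A) (a b : nat) : seq A :=
  [seq s i | i <- index_iota a b].

Section Segments.
Variables (A : Type) (s : nat -> A).

Lemma size_seg a b : size (seg s a b) = b - a.
Proof. by rewrite size_map size_iota. Qed.

Lemma nth_seg x0 a b i : i < b - a -> nth x0 (seg s a b) i = s (a + i).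
Proof. by move=> H; rewrite (nth_map 0) ?size_iota // nth_iota. Qed.

Lemma seg_cat a b c : a <= b -> b <= c -> seg s a c = seg s a b ++ seg s b c.
Proof.
move=> ab bc; rewrite /seg /index_iota -map_cat; congr map.
have -> : c - a = (b - a) + (c - b) by rewrite -[in RHS](addnC (c - b)) addnBA // subnK.
by rewrite iotaD subnKC.
Qed.

Lemma seg_nil a b : b <= a -> seg s a b = [::].
Proof. by rewrite /seg /index_iota -subn_eq0 => /eqP ->. Qed.

Lemma seg_cons a b : a < b -> seg s a b = s a :: seg s a.+1 b.
Proof.
by move=> H; rewrite (seg_cat (leqnSn a) H) {1}/seg /index_iota subSnn.
Qed.

Lemma seg1 a : seg s a a.+1 = [:: s a].
Proof. by rewrite seg_cons // seg_nil. Qed.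

Lemma seg_rcons a b : a <= b -> seg s a b.+1 = rcons (seg s a b) (s b).
Proof. by move=> H; rewrite (seg_cat H (leqnSn b)) seg1 cats1. Qed.

Lemma mkseq_seg n : mkseq s n = seg s 0 n.
Proof. by rewrite /mkseq /seg /index_iota subn0. Qed.

End Segments.

Lemma map_seg (A B : Type) (f : A -> B) s a b :
  map f (seg s a b) = seg (fun i => f (s i)) a b.
Proof. by rewrite /seg -map_comp. Qed.

Lemma seg_shift (A : Type) (s : nat -> A) c a b :
  seg (fun i => s (c + i)) a b = seg s (c + a) (c + b).
Proof.
by rewrite /seg /index_iota subnDl iotaDl -map_comp.
Qed.

Section InfiniteFlatten.
Variables (A : Type) (x0 : A) (f : nat -> seq A).

Definition cut (n : nat) : nat := size (flatten (seg f 0 n)).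

Lemma flatten_segS n : flatten (seg f 0 n.+1) = flatten (seg f 0 n) ++ f n.
Proof. by rewrite seg_rcons // flatten_rcons. Qed.

Lemma cutS n : cut n.+1 = cut n + size (f n).
Proof. by rewrite /cut flatten_segS size_cat. Qed.

Lemma leq_cut m n : m <= n -> cut m <= cut n.
Proof.
move=> H; rewrite /cut (seg_cat _ (leq0n m) H) flatten_cat size_cat.
exact: leq_addr.
Qed.

Lemma nth_flatten_seg m n j : m <= n -> j < cut m ->
  nth x0 (flatten (seg f 0 n)) j = nth x0 (flatten (seg f 0 m)) j.
Proof.
by move=> H jm; rewrite (seg_cat _ (leq0n m) H) flatten_cat nth_cat jm.
Qed.

Lemma cut_find j n : j < cut n -> exists2 i, i < n & cut i <= j < cut i.+1.
Proof.
elim: n => // n IH H; case: (ltnP j (cut n)) => [/IH [i ? ?]|Hn].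
  by exists i => //; apply: ltnW.
by exists n; rewrite ?Hn.
Qed.

Lemma nth_flatten_cut i j n : i < n -> cut i <= j < cut i.+1 ->
  nth x0 (flatten (seg f 0 n)) j = nth x0 (f i) (j - cut i).
Proof.
move=> Hin /andP[H1 H2]; rewrite (nth_flatten_seg Hin H2) flatten_segS nth_cat.
by rewrite -/(cut i) ltnNge H1.
Qed.

(** Letter j is read off the first [N j] blocks, a number of blocks covering position j; all longer
    concatenations agree there. *)
Lemma flatten_stream : (forall n, exists2 i, n <= i & 0 < size (f i)) ->
  exists s : nat -> A, forall n, seg s 0 (cut n) = flatten (seg f 0 n).
Proof.
move=> H.
have unb j : exists n, j < cut n.
  elim: j => [|j [n Hn]].
    by have [i _ Hi] := H 0; exists i.+1; rewrite cutS (leq_trans Hi) ?leq_addl.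
  have [i Hi fi] := H n; exists i.+1; rewrite cutS.
  by rewrite -addn1 leq_add // (leq_trans Hn) // leq_cut.
have [N HN] := fun_choice unb.
exists (fun j => nth x0 (flatten (seg f 0 (N j))) j) => n.
apply: (@eq_from_nth _ x0) => [|j]; rewrite size_seg subn0 // => Hj.
rewrite nth_seg ?subn0 // add0n.
case: (leqP n (N j)) => Hn; first by rewrite (nth_flatten_seg Hn).
by rewrite [RHS](@nth_flatten_seg (N j)) // ltnW.
Qed.

(* A sequence of blocks may be eventually empty, in which case its
   concatenation is finite. *)
Lemma flatten_fiseq : exists u : fiseq A,
  [/\ forall n, le_len (cut n) (len u),
      forall n j, j < cut n -> term x0 u j = nth x0 (flatten (seg f 0 n)) j
    & forall j, lt_len j (len u) -> exists n, j < cut n].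
Proof.
have [H|H] := classic (forall n, exists2 i, n <= i & 0 < size (f i)).
  have [s Hs] := flatten_stream H; exists (Inf s); split=> // [n j Hj|j _] /=.
    by rewrite -Hs nth_seg ?subn0.
  apply: NNPP => Hn; have {}Hn : forall n, cut n <= j.
    by move=> n; rewrite leqNgt; apply/negP => Hj; apply: Hn; exists n.
  suff [n Hc] : exists n, j.+1 <= cut n by move: (leq_trans Hc (Hn n)); rewrite ltnn.
  elim: {Hn} j.+1 => [|b [n Hb]]; first by exists 0.
  have [i ni Hi] := H n; exists i.+1; rewrite cutS -addn1 leq_add //.
  exact: leq_trans (leq_cut ni).
have [N HN] : exists N, forall i, N <= i -> f i = [::].
  apply: NNPP => HN; apply: H => n; apply: NNPP => Hi; apply: HN; exists n => i ni.
  by apply/nilP; rewrite /nilp -leqn0 leqNgt; apply/negP => Hs; apply: Hi; exists i.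
have cutN n : cut n <= cut N.
  case: (leqP n N) => [/leq_cut //|/ltnW Hn].
  suff -> : cut n = cut N by [].
  rewrite -(subnK Hn); elim: (n - N) => // d IH; rewrite addSn cutS IH HN ?addn0 //.
  exact: leq_addl.
exists (Fin (flatten (seg f 0 N))); split=> // [n j Hj|j Hj] /=; last by exists N.
case: (leqP n N) => Hn; first by rewrite (@nth_flatten_seg n N).
by rewrite [RHS](@nth_flatten_seg N) // ?(leq_trans Hj) // ltnW.
Qed.

End InfiniteFlatten.

(** * Graded languages *)

Record glang (A : Type) := Glang {
  gl :> nat -> nat -> seq A -> Prop;
  gl_mono : forall k k' l l' u, k <= k' -> l' <= l -> gl k l u -> gl k' l' u }.

Definition gconst (A : Type) (P : seq A -> Prop) : glang A :=
  @Glang A (fun _ _ => P) (fun _ _ _ _ _ _ _ H => H).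

Lemma gexact0_mono (A : Type) (P : seq A -> Prop) k k' l l' (u : seq A) :
  k <= k' -> l' <= l -> l = 0 /\ P u -> l' = 0 /\ P u.
Proof. by move=> _ H [l0 Pu]; split=> //; apply/eqP; rewrite -leqn0 -l0. Qed.

(** Meant for [BSepsbar]: words exist at lower threshold 0 only, whereas an infinite sequence must
    eventually reach threshold 1, so only finite sequences remain. *)
Definition gexact0 (A : Type) (P : seq A -> Prop) : glang A :=
  Glang (@gexact0_mono A P).

Definition gunion (A I : Type) (X : I -> glang A) : glang A.
Proof.
exists (fun k l u => exists i, X i k l u).
by move=> k k' l l' u Hk Hl [i Hi]; exists i; apply: gl_mono Hi.
Defined.

Definition gor (A : Type) (X Y : glang A) : glang A.
Proof.
exists (fun k l u => X k l u \/ Y k l u).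
by move=> k k' l l' u Hk Hl [H|H]; [left|right]; apply: gl_mono H.
Defined.

Definition gwhen (A : Type) (b : Prop) (X : glang A) : glang A.
Proof.
exists (fun k l u => b /\ X k l u).
by move=> k k' l l' u Hk Hl [? H]; split=> //; apply: gl_mono H.
Defined.

Definition gne (A : Type) (X : glang A) : glang A.
Proof.
exists (fun k l u => u <> [::] /\ X k l u).
by move=> k k' l l' u Hk Hl [? H]; split=> //; apply: gl_mono H.
Defined.

Definition gcat (A : Type) (X Y : glang A) : glang A.
Proof.
exists (fun k l u => exists y z, [/\ X k l y, Y k l z & u = y ++ z]).
move=> k k' l l' u Hk Hl [y [z [Hy Hz ->]]]; exists y, z.
by split=> //; [apply: gl_mono Hy|apply: gl_mono Hz].
Defined.

Variant arity := AnyCount | AtMost | AtLeast.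

Definition count_ok (c : arity) (k l s : nat) : bool :=
  match c with AnyCount => true | AtMost => s <= k | AtLeast => l <= s end.

Lemma count_ok_mono c k k' l l' s : k <= k' -> l' <= l ->
  count_ok c k l s -> count_ok c k' l' s.
Proof. by case: c => //= Hk Hl H; [apply: leq_trans Hk|apply: leq_trans Hl _]. Qed.

Definition gexp (A : eqType) (c : arity) (X : glang A) : glang A.
Proof.
exists (fun k l u => exists ys : seq (seq A), [/\ count_ok c k l (size ys),
  forall y, y \in ys -> X k l y & u = flatten ys]).
move=> k k' l l' u Hk Hl [ys [H1 H2 ->]]; exists ys; split=> //.
  exact: count_ok_mono H1.
by move=> y /H2; apply: gl_mono.
Defined.

Definition gplus (A : eqType) (c : arity) (X : glang A) : glang A.
Proof.
exists (fun k l u => exists ys : seq (seq A), [/\ count_ok c k l (size ys), ys <> [::],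
  forall y, y \in ys -> X k l y & u = flatten ys]).
move=> k k' l l' u Hk Hl [ys [H1 H2 H3 ->]]; exists ys; split=> //.
  exact: count_ok_mono H1.
by move=> y /H3; apply: gl_mono.
Defined.

Fixpoint sem (A : finType) (e : bsexp A) : glang A :=
  match e with
  | BSempty => gconst (fun _ => False)
  | BSeps => gconst (fun u => u = [::])
  | BSepsbar => gexact0 (fun u => u = [::])
  | BSletter a => gconst (fun u => u = [:: a])
  | BSconcat e1 e2 => gcat (sem e1) (sem e2)
  | BSmix e1 e2 => gor (sem e1) (sem e2)
  | BSstar e1 => gexp AnyCount (sem e1)
  | BSexpB e1 => gexp AtMost (sem e1)
  | BSexpS e1 => gexp AtLeast (sem e1)
  end.

Lemma nat_bound (P : nat -> nat -> Prop) n :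
  (forall i k k', k <= k' -> P i k -> P i k') ->
  (forall i, i < n -> exists k, P i k) -> exists k, forall i, i < n -> P i k.
Proof.
move=> Pm; elim: n => [|n IH] H; first by exists 0.
have [i Hi|k Hk] := IH; first exact/H/ltnW.
have [k' Hk'] := H n (ltnSn n); exists (maxn k k') => i.
rewrite ltnS leq_eqVlt => /orP[/eqP ->|/Hk].
  by apply: Pm Hk'; apply: leq_maxr.
by apply: Pm; apply: leq_maxl.
Qed.

(** * Word sequences described by graded languages *)

Section Characterization.
Variable A : finType.
Implicit Types (X Y : glang A) (u w : wseq A).

Definition gseq X u := exists k,
  (forall i, lt_len i (len u) -> X k 0 (wterm u i)) /\
  (forall l, exists N, forall i, N <= i -> lt_len i (len u) -> X k l (wterm u i)).

Lemma eventual_levels (k : nat) X (D : nat -> Prop) (f : nat -> seq A) :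
  (forall i, D i -> X k 0 (f i)) ->
  (forall l, exists N, forall i, N <= i -> D i -> X k l (f i)) ->
  exists2 lv, strongly_unbounded lv & forall i, D i -> X k (lv i) (f i).
Proof.
move=> H0 /fun_choice [N HN].
(* Diagonal choice: the largest l already granted at index i. Capping l by i keeps the maximum
   finite and still lets it tend to infinity. *)
exists (fun i => \max_(l < i.+1 | N l <= i) l).
  move=> K; exists (maxn K (N K)) => i; rewrite geq_max => /andP[Ki NKi].
  exact: (@leq_bigmax_cond _ _ _ (Ordinal (Ki : K < i.+1))).
move=> i Di; elim/big_ind: _ => [|x y Hx Hy|l Hl]; first exact: H0.
  by case: (leqP x y).
exact: HN.
Qed.

(** With one level attached to each index, the terms of a sequence can be decomposed independently
    of each other. *)
Lemma gseqP X u : gseq X u <-> exists k lv, strongly_unbounded lv /\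
  forall i, lt_len i (len u) -> X k (lv i) (wterm u i).
Proof.
split=> [[k [H0 H]]|[k [lv [Hlv H]]]].
  by have [lv Hlv Hk] := eventual_levels H0 H; exists k, lv.
exists k; split=> [i Hi|l]; first by apply: gl_mono (H i Hi).
have [N HN] := Hlv l; exists N => i Ni Hi.
by apply: gl_mono (H i Hi) => //; apply: HN.
Qed.

Lemma gseq_fin X (s : seq (seq A)) :
  (exists k, forall x, x \in s -> X k 0 x) -> gseq X (Fin s).
Proof.
move=> [k H]; exists k; split=> [i /= Hi|l]; first by apply/H/mem_nth.
by exists (size s) => i Hi /=; rewrite ltnNge Hi.
Qed.

Definition wremap (B : Type) (w : wseq A) (f : nat -> B) : fiseq B :=
  match w with Fin s => Fin (mkseq f (size s)) | Inf _ => Inf f end.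

Lemma len_wremap B w (f : nat -> B) : len (wremap w f) = len w.
Proof. by case: w => //= s; rewrite size_mkseq. Qed.

Lemma term_wremap B (x0 : B) w (f : nat -> B) i :
  lt_len i (len w) -> term x0 (wremap w f) i = f i.
Proof. by case: w => //= s Hi; rewrite nth_mkseq. Qed.

Lemma gseq_concat X Y w : wconcat (gseq X) (gseq Y) w <-> gseq (gcat X Y) w.
Proof.
split=> [[u [v [[k [U0 U]] [k' [V0 V]] Euv Ewu Hw]]]|].
  exists (maxn k k'); split=> [i Hi|l].
    exists (wterm u i), (wterm v i); split; last exact: Hw.
      by apply: (@gl_mono _ X k _ 0) (U0 i _); rewrite ?leq_maxl // -Ewu.
    by apply: (@gl_mono _ Y k' _ 0) (V0 i _); rewrite ?leq_maxr // -Euv -Ewu.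
  have [[N HN] [N' HN']] := (U l, V l); exists (maxn N N') => i.
  rewrite geq_max => /andP[Hi1 Hi2] Hi.
  exists (wterm u i), (wterm v i); split; last exact: Hw.
    by apply: (@gl_mono _ X k _ l) (HN i Hi1 _); rewrite ?leq_maxl // -Ewu.
  by apply: (@gl_mono _ Y k' _ l) (HN' i Hi2 _); rewrite ?leq_maxr // -Euv -Ewu.
move=> /gseqP[k [lv [Hlv H]]].
have /fun_choice [f Hf] : forall i, exists p : seq A * seq A,
    lt_len i (len w) -> [/\ X k (lv i) p.1, Y k (lv i) p.2 & wterm w i = p.1 ++ p.2].
  move=> i; case Hi : (lt_len i (len w)); last by exists ([::], [::]).
  by have [y [z Hyz]] := H i Hi; exists (y, z).
exists (wremap w (fun i => (f i).1)), (wremap w (fun i => (f i).2)).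
rewrite !len_wremap; split=> //.
- apply/gseqP; exists k, lv; split=> // i; rewrite len_wremap => Hi.
  by rewrite /wterm term_wremap //; case: (Hf i Hi).
- apply/gseqP; exists k, lv; split=> // i; rewrite len_wremap => Hi.
  by rewrite /wterm term_wremap //; case: (Hf i Hi).
- by move=> i Hi; rewrite /wterm !term_wremap //; case: (Hf i Hi).
Qed.

(* A sequence agreeing with w on D; the other positions are filled with later
   terms of w, which may only raise their levels. *)
Lemma gseq_fill X (w : nat -> seq A) k lv (D : nat -> Prop) :
  strongly_unbounded lv -> (forall i, D i -> X k (lv i) (w i)) ->
  exists u, [/\ gseq X u, forall i, D i -> lt_len i (len u) /\ wterm u i = w i
    & (forall n, exists2 i, n <= i & D i) -> len u = None].
Proof.
move=> Hlv HD.
have [Dinf|Dfin] := classic (forall n, exists2 i, n <= i & D i).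
  have /fun_choice [f Hf] : forall n, exists i, [/\ n <= i, D i & D n -> i = n].
    move=> n; have [Dn|Dn] := classic (D n); first by exists n.
    by have [i ni Di] := Dinf n; exists i.
  exists (Inf (fun n => w (f n))); split=> // [|i Di]; last first.
    by split=> //; rewrite /wterm /=; case: (Hf i) => _ _ ->.
  apply/gseqP; exists k, (fun n => lv (f n)); split=> [K|i _].
    have [N HN] := Hlv K; exists N => i Ni; apply: HN.
    by apply: leq_trans Ni _; case: (Hf i).
  by apply: HD; case: (Hf i).
have [N HN] : exists N, forall i, N <= i -> ~ D i.
  apply: NNPP => HN; apply: Dfin => n; apply: NNPP => Hi; apply: HN; exists n => i ni Di.
  by apply: Hi; exists i.
have [[i0 Di0]|Dno] := classic (exists i, D i); last first.
  exists (Fin [::]); split=> [|i Di|/Dfin []]; last by case: Dno; exists i.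
  by apply: gseq_fin; exists 0.
have /fun_choice [f Hf] : forall n, exists i, D i /\ (D n -> i = n).
  move=> n; have [Dn|Dn] := classic (D n); first by exists n.
  by exists i0.
exists (Fin (mkseq (fun n => w (f n)) N)); split=> [|i Di|/Dfin []].
  apply: gseq_fin; exists k => x /mapP[i _ ->].
  by apply: (@gl_mono _ X k _ (lv (f i))) => //; apply: HD; case: (Hf i).
have Hi : i < N by rewrite ltnNge; apply/negP => /HN.
by rewrite /= size_mkseq Hi /wterm /= nth_mkseq //; case: (Hf i) => _ ->.
Qed.

(** For the converse, each side keeps the terms of w that it owns and must be filled at the other
    positions; the lengths matter, as the longer side must be as long as w. *)
Lemma gseq_mix X Y w : wmix (gseq X) (gseq Y) w <-> gseq (gor X Y) w.
Proof.
split=> [[u [v [[k [U0 U]] [k' [V0 V]] Ew Hw]]]|].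
  exists (maxn k k'); split=> [i /Hw[[Hi ->]|[Hi ->]]|l].
  - by left; apply: (@gl_mono _ X k _ 0) (U0 i _); rewrite ?leq_maxl.
  - by right; apply: (@gl_mono _ Y k' _ 0) (V0 i _); rewrite ?leq_maxr.
  have [[N HN] [N' HN']] := (U l, V l); exists (maxn N N') => i.
  rewrite geq_max => /andP[Hi1 Hi2] /Hw[[Hi ->]|[Hi ->]].
    by left; apply: (@gl_mono _ X k _ l) (HN i _ _); rewrite ?leq_maxl.
  by right; apply: (@gl_mono _ Y k' _ l) (HN' i _ _); rewrite ?leq_maxr.
case: w => [s|w] /gseqP[k [lv [Hlv H]]]; last first.
  pose D1 i := X k (lv i) (w i); pose D2 i := Y k (lv i) (w i).
  have [u [Hu Du Iu]] := @gseq_fill X w k lv D1 Hlv (fun _ h => h).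
  have [v [Hv Dv Iv]] := @gseq_fill Y w k lv D2 Hlv (fun _ h => h).
  exists u, v; split=> // [|i _]; last first.
    by case: (H i isT) => [/Du [? ->]|/Dv [? ->]]; [left|right].
  (* If [X] owns infinitely many terms then u is infinite; otherwise [Y] owns almost all of them and
     v is infinite. *)
  rewrite /=; apply: NNPP => Hn.
  have [H1|H1] := classic (forall n, exists2 i, n <= i & D1 i).
    by apply: Hn; rewrite Iu.
  apply: Hn; rewrite Iv ?[RHS]/=; first by case: (len u).
  move=> n; apply: NNPP => Hi; apply: H1 => n'; exists (maxn n n'); first exact: leq_maxr.
  case: (H (maxn n n') isT) => // HY; case: Hi.
  by exists (maxn n n'); first exact: leq_maxl.
(* Finite case: a side owning no term is the empty sequence, any other side is padded to full length
   by repeating a term it owns. *)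
have selP Z : exists u, [/\ gseq Z u, len u = Some (size s) \/ len u = Some 0 &
    forall i, i < size s -> Z k 0 (nth [::] s i) ->
     len u = Some (size s) /\ wterm u i = nth [::] s i].
  have [[j [jn Zj]]|Zno] := classic (exists j, j < size s /\ Z k 0 (nth [::] s j)).
    have /fun_choice [f Hf] : forall i, exists j, Z k 0 (nth [::] s j) /\
        (Z k 0 (nth [::] s i) -> j = i).
      move=> i; have [Zi|Zi] := classic (Z k 0 (nth [::] s i)); first by exists i.
      by exists j.
    exists (Fin (mkseq (fun i => nth [::] s (f i)) (size s))); split.
    - by apply: gseq_fin; exists k => x /mapP[i _ ->]; case: (Hf i).
    - by left; rewrite /= size_mkseq.
    - move=> i Hi Zi; rewrite /= size_mkseq /wterm /= nth_mkseq //.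
      by case: (Hf i) => _ ->.
  exists (Fin [::]); split=> [||i Hi Zi]; last by case: Zno; exists i.
    by apply: gseq_fin; exists 0.
  by right.
have [[u [X1 X2 X3]] [v [Y1 Y2 Y3]]] := (selP X, selP Y).
have H0 i : i < size s -> X k 0 (nth [::] s i) \/ Y k 0 (nth [::] s i).
  by move=> Hi; case: (H i Hi) => h; [left|right]; apply: gl_mono h.
exists u, v; split=> // [|i /= Hi]; last first.
  by case: (H0 i Hi) => [/(X3 i Hi)[-> ->]|/(Y3 i Hi)[-> ->]]; [left|right].
case: (posnP (size s)) => [s0|spos].
  by case: X2 => ->; case: Y2 => ->; rewrite /= ?s0.
case: (H0 0 spos) => [/(X3 0 spos)[-> _]|/(Y3 0 spos)[-> _]].
  by case: Y2 => ->; rewrite /= ?maxnn ?maxn0.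
by case: X2 => ->; rewrite /= ?maxnn ?max0n.
Qed.

End Characterization.

Lemma nondecreasing_le f i j : nondecreasing (Inf f) -> i <= j -> f i <= f j.
Proof.
move=> H /subnK <-; elim: (j - i) => // d IH; rewrite addSn.
exact: leq_trans IH (H _ isT).
Qed.

Lemma nondecreasing_stationary f M : nondecreasing (Inf f) ->
  (forall i, f i < M) -> exists N, forall i, N <= i -> f i = f N.
Proof.
move=> fm fM.
have [n [[i ->] Hm]] := @nat_minimal (fun n => exists i, n = M - f i)
  (ex_intro _ _ (ex_intro _ 0 erefl)).
exists i => j ij; apply/eqP; rewrite eqn_leq (nondecreasing_le fm ij) andbT.
have := Hm _ (ex_intro _ j erefl).
by rewrite leq_sub2lE // ltnW.
Qed.

Definition exponent_cond (c : arity) : fiseq nat -> Prop :=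
  match c with
  | AnyCount => fun _ => True
  | AtMost => bounded_diff
  | AtLeast => strongly_unbounded_diff
  end.

Section CharacterizationExponents.
Variable A : finType.
Implicit Types (X Y : glang A) (u w : wseq A).

Lemma block_seg u a b : block u a b = flatten (seg (wterm u) a b).
Proof.
rewrite /block /seg unlock; elim: (index_iota a b) => //= i s ->.
by [].
Qed.

Let lo (g : fiseq nat) i := if i is i'.+1 then term 0 g i' else 0.

(** The condition on differences says nothing about the first group, of size g(0), nor about
    finitely many others; these are absorbed into k for the B-exponent and skipped for the
    S-exponent. *)
Lemma group_sizes c (g : fiseq nat) : exponent_cond c g ->
  exists k, (forall i, lt_len i (len g) -> count_ok c k 0 (term 0 g i - lo g i)) /\
  forall l, exists N, forall i, N <= i -> lt_len i (len g) ->
    count_ok c k l (term 0 g i - lo g i).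
Proof.
case: c => /= Hg; first by exists 0; split=> // l; exists 0.
  suff [k Hk] : exists k, forall i, lt_len i (len g) -> term 0 g i - lo g i <= k.
    by exists k; split=> // l; exists 0 => i _; apply: Hk.
  pose P i k := term 0 g i - lo g i <= k.
  have PP n : exists k, forall i, i < n -> P i k.
    apply: nat_bound => [i k k' kk' H|i _]; first exact: leq_trans kk'.
    by exists (term 0 g i - lo g i); rewrite /P.
  case: g Hg @P PP => [s _ P /(_ (size s)) //|f [K [N HN]] P /(_ N.+1) [k Hk]].
  exists (maxn k K) => -[_|i _]; first by rewrite leq_max; apply/orP; left; apply: Hk.
  rewrite leq_max; case: (ltnP i N) => Hi; first by rewrite [X in X || _](Hk i.+1).
  by rewrite orbC (HN i Hi).
exists 0; split=> // l; case: g Hg => [s _|f Hf].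
  by exists (size s) => i Hi; rewrite /= ltnNge Hi.
have [N HN] := Hf l; exists N.+1 => -[|i] //= Hi _; exact: HN.
Qed.

(** Forwards, late groups must consist of late terms of u. Backwards, the lists into which the terms
    of w split are strung together into one sequence, with the partial lengths as group
    boundaries. *)
Lemma gseq_group c X w :
  wgroup (exponent_cond c) (gseq X) w <-> gseq (gexp c X) w.
Proof.
split=> [[u [g [[[k [U0 U]] gm gu Hg] [Ew Hw]]]]|].
  have [k' [C0 C]] := group_sizes Hg.
  have lo_le i : lt_len i (len g) -> lo g i <= term 0 g i.
    by case: i => //= i Hi; apply: gm.
  have in_u i j : lt_len i (len g) -> j < term 0 g i -> lt_len j (len u).
    by move=> /gu; case: (len u) => //= n; move=> H1 H2; apply: leq_trans H1.
  exists (maxn k k'); split=> [i Hi|l].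
    rewrite Hw // block_seg -/(lo g i); exists (seg (wterm u) (lo g i) (term 0 g i)); split=> //.
      rewrite size_seg; apply: (@count_ok_mono _ k' _ 0); rewrite ?leq_maxr //.
      by apply: C0; rewrite -Ew.
    move=> y /mapP[j]; rewrite mem_index_iota => /andP[_ Hj] ->.
    apply: (@gl_mono _ X k _ 0); rewrite ?leq_maxl //.
    by apply/U0/(in_u i) => //; rewrite -Ew.
  have [[N HN] [N0 HN0]] := (C l, U l).
  (* Either the boundaries pass [N0], or they stay below it and become stationary, so that late
     groups are empty. *)
  have [N' HN'] : exists N', forall i, N' <= i -> lt_len i (len g) ->
      lo g i < term 0 g i -> N0 <= lo g i.
    case: g {Hw Hg HN C C0 lo_le in_u gu Ew} gm => [s _|f gm].
      by exists (size s) => i Hi; rewrite /= ltnNge Hi.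
    have [[i0 Hi0]|Hn] := classic (exists i0, N0 <= f i0).
      exists i0.+1 => -[|i] //= Hi _ _.
      by apply: (leq_trans Hi0); apply: nondecreasing_le gm _.
    have [i|N1 HN1] := @nondecreasing_stationary f N0 gm.
      by rewrite ltnNge; apply/negP => H; apply: Hn; exists i.
    exists N1.+1 => -[|i] //= Hi _; rewrite (HN1 i Hi) (HN1 i.+1 (leqW Hi)).
    by rewrite ltnn.
  exists (maxn N N') => i; rewrite geq_max => /andP[Hi1 Hi2] Hi.
  have Hi' : lt_len i (len g) by rewrite -Ew.
  rewrite Hw // block_seg -/(lo g i); exists (seg (wterm u) (lo g i) (term 0 g i)); split=> //.
    rewrite size_seg; apply: (@count_ok_mono _ k' _ l); rewrite ?leq_maxr //.
    exact: HN.
  move=> y /mapP[j]; rewrite mem_index_iota => /andP[Hj1 Hj] ->.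
  apply: (@gl_mono _ X k _ l); rewrite ?leq_maxl //; apply: HN0.
    exact: leq_trans (HN' i Hi2 Hi' (leq_ltn_trans Hj1 Hj)) Hj1.
  exact: in_u Hj.
move=> /gseqP[k [lv [Hlv H]]].
have /fun_choice [f Hf] : forall i, exists ys : seq (seq A), if lt_len i (len w) then
    [/\ count_ok c k (lv i) (size ys), forall y, y \in ys -> X k (lv i) y
      & wterm w i = flatten ys] else ys = [::].
  move=> i; case Hi : (lt_len i (len w)); last by exists [::].
  by have [ys [? ? ?]] := H i Hi; exists ys.
have f_nil i : 0 < size (f i) -> lt_len i (len w).
  by have := Hf i; case: lt_len => // ->.
have {}Hf i : lt_len i (len w) -> [/\ count_ok c k (lv i) (size (f i)),
    forall y, y \in f i -> X k (lv i) y & wterm w i = flatten (f i)].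
  by move=> Hi; have := Hf i; rewrite Hi.
(* The sequence u may be finite although w is infinite, when almost all groups are empty. *)
have [u [Uc Ut Uf]] := flatten_fiseq [::] f.
exists u, (wremap w (fun i => cut f i.+1)); split; last first.
  split=> [|i Hi]; first by rewrite len_wremap.
  rewrite term_wremap // block_seg.
  have -> : (if i is i'.+1 then term 0 (wremap w (fun i => cut f i.+1)) i' else 0) = cut f i.
    case: i Hi => // i Hi; rewrite term_wremap //.
    by case: (len w) Hi => //= n; apply: ltnW.
  have [_ _ ->] := Hf i Hi; congr flatten; apply: (@eq_from_nth _ [::]).
    by rewrite size_seg cutS addKn.
  move=> j Hj; rewrite nth_seg; last by rewrite cutS addKn.
  have Hc : cut f i <= cut f i + j < cut f i.+1 by rewrite leq_addr cutS ltn_add2l.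
  rewrite /wterm (Ut i.+1); last by case/andP: Hc.
  by rewrite (nth_flatten_cut _ (ltnSn i) Hc) addKn.
have in_w i j : cut f i <= j < cut f i.+1 -> lt_len i (len w).
  move=> /andP[H1 H2]; apply: f_nil; have := leq_ltn_trans H1 H2.
  by rewrite cutS -[X in X < _]addn0 ltn_add2l.
have Hterm i j : cut f i <= j < cut f i.+1 -> X k (lv i) (wterm u j).
  move=> Hj; have [_ Hy _] := Hf i (in_w i j Hj).
  rewrite /wterm (Ut i.+1); last by case/andP: Hj.
  rewrite (nth_flatten_cut _ (ltnSn i) Hj); apply/Hy/mem_nth.
  by rewrite ltn_subLR -?cutS; case/andP: Hj.
split.
- exists k; split=> [j /Uf[n /cut_find[i _ Hi]]|l].
    exact: gl_mono (Hterm i j Hi).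
  have [N HN] := Hlv l; exists (cut f N) => j Nj /Uf[n /cut_find[i _ Hi]].
  apply: gl_mono (Hterm i j Hi) => //; apply: HN; rewrite leqNgt; apply/negP => Hlt.
  move: Hi => /andP[_ Hi]; have := leq_trans Hi (leq_trans (leq_cut f Hlt) Nj).
  by rewrite ltnn.
- move=> i; rewrite len_wremap => Hi.
  rewrite !term_wremap ?leq_cut //.
  by case: (len w) Hi => //= n; apply: ltnW.
- by move=> i; rewrite len_wremap => Hi; rewrite term_wremap.
- case: w H Hf f_nil in_w => [s|w] H Hf f_nil in_w; first by case: c {H Hf}.
  case: c {H} Hf => //= Hf.
    exists k, 0 => i _; rewrite (cutS _ i.+1) addKn.
    by case: (Hf i.+1 isT).
  move=> K; have [N HN] := Hlv K; exists N => i Ni; rewrite (cutS _ i.+1) addKn.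
  case: (Hf i.+1 isT) => Hs _ _; apply: leq_trans Hs; apply: HN.
  exact: leq_trans Ni (leqnSn i).
Qed.

Theorem bs_langE (e : bsexp A) u : bs_lang e u <-> gseq (sem e) u.
Proof.
elim: e u => [|||a|e1 IH1 e2 IH2|e1 IH1 e2 IH2|e1 IH1|e1 IH1|e1 IH1] u /=.
- split=> [->|[k [H0 _]]]; first by apply: gseq_fin; exists 0.
  case: u H0 => [[|x s]|f] // H0; first by case: (H0 0 isT).
  by case: (H0 0 isT).
- split=> [H|[k [H0 _]]]; last exact: H0.
  by exists 0; split=> // l; exists 0 => i _; apply: H.
- split=> [[Hl H]|[k [H0 H]]].
    case: u Hl H => // s _ H; apply: gseq_fin; exists 0 => x /(nthP [::])[i Hi <-].
    by split=> //; apply: H.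
  split=> [Hu|i Hi]; last by case: (H0 i Hi).
  by have [N HN] := H 1; case: (HN N (leqnn N)) => //; rewrite Hu.
- split=> [H|[k [H0 _]]]; last exact: H0.
  by exists 0; split=> // l; exists 0 => i _; apply: H.
- rewrite -gseq_concat; split=> -[u1 [u2 [/IH1 ? /IH2 ? ? ? ?]]];
    by exists u1, u2; split.
- rewrite -gseq_mix; split=> -[u1 [u2 [/IH1 ? /IH2 ? ? ?]]];
    by exists u1, u2; split.
- rewrite -gseq_group; split=> -[u1 [g [[/IH1 ? ? ? ?] [? ?]]]];
    by exists u1, g; split; split.
- rewrite -gseq_group; split=> -[u1 [g [[/IH1 ? ? ? ?] [? ?]]]];
    by exists u1, g; split; split.
- rewrite -gseq_group; split=> -[u1 [g [[/IH1 ? ? ? ?] [? ?]]]];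
    by exists u1, g; split; split.
Qed.
End CharacterizationExponents.

(** * Comparison of graded languages up to thresholds *)

Definition gle (A : Type) (X Y : glang A) : Prop :=
  forall k, exists k', forall l u, X k l u -> Y k' l u.

(** Choosing k' before l lets one bound serve a whole sequence. Only tails are transported: even for
    l = 0 the source may have to lie at a positive level. *)
Definition gev (A : Type) (X Y : glang A) : Prop :=
  forall k, exists k', forall l, exists l', forall u, X k l' u -> Y k' l u.

Lemma gle_refl (A : Type) (X : glang A) : gle X X.
Proof. by move=> k; exists k. Qed.

Lemma gle_trans (A : Type) (Y X Z : glang A) : gle X Y -> gle Y Z -> gle X Z.
Proof.
move=> XY YZ k; have [k1 H1] := XY k; have [k2 H2] := YZ k1.
by exists k2 => l u /H1 /H2.
Qed.

Lemma gev_trans (A : Type) (Y X Z : glang A) : gev X Y -> gev Y Z -> gev X Z.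
Proof.
move=> XY YZ k; have [k1 H1] := XY k; have [k2 H2] := YZ k1.
exists k2 => l; have [l2 H3] := H2 l; have [l1 H4] := H1 l2.
by exists l1 => u /H4 /H3.
Qed.

Lemma gle_gev (A : Type) (X Y : glang A) : gle X Y -> gev X Y.
Proof. by move=> XY k; have [k1 H1] := XY k; exists k1 => l; exists l; apply: H1. Qed.

(* The approximating language is sound with the same lower threshold, and
   complete up to a change of both thresholds. *)
Definition approx (A : Type) (Y X : glang A) : Prop := gle Y X /\ gev X Y.

Lemma approx_refl (A : Type) (X : glang A) : approx X X.
Proof. by split; [apply: gle_refl|apply/gle_gev/gle_refl]. Qed.

Lemma approx_trans (A : Type) (Y X Z : glang A) :
  approx X Y -> approx Y Z -> approx X Z.
Proof.
by move=> [? ?] [? ?]; split; [apply: gle_trans; eauto|apply: gev_trans; eauto].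
Qed.

Lemma approx_ext (A : Type) (X Y : glang A) :
  (forall k l u, X k l u <-> Y k l u) -> approx X Y.
Proof.
by move=> H; split=> k; exists k => l; [move=> u /H|exists l => u /H].
Qed.

Lemma gle_union (A : Type) (I : finType) (X Y : I -> glang A) :
  (forall i, gle (X i) (Y i)) ->
  forall k, exists k', forall l i u, X i k l u -> Y i k' l u.
Proof.
move=> H k; have /fin_all_exists [f Hf] : forall i, exists k', forall l u,
  X i k l u -> Y i k' l u by move=> i; apply: H.
exists (\max_i f i) => l i u /Hf; apply: gl_mono => //; exact: leq_bigmax.
Qed.

Lemma gev_union (A : Type) (I : finType) (X Y : I -> glang A) :
  (forall i, gev (X i) (Y i)) ->
  forall k, exists k', forall l, exists l', l <= l' /\
    forall i u, X i k l' u -> Y i k' l u.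
Proof.
move=> H k; have /fin_all_exists [f Hf] : forall i, exists k', forall l, exists l',
  forall u, X i k l' u -> Y i k' l u by move=> i; apply: H.
exists (\max_i f i) => l.
have /fin_all_exists [h Hh] : forall i, exists l', forall u,
  X i k l' u -> Y i (f i) l u by move=> i; apply: Hf.
exists (maxn l (\max_i h i)); split=> [|i u Hu]; first exact: leq_maxl.
apply: (@gl_mono _ (Y i) (f i) _ l) (Hh _ _ _) => //; first exact: leq_bigmax.
by apply: gl_mono Hu => //; rewrite leq_max leq_bigmax orbT.
Qed.

Lemma approx_gunion (A : Type) (I : finType) (X Y : I -> glang A) :
  (forall i, approx (X i) (Y i)) -> approx (gunion X) (gunion Y).
Proof.
move=> H; split=> k.
  have [k' Hk] := gle_union (fun i => proj1 (H i)) k.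
  by exists k' => l u [i /Hk Hi]; exists i.
have [k' Hk] := gev_union (fun i => proj2 (H i)) k; exists k' => l.
by have [l' [_ Hl]] := Hk l; exists l' => u [i /Hl Hi]; exists i.
Qed.

Lemma approx_gor (A : Type) (X X' Y Y' : glang A) :
  approx X X' -> approx Y Y' -> approx (gor X Y) (gor X' Y').
Proof.
move=> [X1 X2] [Y1 Y2]; split=> k.
  have [[a Ha] [b Hb]] := (X1 k, Y1 k); exists (maxn a b) => l u [/Ha|/Hb] H;
  by [left; apply: gl_mono H; rewrite // leq_maxl|right; apply: gl_mono H; rewrite // leq_maxr].
have [[a Ha] [b Hb]] := (X2 k, Y2 k); exists (maxn a b) => l.
have [[c Hc] [d Hd]] := (Ha l, Hb l); exists (maxn c d) => u [] H; [left|right].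
  apply: (@gl_mono _ X a _ l); rewrite ?leq_maxl //; apply: Hc.
  by apply: gl_mono H; rewrite ?leq_maxl.
apply: (@gl_mono _ Y b _ l); rewrite ?leq_maxr //; apply: Hd.
by apply: gl_mono H; rewrite ?leq_maxr.
Qed.

Lemma gle_gcat (A : Type) (X X' Y Y' : glang A) :
  gle X X' -> gle Y Y' -> gle (gcat X Y) (gcat X' Y').
Proof.
move=> X1 Y1 k.
have [[a Ha] [b Hb]] := (X1 k, Y1 k); exists (maxn a b) => l u [y [z [/Ha Hy /Hb Hz ->]]].
by exists y, z; split=> //; [apply: gl_mono Hy; rewrite // leq_maxl|
                              apply: gl_mono Hz; rewrite // leq_maxr].
Qed.

Lemma gev_gcat (A : Type) (X X' Y Y' : glang A) :
  gev X X' -> gev Y Y' -> gev (gcat X Y) (gcat X' Y').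
Proof.
move=> X2 Y2 k.
have [[a Ha] [b Hb]] := (X2 k, Y2 k); exists (maxn a b) => l.
have [[c Hc] [d Hd]] := (Ha l, Hb l); exists (maxn c d) => u [y [z [Hy Hz ->]]].
exists y, z; split=> //.
  apply: (@gl_mono _ X' a _ l); rewrite ?leq_maxl //; apply: Hc.
  by apply: gl_mono Hy; rewrite ?leq_maxl.
apply: (@gl_mono _ Y' b _ l); rewrite ?leq_maxr //; apply: Hd.
by apply: gl_mono Hz; rewrite ?leq_maxr.
Qed.

Lemma approx_gcat (A : Type) (X X' Y Y' : glang A) :
  approx X X' -> approx Y Y' -> approx (gcat X Y) (gcat X' Y').
Proof. by move=> [? ?] [? ?]; split; [apply: gle_gcat|apply: gev_gcat]. Qed.

Lemma gle_gplus (A : eqType) c (X X' : glang A) :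
  gle X X' -> gle (gplus c X) (gplus c X').
Proof.
move=> X1 k; have [a Ha] := X1 k; exists (maxn a k) => l u [ys [H1 H2 H3 ->]].
exists ys; split=> //; first by apply: count_ok_mono H1 => //; apply: leq_maxr.
by move=> y /H3 /Ha; apply: gl_mono => //; apply: leq_maxl.
Qed.

Lemma gev_gplus (A : eqType) c (X X' : glang A) :
  gev X X' -> gev (gplus c X) (gplus c X').
Proof.
move=> X1 k; have [a Ha] := X1 k; exists (maxn a k) => l.
have [b Hb] := Ha l; exists (maxn b l) => u [ys [H1 H2 H3 ->]].
exists ys; split=> //; first by apply: count_ok_mono H1 => //; apply: leq_maxr.
move=> y /H3 Hy; apply: (@gl_mono _ X' a _ l); rewrite ?leq_maxl //; apply: Hb.
by apply: gl_mono Hy => //; apply: leq_maxl.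
Qed.

Lemma approx_gplus (A : eqType) c (X X' : glang A) :
  approx X X' -> approx (gplus c X) (gplus c X').
Proof. by move=> [? ?]; split; [apply: gle_gplus|apply: gev_gplus]. Qed.

(** * Omega-powers of graded languages *)

Section OmegaPower.
Variable A : finType.
Implicit Types (X Y : glang A) (w : omega_word A) (u : nat -> seq A)
  (R : seq A -> Prop).

Definition om X w := exists u,
  [/\ gseq X (Inf u), forall n, exists2 i, n <= i & u i != [::]
    & forall n, prefix_of (flatten (seg u 0 n)) w].

(* Only the tail of the factorization is constrained by X, while R holds of the
   prefix ending at each factor. *)
Definition eom R X w := exists u k,
  [/\ forall l, exists N, forall i, N <= i -> X k l (u i),
      forall n, exists2 i, n <= i & u i != [::]
    & forall n, prefix_of (flatten (seg u 0 n)) w /\ R (flatten (seg u 0 n))].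

Lemma omega_power_om (e : bsexp A) w : omega_power (bs_lang e) w <-> om (sem e) w.
Proof.
split=> -[u [Hu Hn Hp]]; exists u; split=> //; try exact/bs_langE.
  by move=> n; have := Hp n; rewrite block_seg.
by move=> n; rewrite block_seg; apply: Hp.
Qed.

Lemma prefix_of_cat x y w : prefix_of (x ++ y) w <->
  prefix_of x w /\ prefix_of y (fun i => w (size x + i)).
Proof.
rewrite /prefix_of size_cat !mkseq_seg (seg_cat w (leq0n (size x)) (leq_addr _ _)).
rewrite seg_shift addn0; split=> [/eqP|[-> ->] //].
by rewrite eqseq_cat ?size_seg ?subn0 // => /andP[/eqP ? /eqP ?].
Qed.

Lemma prefix_of_seg w n : prefix_of (seg w 0 n) w.
Proof. by rewrite /prefix_of mkseq_seg size_seg subn0. Qed.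

Lemma omega_concat_ext R R' (L L' : omega_word A -> Prop) w :
  (forall x, R x -> R' x) -> (forall w, L w -> L' w) ->
  omega_concat R L w -> omega_concat R' L' w.
Proof. by move=> H1 H2 [x [? ? ?]]; exists x; split; auto. Qed.

Lemma flatten_seg_neq0 u a b i : a <= i < b -> u i != [::] ->
  flatten (seg u a b) != [::].
Proof.
move=> /andP[ai ib] Hi; rewrite (@seg_cat _ u a i b) ?(ltnW ib) // (seg_cons u ib).
by rewrite flatten_cat /=; case: (u i) Hi => // x s _; case: (flatten _).
Qed.

(** The factors that precede level 0 are absorbed into the finite prefix, of which [R] is known. *)
Lemma eom_om R X w : eom R X w -> omega_concat R (om X) w.
Proof.
move=> [u [k [HX Hn HR]]]; have [N0 HN0] := HX 0.
have [Hp HRN] := HR N0; exists (flatten (seg u 0 N0)); split=> //.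
exists (fun i => u (N0 + i)); split=> [|n|n].
- exists k; split=> [i _|l]; first by apply: HN0; apply: leq_addr.
  have [N HN] := HX l; exists N => i Ni _; apply: HN.
  exact: leq_trans Ni (leq_addl _ _).
- have [i Hi ui] := Hn (N0 + n); exists (i - N0).
    by rewrite leq_subRL // (leq_trans (leq_addr n N0)).
  by rewrite subnKC // (leq_trans (leq_addr n N0)).
- rewrite seg_shift addn0; have [H _] := HR (N0 + n).
  move: H; rewrite (@seg_cat _ u 0 N0) ?leq_addr // flatten_cat.
  by case/prefix_of_cat.
Qed.

Lemma om_ext X w w' : w =1 w' -> om X w -> om X w'.
Proof.
by move=> E [u [? ? Hp]]; exists u; split=> // n; rewrite /prefix_of -(eq_mkseq E); apply: Hp.
Qed.

Lemma om_le X Y w : gle X Y -> om X w -> om Y w.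
Proof.
move=> XY [u [[k [H0 H]] Hn Hp]]; exists u; split=> //.
have [k' Hk] := XY k; exists k'; split=> [i Hi|l]; first exact/Hk/H0.
by have [N HN] := H l; exists N => i Ni Hi; apply/Hk/HN.
Qed.

Lemma eom_le R X Y w : gev X Y -> eom R X w -> eom R Y w.
Proof.
move=> XY [u [k [H Hn Hp]]]; have [k' Hk] := XY k; exists u, k'; split=> // l.
have [l' Hl] := Hk l; have [N HN] := H l'.
by exists N => i Ni; apply/Hl/HN.
Qed.

(** Factors are merged along g. The part before [g 0] becomes a leading factor, whose level is free
    because [eom] constrains tails only. *)
Lemma eom_group R X w u k (g : nat -> nat) :
  (forall n, exists2 i, n <= i & u i != [::]) ->
  (forall n, prefix_of (flatten (seg u 0 n)) w /\ R (flatten (seg u 0 n))) ->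
  (forall i, g i < g i.+1) ->
  (forall l, exists N, forall i, N <= i ->
     X k l (flatten (seg u (g i) (g i.+1)))) ->
  eom R X w.
Proof.
move=> Hn HR gS HX.
pose u' i := if i is i'.+1 then flatten (seg u (g i') (g i)) else flatten (seg u 0 (g 0)).
have E n : flatten (seg u' 0 n.+1) = flatten (seg u 0 (g n)).
  elim: n => [|n IH]; first by rewrite seg1 /= cats0.
  rewrite seg_rcons // flatten_rcons IH /= -flatten_cat -seg_cat //.
  exact: ltnW.
exists u', k; split=> [l|n|[|n]]; last 2 first.
- by have := HR 0; rewrite !seg_nil.
- by rewrite E.
- have [N HN] := HX l; exists N.+1 => -[|i] //= Hi; exact: HN.
(* Were all merged factors after the n-th empty, everything from [g n] on would be empty, against
   the nonempty [u j]. *)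
have [j gj uj] := Hn (g n).
have : flatten (seg u (g n) (g j.+1)) != [::].
  apply: flatten_seg_neq0 uj; rewrite gj /=; exact: strict_mono_ge.
have nj : n <= j.+1.
  apply: leq_trans (leqnSn j); exact: leq_trans (strict_mono_ge gS n) gj.
move=> H; apply: NNPP => Hno; case/negP: H; apply/eqP.
rewrite -(subnK nj); elim: (j.+1 - n) => [|d IH]; first by rewrite add0n seg_nil.
rewrite addSn (@seg_cat _ u _ (g (d + n))); last 2 first.
- by apply: (strict_mono_le gS); apply: leq_addl.
- exact/ltnW.
rewrite flatten_cat IH /=; case: (eqVneq (u' (d + n).+1) [::]) => // Hd.
by case: Hno; exists (d + n).+1 => //; rewrite -addSn leq_addl.
Qed.

Definition gstar0 X (x : seq A) := exists k, gexp AnyCount X k 0 x.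

Lemma om_eom X w : om X w -> eom (gstar0 X) X w.
Proof.
move=> [u [[k [H0 H]] Hn Hp]]; exists u, k; split=> // [l|n].
  by have [N HN] := H l; exists N => i Ni; apply: HN.
split=> //; exists k, (seg u 0 n); split=> // y /mapP[i _ ->]; exact: H0.
Qed.

(** Finitely many extra factors at lower threshold 0 only raise the bound k. *)
Lemma om_prepend X w : omega_concat (gstar0 X) (om X) w -> om X w.
Proof.
move=> [x [[k [us [_ Hus ->]]] Hx [u [[k' [H0 H]] Hn Hp]]]].
pose u' i := if i < size us then nth [::] us i else u (i - size us).
have u'0 i : i <= size us -> seg u' 0 i = take i us.
  move=> Hi; apply: (@eq_from_nth _ [::]); rewrite size_seg subn0 ?size_takel //.
  move=> j Hj; rewrite nth_seg ?subn0 // nth_take // /u' add0n.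
  by rewrite (leq_trans Hj).
have u'1 n : seg u' (size us) (size us + n) = seg u 0 n.
  rewrite -{1}[size us]addn0 -seg_shift; apply: (@eq_from_nth _ [::]);
    rewrite !size_seg // => j Hj.
  by rewrite !nth_seg // /u' add0n ltnNge leq_addr /= addKn.
exists u'; split=> [|n|n].
- exists (maxn k k'); split=> [i _|l].
    rewrite /wterm /= /u'; case: ifP => Hi.
      by apply: gl_mono (Hus _ (mem_nth _ Hi)) => //; apply: leq_maxl.
    by apply: gl_mono (H0 (i - size us) isT) => //; apply: leq_maxr.
  have [N HN] := H l; exists (size us + N) => i Hi _.
  rewrite /wterm /= /u' ltnNge (leq_trans (leq_addr _ _) Hi) /=.
  apply: (@gl_mono _ X k' _ l) (HN (i - size us) _ _); rewrite ?leq_maxr //.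
  by rewrite leq_subRL // (leq_trans (leq_addr _ _) Hi).
- have [i Hi ui] := Hn n; exists (size us + i); first exact: leq_trans Hi (leq_addl _ _).
  by rewrite /u' ltnNge leq_addr /= addKn.
case: (leqP n (size us)) => Hu.
  move: Hx; rewrite u'0 // -{1}(cat_take_drop n us) flatten_cat.
  by case/prefix_of_cat.
rewrite -(subnKC (ltnW Hu)) (@seg_cat _ u' 0 (size us)) ?leq_addr // u'1 u'0 // take_size.
by rewrite flatten_cat; apply/prefix_of_cat.
Qed.

(** Every factor is replaced by the pieces of its iteration; a piece inherits the level of its
    factor, so the levels still tend to infinity. *)
Lemma om_ungroup c X w : om (gexp c X) w -> om X w.
Proof.
move=> [u [/gseqP[k [lv [Hlv H]]] Hn Hp]].
have /fun_choice [f Hf] : forall i, exists ys : seq (seq A),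
    (forall y, y \in ys -> X k (lv i) y) /\ u i = flatten ys.
  by move=> i; have [ys [_ ? ?]] := H i isT; exists ys.
have fF n : flatten (flatten (seg f 0 n)) = flatten (seg u 0 n).
  elim: n => [|n IH]; first by rewrite !seg_nil.
  by rewrite !seg_rcons // !flatten_rcons flatten_cat IH; case: (Hf n) => _ ->.
have [|s Hs] := @flatten_stream _ [::] f.
  move=> n; have [i ni ui] := Hn n; exists i => //.
  by move: ui; case: (Hf i) => _ ->; case: (f i).
have unb j : exists n, j < cut f n.
  elim: j => [|j [n Hj]]; have := Hn.
    move=> /(_ 0) [i _ ui]; exists i.+1; rewrite cutS.
    by move: ui; case: (Hf i) => _ ->; case: (f i) => //= *; rewrite addnS.
  move=> /(_ n) [i ni ui]; exists i.+1; rewrite cutS.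
  rewrite (leq_trans (leq_ltn_trans Hj (ltnSn _))) // -addn1 leq_add ?leq_cut //.
  by move: ui; case: (Hf i) => _ ->; case: (f i).
have Hsf i j : cut f i <= j < cut f i.+1 -> s j \in f i.
  move=> Hj; have /andP[H1 H2] := Hj.
  have <- : nth [::] (flatten (seg f 0 i.+1)) j = s j.
    by rewrite -Hs nth_seg ?subn0.
  rewrite (nth_flatten_cut _ (ltnSn i) Hj) mem_nth //.
  by rewrite ltn_subLR // -cutS.
exists s; split=> [|n|n].
- exists k; split=> [j _|l].
    have [n /cut_find[i _ Hi]] := unb j.
    by apply: gl_mono (proj1 (Hf i) _ (Hsf i j Hi)).
  have [N HN] := Hlv l; exists (cut f N) => j Nj _.
  have [n /cut_find[i _ Hi]] := unb j.
  apply: gl_mono (proj1 (Hf i) _ (Hsf i j Hi)) => //; apply: HN.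
  rewrite leqNgt; apply/negP => Hlt; have /andP[_ {}Hi] := Hi.
  by have := leq_trans Hi (leq_trans (leq_cut f Hlt) Nj); rewrite ltnn.
- have [m Hm] := unb n; have [i mi ui] := Hn m.
  have : flatten (flatten (seg f m i.+1)) != [::].
    have /= := @flatten_seg_neq0 u m i.+1 i; rewrite mi ltnSn => /(_ isT ui).
    suff -> : flatten (flatten (seg f m i.+1)) = flatten (seg u m i.+1) by [].
    move: (fF i.+1); rewrite (@seg_cat _ f 0 m i.+1) ?(@seg_cat _ u 0 m i.+1) ?leq0n ?(leqW mi) //.
    by rewrite !flatten_cat fF => /eqP; rewrite eqseq_cat // => /andP[_ /eqP].
  have -> : flatten (seg f m i.+1) = seg s (cut f m) (cut f i.+1).
    have := Hs i.+1; rewrite (@seg_cat _ f 0 m i.+1) ?(leqW mi) //.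
    rewrite flatten_cat -Hs (@seg_cat _ s 0 (cut f m)) ?leq_cut //; last exact: leqW.
    by move/eqP; rewrite eqseq_cat // => /andP[_ /eqP ->].
  move=> Hne; apply: NNPP => Hno; case/negP: Hne; apply/eqP.
  have : all (fun x => x == [::]) (seg s (cut f m) (cut f i.+1)).
    apply/allP => x /mapP[j]; rewrite mem_index_iota => /andP[Hj _] ->.
    apply/negPn/negP => sj; apply: Hno; exists j => //.
    exact: leq_trans (ltnW Hm) Hj.
  by elim: seg => //= x r IH /andP[/eqP -> /IH].
- have [m Hm] := unb n; have := Hp m; rewrite -fF -Hs (@seg_cat _ s 0 n) ?(ltnW Hm) //.
  by rewrite flatten_cat => /prefix_of_cat[].
Qed.

Lemma gplus_gexp c X : gle (gplus c X) (gexp c X).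
Proof. by move=> k; exists k => l u [ys [? _ ? ->]]; exists ys. Qed.

End OmegaPower.

Fixpoint erase (A : finType) (e : bsexp A) : regexp A :=
  match e with
  | BSempty => Rempty
  | BSeps | BSepsbar => Reps
  | BSletter a => Rletter a
  | BSconcat e1 e2 => Rconcat (erase e1) (erase e2)
  | BSmix e1 e2 => Rplus (erase e1) (erase e2)
  | BSstar e1 | BSexpB e1 | BSexpS e1 => Rstar (erase e1)
  end.

Lemma gexp_levels (A : finType) c (X : glang A) (ys : seq (seq A)) :
  (forall y, y \in ys -> exists k, X k 0 y) -> exists k, gexp c X k 0 (flatten ys).
Proof.
move=> H.
have [i k k' kk' Hk Hi|i Hi|k Hk] :=
  @nat_bound (fun i k => i < size ys -> X k 0 (nth [::] ys i)) (size ys).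
- by apply: gl_mono (Hk Hi).
- by have [k Hk] := H _ (mem_nth [::] Hi); exists k.
exists (maxn (size ys) k), ys; split=> //; first by case: c => //=; apply: leq_maxl.
move=> y /(nthP [::])[i Hi <-]; apply: gl_mono (Hk i Hi Hi) => //; exact: leq_maxr.
Qed.

(** For a single word, k may be taken as large as the iterations in it and l = 0 asks nothing, so
    all three exponents are plain stars. *)
Lemma reg_lang_erase (A : finType) (e : bsexp A) x :
  reg_lang (erase e) x <-> exists k, sem e k 0 x.
Proof.
have star c (X : glang A) (P : seq A -> Prop) : (forall y, P y <-> exists k, X k 0 y) ->
    forall x, (exists ys, (forall y, y \in ys -> P y) /\ x = flatten ys) <->
    exists k, gexp c X k 0 x.
  move=> HP {}x; split=> [[ys [H ->]]|[k [ys [_ H ->]]]].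
    by apply: gexp_levels => y /H /HP.
  by exists ys; split=> // y /H Hy; apply/HP; exists k.
elim: e x => [|||a|e1 IH1 e2 IH2|e1 IH1 e2 IH2|e1 IH1|e1 IH1|e1 IH1] x /=.
- by split=> // -[].
- by split=> [->|[]] //; exists 0.
- by split=> [->|[_ []]] //; exists 0.
- by split=> [->|[]] //; exists 0.
- split=> [[y [z [/IH1[k Hy] /IH2[k' Hz] ->]]]|[k [y [z [Hy Hz ->]]]]].
    exists (maxn k k'), y, z; split=> //.
      by apply: gl_mono Hy => //; apply: leq_maxl.
    by apply: gl_mono Hz => //; apply: leq_maxr.
  by exists y, z; split=> //; [apply/IH1; exists k|apply/IH2; exists k].
- split=> [[/IH1[k H]|/IH2[k H]]|[k [H|H]]].
  + by exists k; left.
  + by exists k; right.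
  + by left; apply/IH1; exists k.
  + by right; apply/IH2; exists k.
- exact: (star AnyCount _ _ IH1).
- exact: (star AtMost _ _ IH1).
- exact: (star AtLeast _ _ IH1).
Qed.

(** * Counter values in finite words *)

Section ActionWords.
Implicit Types (a : action) (u v : seq action) (k l : nat) (b : bool).

(* Boolean tests that reduce, unlike equality on [action]. *)
Definition isr a := if a is Reset then true else false.
Definition isi a := if a is Incr then true else false.
Definition hasr u := has isr u.
Definition hasi u := has isi u.

Arguments hasr : simpl never.
Arguments hasi : simpl never.

Lemma isrE a : isr a = (a == Reset).
Proof. by apply/idP/eqP; case: a. Qed.

Lemma isiE a : isi a = (a == Incr).
Proof. by apply/idP/eqP; case: a. Qed.

Fixpoint pre u : nat :=
  match u with
  | Incr :: u' => (pre u').+1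
  | NoAct :: u' => pre u'
  | _ => 0
  end.

Definition suf u := pre (rev u).

(** [allB] bounds every stretch without reset, including the outer ones cut off by the ends of the
    word; [inS] constrains only the complete intervals between two resets. *)
Fixpoint allB k u : bool := if u is _ :: u' then (pre u <= k) && allB k u' else true.

Fixpoint inS l u : bool :=
  if u is a :: u' then (isr a && hasr u' ==> (l <= pre u')) && inS l u'
  else true.

Lemma hasr_cat u v : hasr (u ++ v) = hasr u || hasr v.
Proof. exact: has_cat. Qed.

Lemma hasr_cons a u : hasr (a :: u) = isr a || hasr u.
Proof. by []. Qed.

Lemma hasi_cons a u : hasi (a :: u) = isi a || hasi u.
Proof. by []. Qed.

Lemma pre_cat u v : pre (u ++ v) = if hasr u then pre u else pre u + pre v.
Proof.
by elim: u => [|[] u IH] //=; rewrite hasr_cons /= ?IH; case: ifP.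
Qed.

Lemma hasr_rev u : hasr (rev u) = hasr u.
Proof. exact: has_rev. Qed.

Lemma suf_cat u v : suf (u ++ v) = if hasr v then suf v else suf u + suf v.
Proof. by rewrite /suf rev_cat pre_cat hasr_rev addnC. Qed.

Lemma suf_cons a u : suf (a :: u) = if hasr u then suf u else isi a + suf u.
Proof. by rewrite -cat1s suf_cat; case: a. Qed.

Lemma pre_suf u : ~~ hasr u -> pre u = suf u.
Proof.
elim: u => // a u IH; rewrite hasr_cons suf_cons negb_or => /andP[+ Hu].
by rewrite (negbTE Hu) -IH //; case: a.
Qed.

Lemma allB_pre k u : allB k u -> pre u <= k.
Proof. by case: u => // a u /andP[]. Qed.

Lemma allB_cat k u v :
  allB k (u ++ v) = [&& allB k u, allB k v & suf u + pre v <= k].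
Proof.
elim: u => [|a u IH].
  rewrite /= add0n; case H : (allB k v) => //.
  by rewrite allB_pre.
have -> : allB k ((a :: u) ++ v) = (pre ((a :: u) ++ v) <= k) && allB k (u ++ v) by [].
have -> : allB k (a :: u) = (pre (a :: u) <= k) && allB k u by [].
rewrite IH pre_cat hasr_cons suf_cons; case Hu : (hasr u); first by rewrite orbT -andbA.
have E := pre_suf (negbT Hu).
by case: a => /=; case: (allB k u) => /=; case: (allB k v) => /=; lia.
Qed.

Lemma allB_suf k u : allB k u -> suf u <= k.
Proof.
elim: u => // a u IH /= /andP[H1 /IH H2]; rewrite suf_cons; case: ifP => // /negbT Hu.
by move: H1; have := pre_suf Hu; case: a => /=; lia.
Qed.

Lemma allB_mono k k' u : k <= k' -> allB k u -> allB k' u.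
Proof. by move=> Hk; elim: u => //= a u IH /andP[H1 /IH ->]; rewrite andbT (leq_trans H1). Qed.

Lemma allB_cat_add k k' u v : allB k u -> allB k' v -> allB (k + k') (u ++ v).
Proof.
move=> Hu Hv; rewrite allB_cat (allB_mono _ Hu) ?leq_addr // (allB_mono _ Hv) ?leq_addl //=.
by rewrite leq_add ?allB_suf ?allB_pre.
Qed.

Lemma inS_mono l l' u : l' <= l -> inS l u -> inS l' u.
Proof.
move=> Hl; elim: u => //= a u IH /andP[H1 /IH ->]; rewrite andbT.
by apply/implyP => H; move: H1; rewrite H /=; apply: leq_trans.
Qed.

Lemma inS_cat l u v : inS l (u ++ v) =
  [&& inS l u, inS l v & hasr u && hasr v ==> (l <= suf u + pre v)].
Proof.
elim: u => [|a u IH]; first by rewrite /= andbT.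
rewrite /= IH hasr_cat hasr_cons suf_cons pre_cat.
case Hu : (hasr u).
  case: (isr a) => //=; rewrite ?orbT //=.
  by case: (l <= pre u).
have E := pre_suf (negbT Hu); rewrite E.
case: (inS l u); case: (inS l v); rewrite ?andbT ?andbF //=.
by case: a => //=; case: (hasr v); rewrite //= add0n ?orbF ?andbT.
Qed.

Lemma inS_nohasr l u : ~~ hasr u -> inS l u.
Proof.
elim: u => //= a u IH; rewrite hasr_cons negb_or => /andP[/negbTE -> Hu].
by rewrite IH.
Qed.

(* A cut is claimed to lie on the left (b = true) when its left neighbourhood
   already contributes many increments to the current interval between two
   resets; otherwise the right neighbourhood does. A claim is thus the same as a
   virtual reset placed at the cut. *)
Definition Sok l b u b' := inS l (nseq (~~ b) Reset ++ u ++ nseq b' Reset).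

Lemma SokE l b u b' : Sok l b u b' = inS l u &&
  (if hasr u then (~~ b ==> (l <= pre u)) && (b' ==> (l <= suf u))
   else ~~ b && b' ==> (l <= pre u)).
Proof.
rewrite /Sok; case: b; case: b'; rewrite /= ?cats0 ?cats1 -?cats1 ?inS_cat ?hasr_cat ?pre_cat
  /= ?hasr_cons /= ?addn0 ?orbT ?andbT ?orbF; case: (hasr u) => //=; rewrite ?andbT //.
- by rewrite andbCA andbA andbC andbA.
- by rewrite andbC.
- by rewrite andbC.
Qed.

Lemma Sok_mono l l' b u b' : l' <= l -> Sok l b u b' -> Sok l' b u b'.
Proof. exact: inS_mono. Qed.

(** The interval crossing the cut, if complete, already has l increments on the side designated by
    the claim. *)
Lemma Sok_cat l b1 b b2 u v : Sok l b1 u b -> Sok l b v b2 -> Sok l b1 (u ++ v) b2.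
Proof.
rewrite !SokE inS_cat hasr_cat pre_cat suf_cat.
case Hu : (hasr u); case Hv : (hasr v) => //=;
  move=> /andP[-> +] /andP[-> +] => /=;
  try have := pre_suf (negbT Hu); try have := pre_suf (negbT Hv);
  case: b1; case: b; case: b2 => //=; lia.
Qed.

(** The left side is designated when it has enough increments itself, or when u has no reset and its
    own left end was already claimed on the left: the claim is then passed on. *)
Definition claim l b u := ~~ (~~ b || hasr u) || (l <= suf u).

(** Of the two parts of an interval with 2l increments, one has at least l. *)
Lemma Sok_split l b u v b' : Sok (2 * l) b (u ++ v) b' ->
  Sok l b u (claim l b u) /\ Sok l (claim l b u) v b'.
Proof.
have Hl : l <= 2 * l by lia.
rewrite !SokE /claim inS_cat hasr_cat pre_cat suf_cat.
move=> /andP[/and3P[/(inS_mono Hl) -> /(inS_mono Hl) ->]] /=.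
case Hu : (hasr u); case Hv : (hasr v) => //=;
  try have := pre_suf (negbT Hu); try have := pre_suf (negbT Hv);
  case: b => /=; case: b' => //=; case: (leqP l (suf u)) => //=; lia.
Qed.

Lemma allB_nohasr k u : ~~ hasr u -> allB k u = (pre u <= k).
Proof.
elim: u => //= a u IH; rewrite hasr_cons negb_or => /andP[Ha Hu]; rewrite IH //.
by case: a Ha => //= _; lia.
Qed.

Lemma pre_nohasr_cat u v : ~~ hasr u -> pre (u ++ v) = pre u + pre v.
Proof. by move=> /negbTE; rewrite pre_cat => ->. Qed.

Lemma hasr_flatten us : hasr (flatten us) = has hasr us.
Proof. by elim: us => //= u us IH; rewrite hasr_cat IH. Qed.

(** As every word resets the counter, a stretch without reset meets at most two consecutive words,
    whence the factor 2. *)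
Lemma allB_flatten_reset k us : all hasr us -> all (allB k) us ->
  allB (2 * k) (flatten us) /\ pre (flatten us) <= k.
Proof.
elim: us => //= u us IH /andP[Hu /IH{}IH] /andP[Hk /IH [H1 H2]].
split; last by rewrite pre_cat Hu allB_pre.
rewrite allB_cat H1 (allB_mono _ Hk) //=; last by lia.
by have := allB_suf Hk; lia.
Qed.

Lemma pre_flatten_noreset k us : all (fun u => ~~ hasr u) us -> all (allB k) us ->
  pre (flatten us) <= size us * k.
Proof.
elim: us => //= u us IH /andP[Hu /IH{}IH] /andP[Hk /IH H].
by rewrite pre_nohasr_cat // mulSn leq_add // allB_pre.
Qed.

Lemma pre_flatten_ge us : all (fun u => ~~ hasr u) us -> all hasi us ->
  size us <= pre (flatten us).
Proof.
elim: us => //= u us IH /andP[Hu /IH{}IH] /andP[Hk /IH H].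
rewrite pre_nohasr_cat // -add1n leq_add //.
elim: u Hu Hk => //= a u IHu; rewrite hasr_cons hasi_cons negb_or => /andP[Ha Hu].
by case: a Ha => //= _; apply: IHu.
Qed.

Lemma pre0 u : ~~ hasi u -> pre u = 0.
Proof. by elim: u => //= a u IH; rewrite hasi_cons negb_or => /andP[Ha /IH]; case: a Ha. Qed.

(* Claims at all the cuts between words that each contain a reset can be chosen
   at once, because an interval between resets crosses at most one cut. *)
Lemma Sok_claims l b us b' : us <> [::] -> all hasr us -> Sok (2 * l) b (flatten us) b' ->
  exists bs, [/\ size bs = size us, last b bs = b' &
    forall i, i < size us ->
      Sok l (nth b (b :: bs) i) (nth [::] us i) (nth b bs i)].
Proof.
move=> Hne Hr H.
have {H} : inS (2 * l) (flatten us) /\ (~~ b ==> (l <= pre (flatten us))) /\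
    (b' ==> (2 * l <= suf (flatten us))).
  move: H; rewrite SokE hasr_flatten; case: us Hne Hr => //= u us _ /andP[-> _] /=.
  move=> /andP[-> /andP[H ->]]; split=> //; split=> //; move: H; case: b => //=; lia.
elim: us b Hne Hr => //= u us IH b _ /andP[Hu Hr].
rewrite inS_cat pre_cat suf_cat Hu hasr_flatten => -[/and3P[Hu1 H1 H2]] [H3 H4].
have Hl : l <= 2 * l by lia.
case: us IH Hr H1 H2 H4 => [|v us] IH Hr H1 H2 H4.
  exists [:: b']; split=> // -[|//] _ /=.
  rewrite SokE (inS_mono Hl Hu1) Hu H3 /=; apply/implyP => Hb.
  by move: H4; rewrite Hb /suf /=; lia.
have Hv : has hasr (v :: us) by case/andP: Hr => /= ->.
move: H2 H4; rewrite Hv => H2 H4.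
pose b1 := l <= suf u.
have [//|//||bs [Hs Hl' Hbs]] := IH b1.
  split=> //; split=> //; apply/implyP; rewrite /b1.
  by move: H2; rewrite /=; lia.
exists (b1 :: bs); split=> [||]; first by rewrite /= Hs.
  by rewrite /= Hl'.
move=> [|i] /= Hi.
  by rewrite SokE (inS_mono Hl Hu1) Hu H3 /= /b1; case: leqP.
have := Hbs i Hi; rewrite [nth b1 bs i](set_nth_default b) ?Hs //.
by rewrite [nth b1 (b1 :: bs) i](set_nth_default b) //= Hs ltnW.
Qed.
End ActionWords.

(** * Kleene's algorithm *)

Section Expressible.
Variables (A : finType) (T : kind).
Implicit Types (X Y : glang A) (e : bsexp A).

Definition Expr X := exists e, T_regular T e /\ approx (sem e) X.

Lemma Expr_approx Y X : approx Y X -> Expr Y -> Expr X.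
Proof. by move=> H [e [He Ha]]; exists e; split=> //; apply: approx_trans Ha H. Qed.

Lemma Expr_none : Expr (gconst (fun _ => False)).
Proof. by exists BSempty; split=> //; apply: approx_refl. Qed.

Lemma Expr_letter (a : A) : Expr (gconst (fun u => u = [:: a])).
Proof. by exists (BSletter a); split=> //; apply: approx_refl. Qed.

Lemma Expr_or X Y : Expr X -> Expr Y -> Expr (gor X Y).
Proof.
move=> [e [He Ha]] [f [Hf Hb]]; exists (BSmix e f); split; first by rewrite /= He.
exact: (approx_gor Ha Hb).
Qed.

Lemma Expr_cat X Y : Expr X -> Expr Y -> Expr (gcat X Y).
Proof.
move=> [e [He Ha]] [f [Hf Hb]]; exists (BSconcat e f); split; first by rewrite /= He.
exact: (approx_gcat Ha Hb).
Qed.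

Lemma Expr_when (P : Prop) X : (P -> Expr X) -> Expr (gwhen P X).
Proof.
move=> H; have [HP|HP] := classic P.
  by apply: Expr_approx (H HP); apply: approx_ext => k l u /=; tauto.
by apply: Expr_approx Expr_none; apply: approx_ext => k l u /=; tauto.
Qed.

Lemma Expr_union (I : finType) (X : I -> glang A) :
  (forall i, Expr (X i)) -> Expr (gunion X).
Proof.
move=> H.
suff : Expr (gunion (fun i => gwhen (i \in enum I) (X i))).
  apply: Expr_approx; apply: approx_ext => k l u /=.
  by split=> -[i Hi]; exists i; rewrite ?mem_enum // in Hi *; case: Hi.
elim: (enum I) => [|x s IH].
  by apply: Expr_approx Expr_none; apply: approx_ext => k l u /=; split=> // -[i []].
apply: Expr_approx (Expr_or (H x) IH); apply: approx_ext => k l u /=; split.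
  by case=> [Hx|[i [Hi Hu]]]; [exists x; rewrite mem_head|exists i; rewrite inE Hi orbT].
by case=> i [/predU1P[->|Hi] Hu]; [left|right; exists i].
Qed.
End Expressible.

Lemma size_count_mem (I : finType) (s : seq I) : size s = \sum_x count_mem x s.
Proof.
elim: s => [|y s IH] /=; first by rewrite big1.
rewrite big_split /= -IH (bigD1 y) //= eqxx big1 // => z /negPf.
by rewrite eq_sym => ->.
Qed.

Section MatrixPaths.
Variables (A N : finType).
Implicit Types (X : N -> N -> glang A) (k l : nat) (ys : seq (seq A)).

Fixpoint mxp X k l n ys n' : Prop :=
  if ys is y :: ys' then exists n1, X n n1 k l y /\ mxp X k l n1 ys' n'
  else n = n'.

Lemma mxp_cat X k l n ys zs n' : mxp X k l n (ys ++ zs) n' <->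
  exists n1, mxp X k l n ys n1 /\ mxp X k l n1 zs n'.
Proof.
elim: ys n => [|y ys IH] n /=; first by split=> [?|[n1 [<- ?]]] //; exists n.
split=> [[n1 [Hy /IH[n2 [H1 H2]]]]|[n2 [[n1 [Hy H1]] H2]]].
  by exists n2; split=> //; exists n1.
by exists n1; split=> //; apply/IH; exists n2.
Qed.

Lemma mxp_mono X k k' l l' n ys n' : k <= k' -> l' <= l ->
  mxp X k l n ys n' -> mxp X k' l' n ys n'.
Proof.
move=> Hk Hl; elim: ys n => //= y ys IH n [n1 [Hy /IH H]]; exists n1; split=> //.
exact: gl_mono Hy.
Qed.

Lemma mxp_sub X (Y : N -> N -> glang A) k k' l l' n ys n' :
  (forall m m' u, X m m' k l u -> Y m m' k' l' u) ->
  mxp X k l n ys n' -> mxp Y k' l' n ys n'.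
Proof.
move=> H; elim: ys n => //= y ys IH n [n1 [/H Hy /IH H1]]; by exists n1.
Qed.

Definition gmx (c : arity) X (n n' : N) : glang A.
Proof.
exists (fun k l u => exists ys, [/\ ys <> [::], count_ok c k l (size ys),
   mxp X k l n ys n' & u = flatten ys]).
move=> k k' l l' u Hk Hl [ys [H0 H1 H2 ->]]; exists ys; split=> //.
  exact: count_ok_mono H1.
exact: mxp_mono H2.
Defined.

Lemma approx_gmx c X (Y : N -> N -> glang A) (n n' : N) : (forall m m', approx (X m m') (Y m m')) ->
  approx (gmx c X n n') (gmx c Y n n').
Proof.
move=> H; split=> k.
  have [k' Hk] := @gle_union _ _ (fun p => X p.1 p.2) (fun p => Y p.1 p.2)
    (fun p => proj1 (H p.1 p.2)) k.
  exists (maxn k k') => l u [ys [H0 H1 H2 ->]]; exists ys; split=> //.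
    by apply: count_ok_mono H1 => //; apply: leq_maxl.
  apply: mxp_sub H2 => m m' u' /(Hk l (m, m')); apply: gl_mono => //.
  exact: leq_maxr.
have [k' Hk] := @gev_union _ _ (fun p => Y p.1 p.2) (fun p => X p.1 p.2)
    (fun p => proj2 (H p.1 p.2)) k.
exists (maxn k k') => l; have [l' [Hll Hl]] := Hk l; exists l' => u [ys [H0 H1 H2 ->]].
exists ys; split=> //.
  by apply: count_ok_mono H1 => //; apply: leq_maxl.
apply: mxp_sub H2 => m m' u' /(Hl (m, m')); apply: gl_mono => //.
exact: leq_maxr.
Qed.
End MatrixPaths.

Section Kleene.
Variables (A N : finType) (T : kind) (E : N -> N -> bsexp A).
Implicit Types (k l : nat) (s : seq N) (ys : seq (seq A)) (b : bool).

Definition starop b (e : bsexp A) := if b then BSexpB e else BSstar e.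
Definition starop_arity b := if b then AtMost else AnyCount.

(* McNaughton-Yamada: paths of length at least one whose interior nodes lie
   in s. Replacing the star by the bounded exponent bounds their length. *)
Fixpoint kleene b s n n' : bsexp A :=
  if s is x :: s' then
    BSmix (kleene b s' n n')
      (BSconcat (kleene b s' n x)
        (BSconcat (starop b (kleene b s' x x)) (kleene b s' x n')))
  else E n n'.

Lemma sem_starop b e : sem (starop b e) = gexp (starop_arity b) (sem e).
Proof. by case: b. Qed.

Lemma kleene_regular b s n n' : (b -> allows_B T) ->
  (forall n n', T_regular T (E n n')) -> T_regular T (kleene b s n n').
Proof.
move=> Hb HE; elim: s n n' => //= x s IH n n'; rewrite !IH /=.
by case: b Hb IH => [/(_ isT)|_] /= => [->|] IH; rewrite ?IH.
Qed.

Local Notation Y := (fun n n' => sem (E n n')).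

(** A path through the added node has one part before its first visit, one after its last visit, and
    at most k loops between: k + 2 parts. *)
Fixpoint path_bound s k := if s is _ :: s' then path_bound s' k * (k + 2) else 1.

Lemma kleene_sound b s n n' k l u : sem (kleene b s n n') k l u ->
  exists ys, [/\ ys <> [::], mxp Y k l n ys n', u = flatten ys
    & b -> size ys <= path_bound s k].
Proof.
elim: s n n' u => [|x s IH] n n' u /=.
  by move=> H; exists [:: u]; split=> //=; [exists n'|rewrite cats0].
case=> [/IH[ys [H0 H1 H2 H3]]|].
  exists ys; split=> // /H3 H; apply: leq_trans H _; rewrite -{1}[path_bound s k]muln1.
  by rewrite leq_mul2l addnS orbT.
move=> [y [z [/IH[ys [Y0 Y1 -> Y3]] [y' [z' [Hy' /IH[zs [Z0 Z1 -> Z3]] ->]] ->]]]].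
have {Hy'} [ws [W1 -> W3]] : exists ws, [/\ mxp Y k l x ws x, y' = flatten ws
    & b -> size ws <= path_bound s k * k].
  move: Hy'; rewrite sem_starop => -[vs [V1 V2 ->]].
  have {}V1 : b -> size vs <= k by move=> Hb; move: V1; rewrite /starop_arity Hb.
  suff [ws [W1 W2 W3]] : exists ws, [/\ mxp Y k l x ws x, flatten vs = flatten ws
      & b -> size ws <= path_bound s k * size vs].
    exists ws; split=> // Hb; apply: leq_trans (W3 Hb) _; rewrite leq_mul2l.
    by rewrite V1 ?orbT.
  elim: vs V2 {V1} => [|v vs IHv] V2; first by exists [::].
  have [|ws [W1 W2 W3]] := IHv; first by move=> y0 Hy0; apply: V2; rewrite inE Hy0 orbT.
  have [ws' [_ W1' W2' W3']] := IH _ _ _ (V2 v (mem_head _ _)).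
  exists (ws' ++ ws); split; first by apply/mxp_cat; exists x.
    by rewrite flatten_cat -W2 -W2'.
  by move=> Hb; rewrite size_cat mulnS leq_add ?W3 ?W3'.
exists (ys ++ ws ++ zs); split.
- by case: ys Y0 {Y1 Y3}.
- by apply/mxp_cat; exists x; split=> //; apply/mxp_cat; exists x.
- by rewrite !flatten_cat.
- move=> Hb; rewrite !size_cat mulnDr muln2 -addnn.
  by have := Y3 Hb; have := W3 Hb; have := Z3 Hb; lia.
Qed.

(** Paths with labels [y :: ys], hence nonempty, whose interior nodes lie in s. *)
Fixpoint pin s k l n y ys n' : Prop :=
  if ys is y' :: ys' then
    exists n1, [/\ n1 \in s, Y n n1 k l y & pin s k l n1 y' ys' n']
  else Y n n' k l y.

(** The cut is at the first visit of x, so the first part avoids x in its interior while the rest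
    may return to it. *)
Lemma pin_split s x k l n y ys n' : pin (x :: s) k l n y ys n' ->
  pin s k l n y ys n' \/ exists a r (y' : seq A) t,
    [/\ y :: ys = (a :: r) ++ (y' :: t), pin s k l n a r x & pin (x :: s) k l x y' t n'].
Proof.
elim: ys n y => [|y' ys IH] n y /=; first by left.
move=> [n1 [/predU1P[->|Hn1] Hy H]]; first by right; exists y, [::], y', ys.
case: (IH _ _ H) => [H1|[a [r [b [t [-> H1 H2]]]]]]; first by left; exists n1.
by right; exists y, (a :: r), b, t; split=> //=; exists n1.
Qed.

Lemma kleene_complete b s n y ys n' k l : (b -> size ys < k) ->
  pin s k l n y ys n' -> sem (kleene b s n n') k l (flatten (y :: ys)).
Proof.
elim: s n y ys n' => [|x s IH] n y ys n' Hb.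
  by case: ys {Hb} => [|y' ys] /=; [rewrite cats0|case=> n1 []].
(* Cutting at all returns to x yields a list of loops and a last part. Each loop uses up at least
   one edge, so the number of loops is bounded by that of edges, and the same k serves at every
   stage. *)
have loop : forall m y ys, size ys <= m -> (b -> size ys < k) ->
    pin (x :: s) k l x y ys n' -> exists (zs : seq (seq A)) c, [/\ size zs <= size ys,
      forall z, z \in zs -> sem (kleene b s x x) k l z,
      sem (kleene b s x n') k l c & flatten (y :: ys) = flatten zs ++ c].
  elim=> [|m IHm] {Hb}y {}ys Hm Hb /pin_split[H|[a [r [b' [t [E' H1 H2]]]]]].
  - by exists [::], (flatten (y :: ys)); split=> //; apply: IH H.
  - by move: E'; case: ys Hm Hb => //; case: r H1 => [|? ?].
  - by exists [::], (flatten (y :: ys)); split=> //; apply: IH H.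
  have Es : size ys = (size r + size t).+1.
    by have := congr1 size E'; rewrite size_cat /= => -[->]; rewrite addnS.
  have [|Hbb|zs [c [Z1 Z2 Z3 Z4]]] := IHm b' t _ _ H2; first by lia.
    by have := Hb Hbb; lia.
  exists (flatten (a :: r) :: zs), c; split=> //=; first by rewrite Es ltnS (leq_trans Z1) ?leq_addl.
    move=> z /predU1P[->|]; last exact: Z2.
    by apply: IH H1 => Hbb; have := Hb Hbb; lia.
  have -> : y ++ flatten ys = flatten (y :: ys) by [].
  by rewrite E' flatten_cat Z4 /= !catA.
move=> /pin_split[H|[a [r [b' [t [E' H1 H2]]]]]]; first by left; apply: IH.
have Es : size ys = (size r + size t).+1.
  by have := congr1 size E'; rewrite size_cat /= => -[->]; rewrite addnS.
have [|zs [c [Z1 Z2 Z3 Z4]]] := loop _ b' t (leqnn _) _ H2.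
  by move=> Hbb; have := Hb Hbb; lia.
right; exists (flatten (a :: r)), (flatten (b' :: t)); split=> //.
- by apply: IH H1 => Hbb; have := Hb Hbb; lia.
- exists (flatten zs), c; split=> //; rewrite sem_starop; exists zs; split=> //.
  by rewrite /starop_arity; case Eb : b => //=; apply: leq_trans Z1 _; have := Hb Eb; lia.
- by rewrite E' flatten_cat.
Qed.

Lemma mxp_pin k l n y ys n' : mxp Y k l n (y :: ys) n' <-> pin (enum N) k l n y ys n'.
Proof.
elim: ys n y => [|y' ys IH] n y.
  by split=> /= [[n1 [Hy <-]]|Hy] //; exists n'.
split=> [[n1 [Hy /IH H]]|[n1 [_ Hy /IH H]]]; last by exists n1.
by exists n1; rewrite mem_enum.
Qed.

Lemma sem_kleene_any n n' :
  approx (sem (kleene false (enum N) n n')) (gmx AnyCount Y n n').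
Proof.
apply: approx_ext => k l u; split=> [/kleene_sound[ys [H0 H1 -> _]]|]; first by exists ys.
by move=> [[|y ys] [// _ _ /mxp_pin H ->]]; apply: kleene_complete H.
Qed.

Lemma sem_kleene_atmost n n' :
  approx (sem (kleene true (enum N) n n')) (gmx AtMost Y n n').
Proof.
split=> k.
  exists (maxn k (path_bound (enum N) k)) => l u /kleene_sound[ys [H0 H1 -> H2]].
  exists ys; split=> //=; first by rewrite leq_max H2 ?orbT.
  by apply: mxp_mono H1 => //; apply: leq_maxl.
exists k => l; exists l => u [[|y ys] [// _ Hs /mxp_pin H ->]].
by apply: kleene_complete H => _.
Qed.

(** A long path visits some node x many times; the S-exponent counts the loops at x. The part after
    the last visit may be empty, which [kleene] does not describe, hence the case x = n'. *)
Definition kleene_long n n' : bsexp A :=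
  let K := kleene false (enum N) in
  foldr (fun x => BSmix (BSconcat (BSconcat (K n x) (BSexpS (K x x)))
     (BSmix (if x == n' then BSeps else BSempty) (K x n')))) BSempty (enum N).

Lemma sem_kleene_longP n n' k l u : sem (kleene_long n n') k l u <->
  exists x ys (zs : seq (seq A)) ws, [/\ mxp Y k l n ys x /\ ys <> [::],
    forall z, z \in zs -> exists2 vs, z = flatten vs & mxp Y k l x vs x /\ vs <> [::],
    l <= size zs, mxp Y k l x ws n' & u = flatten ys ++ flatten zs ++ flatten ws].
Proof.
pose K := kleene false (enum N).
have KP m m' v : sem (K m m') k l v <-> exists2 vs, v = flatten vs & mxp Y k l m vs m' /\ vs <> [::].
  split=> [/kleene_sound[ys [H0 H1 -> _]]|[[|y ys] -> []] // H1 _]; first by exists ys.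
  by apply: kleene_complete => //; apply/mxp_pin.
have -> : sem (kleene_long n n') k l u <-> exists x,
  sem (BSconcat (BSconcat (K n x) (BSexpS (K x x)))
     (BSmix (if x == n' then BSeps else BSempty) (K x n'))) k l u.
  rewrite /kleene_long -/K.
  have: (exists x, sem (BSconcat (BSconcat (K n x) (BSexpS (K x x)))
     (BSmix (if x == n' then BSeps else BSempty) (K x n'))) k l u) <->
    exists2 x, x \in enum N & sem (BSconcat (BSconcat (K n x) (BSexpS (K x x)))
     (BSmix (if x == n' then BSeps else BSempty) (K x n'))) k l u.
    by split=> [[x Hx]|[x _ Hx]]; exists x => //; rewrite mem_enum.
  move=> ->; elim: (enum N) => [|x s IH]; first by split=> // -[].
  split=> [[H|/IH[y ys Hy]]|[y /predU1P[->|ys] Hy]].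
  - by exists x; rewrite ?mem_head.
  - by exists y => //; rewrite inE ys orbT.
  - by left.
  - by right; apply/IH; exists y.
split=> [[x [y [z [[y1 [y2 [/KP[ys -> Hys] [zs [Z1 Z2 ->]] ->]]] Hz ->]]]]|].
  exists x, ys, zs.
  have [ws Hws ->] : exists2 ws, mxp Y k l x ws n' & z = flatten ws.
    case: Hz => [|/KP[ws -> [Hws _]]]; last by exists ws.
    by case: eqP => // -> /= ->; exists [::].
  by exists ws; split=> //; [move=> v /Z2 /KP|rewrite catA].
move=> [x [ys [zs [ws [Hys Hzs Hl Hws ->]]]]]; exists x.
exists (flatten ys ++ flatten zs), (flatten ws); split; last by rewrite catA.
  exists (flatten ys), (flatten zs); split=> //; first by apply/KP; exists ys.
  by exists zs; split=> // z /Hzs /KP.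
case: ws Hws => [/= <-|w ws Hws]; first by left; rewrite eqxx.
by right; apply/KP; exists (w :: ws).
Qed.

Fixpoint mxn k l n (ps : seq (N * seq A)) : Prop :=
  if ps is (n1, y) :: ps' then Y n n1 k l y /\ mxn k l n1 ps' else True.

Lemma mxp_mxn k l n ys n' : mxp Y k l n ys n' -> exists ps,
  [/\ mxn k l n ps, last n (unzip1 ps) = n' & unzip2 ps = ys].
Proof.
elim: ys n => [|y ys IH] n /=; first by move=> ->; exists [::].
move=> [n1 [Hy /IH[ps [H1 H2 H3]]]]; exists ((n1, y) :: ps).
by split=> //=; rewrite H3.
Qed.

Lemma mxn_loops k l n ps x : mxn k l n ps -> x \in unzip1 ps ->
  exists ys (zs : seq (seq A)) ws, [/\ mxp Y k l n ys x /\ ys <> [::],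
    forall z, z \in zs -> exists2 vs, z = flatten vs & mxp Y k l x vs x /\ vs <> [::],
    (size zs).+1 = count_mem x (unzip1 ps), mxp Y k l x ws (last n (unzip1 ps))
    & flatten (unzip2 ps) = flatten ys ++ flatten zs ++ flatten ws].
Proof.
elim: ps n => // -[n1 y] ps IH n /= [Hy Hps] Hx.
case Hin : (x \in unzip1 ps); last first.
  have En : n1 = x by move: Hx; rewrite inE Hin orbF => /eqP.
  subst n1; exists [:: y], [::], (unzip2 ps); split=> //.
  - by split=> //; exists x.
  - by rewrite eqxx /=; move/negbT/count_memPn: Hin => ->.
  - elim: ps x {IH Hx Hin Hy} Hps => //= -[n2 z] ps IH x [Hz /IH H]; by exists n2.
  - by rewrite /= cats0.
have [ys [zs [ws [[Y1 Y2] Z1 Z2 W E']]]] := IH _ Hps Hin.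
case: (eqVneq n1 x) => [En|Hn].
  subst n1; exists [:: y], (flatten ys :: zs), ws; split=> //.
  - by split=> //; exists x.
  - by move=> z /predU1P[->|/Z1 //]; exists ys.
  - by rewrite /= Z2 add1n.
  - by rewrite /= cats0 E' !catA.
exists (y :: ys), zs, ws; split=> //.
- by split=> //; exists n1.
- by rewrite E' /= catA.
Qed.

Lemma sem_kleene_long n n' : approx (sem (kleene_long n n')) (gmx AtLeast Y n n').
Proof.
split=> k; exists k => l.
  move=> u /sem_kleene_longP[x [ys [zs [ws [[Y1 Y2] Z1 Z2 W ->]]]]].
  have [vs [V1 V2 V3]] : exists vs, [/\ flatten zs = flatten vs, mxp Y k l x vs x
      & size zs <= size vs].
    elim: zs Z1 {Z2} => [|z zs IH] Z1; first by exists [::].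
    have [|vs [V1 V2 V3]] := IH; first by move=> v Hv; apply: Z1; rewrite inE Hv orbT.
    have [vs' E' [V1' V2']] := Z1 z (mem_head _ _); exists (vs' ++ vs); split.
    - by rewrite /= E' V1 flatten_cat.
    - by apply/mxp_cat; exists x.
    - by rewrite size_cat /=; case: vs' V2' {E' V1'} => //= *; lia.
  exists (ys ++ vs ++ ws); split.
  - by case: ys Y2 {Y1}.
  - by rewrite /= !size_cat; lia.
  - by apply/mxp_cat; exists x; split=> //; apply/mxp_cat; exists x.
  - by rewrite !flatten_cat V1.
(* Pigeonhole: a path with so many edges enters some node more than l times, which leaves at least l
   loops there. *)
exists (#|N| * l.+1).+1 => u [ys [_ Hs /(mxp_mono (leqnn k)) H ->]].
have {H} /H /mxp_mxn[ps [H1 H2 H3]] : l <= (#|N| * l.+1).+1.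
  have : 0 < #|N| by apply/card_gt0P; exists n.
  by nia.
have [x Hx] : exists x, l < count_mem x (unzip1 ps).
  apply: NNPP => Hno; move: Hs; rewrite /= -H3 size_map -(size_map fst).
  rewrite ltnNge => /negP; apply; rewrite size_count_mem -sum_nat_const.
  apply: leq_sum => x _; rewrite leqNgt; apply/negP => Hx; apply: Hno; exists x.
  exact: ltnW.
have [|ys' [zs [ws [[Y1 Y2] Z1 Z2 W E']]]] := mxn_loops H1 (x := x).
  by rewrite -has_pred1 has_count (leq_ltn_trans _ Hx).
apply/sem_kleene_longP; exists x, ys', zs, ws; split=> //.
- by rewrite -ltnS Z2.
- by rewrite -H2.
- by rewrite -E' H3.
Qed.
End Kleene.

Lemma Expr_gmx (A N : finType) (T : kind) c (X : N -> N -> glang A) n n' :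
  (c = AtMost -> allows_B T) -> (c = AtLeast -> allows_S T) ->
  (forall m m', Expr T (X m m')) -> Expr T (gmx c X n n').
Proof.
move=> HB HS H.
have /fin_all_exists [E HE] : forall m, exists f : N -> bsexp A, forall m',
    T_regular T (f m') /\ approx (sem (f m')) (X m m').
  by move=> m; have [f Hf] := fin_all_exists (H m); exists f.
have HT m m' : T_regular T (E m m') by case: (HE m m').
suff [e [He Ha]] : Expr T (gmx c (fun m m' => sem (E m m')) n n').
  exists e; split=> //; apply: approx_trans Ha _; apply: approx_gmx => m m'.
  by case: (HE m m').
case: c HB HS => HB HS.
- exists (kleene E false (enum N) n n'); split; last exact: sem_kleene_any.
  exact: kleene_regular.
- exists (kleene E true (enum N) n n'); split; last exact: sem_kleene_atmost.
  by apply: kleene_regular => // _; apply: HB.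
- exists (kleene_long E n n'); split; last exact: sem_kleene_long.
  have : forall m m', T_regular T (kleene E false (enum N) m m').
    by move=> m m'; apply: kleene_regular.
  rewrite /kleene_long; move: (kleene E false (enum N)) => K HK.
  elim: (enum N) => //= x s ->.
  by rewrite !HK HS //=; case: ifP.
Qed.

(** * From automata to expressions *)

Definition gwith (A : Type) (P : seq A -> Prop) (X : glang A) : glang A.
Proof.
exists (fun k l u => P u /\ X k l u).
by move=> k k' l l' u Hk Hl [? H]; split=> //; apply: gl_mono H.
Defined.

(** One letter contributes at most one increment, so at level 2 a claim can only hold vacuously, and
    then it holds at every level. *)
Lemma Sok_letter l b (a : action) b' : Sok 2 b [:: a] b' -> Sok l b [:: a] b'.
Proof. by rewrite !SokE; case: a; case: b; case: b' => //= /andP[]. Qed.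

Lemma allB_letter (a : action) : allB 1 [:: a].
Proof. by case: a. Qed.

Section AutomatonWords.
Variables (Sigma Gamma : finType) (A : automaton Sigma Gamma).
Local Notation letter := (Sigma * transition (state A) Gamma)%type.
Local Notation ttype := ({set Gamma} * {set Gamma})%type.
Local Notation node := (state A * {set Gamma})%type.
Implicit Types (u v : seq letter) (n : node) (m : ttype) (c : Gamma).

Definition ac c u : seq action := [seq act x.2 c | x <- u].

Fixpoint pth (q : state A) u (q' : state A) : bool :=
  if u is x :: u' then
    [&& x.2 \in delta A x.1, source x.2 == q & pth (target x.2) u' q']
  else q == q'.

Lemma pth_cat q u v q' : pth q (u ++ v) q' <-> exists q1, pth q u q1 /\ pth q1 v q'.
Proof.
elim: u q => [|x u IH] q /=.
  by split=> [?|[q1 [/eqP <- ?]]] //; exists q.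
split=> [/and3P[-> -> /IH[q1 [? ?]]]|[q1 [/and3P[-> -> ?] ?]]]; first by exists q1.
by apply/IH; exists q1.
Qed.

Lemma ac_cat c u v : ac c (u ++ v) = ac c u ++ ac c v.
Proof. exact: map_cat. Qed.

Lemma ac_flatten c us : ac c (flatten us) = flatten (map (ac c) us).
Proof. exact: map_flatten. Qed.

Definition ty u : ttype := ([set c | hasi (ac c u)], [set c | hasr (ac c u)]).
Definition tjoin m m' : ttype := (m.1 :|: m'.1, m.2 :|: m'.2).

Lemma ty_cat u v : ty (u ++ v) = tjoin (ty u) (ty v).
Proof.
by congr (_, _); apply/setP => c; rewrite !inE ac_cat /hasi ?hasr_cat ?has_cat.
Qed.

Lemma tjoinxx m : tjoin m m = m.
Proof. by case: m => a b; rewrite /tjoin /= !setUid. Qed.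

Lemma ty_flatten m us : us <> [::] -> (forall u, u \in us -> ty u = m) ->
  ty (flatten us) = m.
Proof.
case: us => // u us _; elim: us u => [|v us IH] u H.
  by rewrite /= cats0 H ?mem_head.
rewrite [flatten _]/= ty_cat H ?mem_head // [ty (v ++ _)](IH v) ?tjoinxx //.
by move=> w Hw; apply: H; rewrite inE Hw orbT.
Qed.

Lemma ty_reset c u m : ty u = m -> (c \in m.2) = hasr (ac c u).
Proof. by move=> <-; rewrite inE. Qed.

Lemma ty_incr c u m : ty u = m -> (c \in m.1) = hasi (ac c u).
Proof. by move=> <-; rewrite inE. Qed.

(** Paths of type m. The second component of a node is the set of counters whose claim at that
    endpoint designates the left side. *)
Definition G m n n' : glang letter.
Proof.
exists (fun k l u => [/\ u <> [::], ty u = m, pth n.1 u n'.1,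
  forall c, c \in Gamma_B A -> allB k (ac c u)
  & forall c, c \in Gamma_S A -> Sok l (c \in n.2) (ac c u) (c \in n'.2)]).
move=> k k' l l' u Hk Hl [? ? ? HB HS]; split=> // c Hc.
  by apply: allB_mono Hk _; apply: HB.
by apply: Sok_mono Hl _; apply: HS.
Defined.

Lemma G_cat m1 m2 n n1 n' k1 k2 l u v :
  G m1 n n1 k1 l u -> G m2 n1 n' k2 l v ->
  G (tjoin m1 m2) n n' (k1 + k2) l (u ++ v).
Proof.
move=> [u0 tu pu Bu Su] [v0 tv pv Bv Sv]; split.
- by case: u u0 {tu pu Bu Su}.
- by rewrite ty_cat tu tv.
- by apply/pth_cat; exists n1.1.
- by move=> c Hc; rewrite ac_cat allB_cat_add ?Bu ?Bv.
- by move=> c Hc; rewrite ac_cat; apply: Sok_cat (Su c Hc) (Sv c Hc).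
Qed.

Lemma G_split m n n' k l u v : u <> [::] -> v <> [::] ->
  G m n n' k (2 * l) (u ++ v) ->
  exists n1, G (ty u) n n1 k l u /\ G (ty v) n1 n' k l v.
Proof.
move=> u0 v0 [_ _ /pth_cat[q [pu pv]] HB HS].
exists (q, [set c | claim l (c \in n.2) (ac c u)]); split; split=> // c Hc.
- by have := HB c Hc; rewrite ac_cat allB_cat => /andP[].
- by have := HS c Hc; rewrite ac_cat inE => /Sok_split[].
- by have := HB c Hc; rewrite ac_cat allB_cat => /and3P[].
- by have := HS c Hc; rewrite ac_cat inE => /Sok_split[].
Qed.

(** Each cut halves the guaranteed number of increments, so the cost is exponential in the number of
    factors; only usable when that number is bounded. *)
Lemma G_splits (P : seq letter -> Prop) m m' n n' k l us : us <> [::] ->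
  (forall u, u \in us -> [/\ u <> [::], ty u = m & P u]) ->
  G m' n n' k (2 ^ size us * l) (flatten us) ->
  mxp (fun n n' => gwith P (G m n n')) k l n us n'.
Proof.
elim: us m' n => // u us IH m' n _ Hus; case: us IH Hus => [|v us] IH Hus.
  rewrite /= cats0 => H; exists n'; split=> //.
  have [u0 tu Pu] := Hus u (mem_head _ _); split=> //.
  case: H => ? ? ? HB HS; split=> // c /HS; apply: Sok_mono; exact: leq_pmull.
have [u0 tu Pu] := Hus u (mem_head _ _).
have [v0 tv Pv] : [/\ v <> [::], ty v = m & P v] by apply: Hus; rewrite !inE eqxx orbT.
rewrite [size _]/= expnS -mulnA => /G_split[//||n1 [H1 H2]].
  by case: v v0 {IH Hus tv Pv}.
exists n1; split; last first.
  apply: (IH _ _ _ _ H2) => // w Hw; apply: Hus; by rewrite inE Hw orbT.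
split=> //; rewrite -tu; apply: gl_mono H1 => //.
by rewrite leq_pmull // expn_gt0.
Qed.

(** The last letter completes the type. The case of an empty v is listed apart because the empty
    word has the type made of two empty sets. *)
Definition child m u := exists v a, [/\ u = rcons v a, ty u = m & v = [::] \/ ty v <> m].

Lemma chop m u : exists us rest, [/\ u = flatten us ++ rest,
  forall x, x \in us -> child m x & rest = [::] \/ ty rest <> m].
Proof.
elim/last_ind: u => [|u a [us [rest [-> H1 H2]]]]; first by exists [::], [::]; split=> //; left.
have [E|E] := eqVneq (ty (rcons rest a)) m; last first.
  exists us, (rcons rest a); split=> //; first by rewrite rcons_cat.
  by right; apply/eqP.
exists (rcons us (rcons rest a)), [::]; split; last by left.
  by rewrite flatten_rcons cats0 rcons_cat.
move=> x; rewrite mem_rcons inE => /predU1P[->|/H1 //].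
by exists rest, a.
Qed.

Lemma child_G m u : child m u -> u <> [::] /\ ty u = m.
Proof. by move=> [v [a [-> -> _]]]; split=> //; case: v. Qed.

(** Level 2 stands for all levels, by [Sok_letter], which makes this condition independent of l. *)
Definition letter_ok a n n' := pth n.1 [:: a] n'.1 /\
  forall c, c \in Gamma_S A -> Sok 2 (c \in n.2) (ac c [:: a]) (c \in n'.2).

Definition step m n n' : glang letter :=
  gor (gunion (fun a => gwhen (ty [:: a] = m /\ letter_ok a n n') (gconst (fun u => u = [:: a]))))
      (gunion (fun p : ttype * node * letter =>
         gwhen [/\ p.1.1 <> m, tjoin p.1.1 (ty [:: p.2]) = m & letter_ok p.2 p.1.2 n']
           (gcat (G p.1.1 n p.1.2) (gconst (fun u => u = [:: p.2]))))).

Lemma letter_G a n n' l : letter_ok a n n' -> G (ty [:: a]) n n' 1 l [:: a].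
Proof.
move=> [Hp HS]; split=> // c Hc; first exact: allB_letter.
exact: Sok_letter (HS c Hc).
Qed.

Lemma step_sound m n n' k l u : step m n n' k l u -> G m n n' (k + 1) l u.
Proof.
case=> [[a [[<- Ha] ->]]|[[[m1 n1] a] [[_ <- Ha] [y [z [Hy -> ->]]]]]].
  by apply: gl_mono (letter_G l Ha); rewrite // leq_addl.
exact: G_cat Hy (letter_G l Ha).
Qed.

Lemma step_complete m n n' : gev (gwith (child m) (G m n n')) (step m n n').
Proof.
(* The factor 2 pays for the cut before the last letter; what remains is at least 2, as [letter_ok]
   requires. *)
move=> k; exists k => l; exists (2 * maxn l 2) => u [[v [a [-> tu Hv]]] H].
case: v Hv tu H => [|x v] Hv tu H.
  left; exists a; split=> //; split=> //; case: H => _ _ Hp _ HS; split=> // c /HS.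
  by apply: Sok_mono; rewrite mul2n -addnn; lia.
have {}Hv : ty (x :: v) <> m by case: Hv.
move: H tu; rewrite -cats1 => /G_split[//|//|n1 [H1 H2]] tu.
right; exists (ty (x :: v), n1, a); split; first split=> //.
- by rewrite /= -ty_cat.
- case: H2 => _ _ Hp _ HS; split=> // c /HS; apply: Sok_mono; exact: leq_maxr.
exists (x :: v), [:: a]; split=> //; apply: gl_mono H1 => //; exact: leq_maxl.
Qed.

(* Each factor of type m increments such a counter without resetting it, so a
   bound on the counter bounds the number of factors. *)
Definition bounds_length m := [exists c, [&& c \in Gamma_B A, c \in m.1 & c \notin m.2]].

(* A claim about a counter that is incremented but not reset holds for free
   along a long enough path, so such paths only keep the claims of m.2. *)
Definition restr m n : node := (n.1, n.2 :&: m.2).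

(** Without a reset, the path carries an obligation only when the left end designates the path and
    the right end does too. Then every factor must increment the counter, so that a long path has
    many increments. *)
Definition long_ok m n n' := forall c, c \in Gamma_S A -> c \notin m.2 ->
  c \notin n.2 -> c \in n'.2 -> c \in m.1.

(** Iterations of factors of full type: bounded when some B-counter forces it; otherwise either with
    all claims kept at every cut, or long with only the claims on reset counters. The flag b tells
    whether S-exponents are available. *)
Definition loops (b : bool) m n n' : glang letter :=
  if bounds_length m then gmx AtMost (step m) n n'
  else gor (gmx AnyCount (step m) n n')
         (gwhen (b /\ long_ok m n n')
            (gmx AtLeast (step m) (restr m n) (restr m n'))).

Section Paths.
Variables (m : ttype) (k l : nat).
Local Notation path := (mxp (fun n n' => G m n n') k l).

Lemma path_mem n ys n' y : path n ys n' -> y \in ys ->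
  exists n1 n2, G m n1 n2 k l y.
Proof.
elim: ys n => //= z ys IH n [n1 [Hz Hp]] /predU1P[->|Hy]; last exact: IH Hp Hy.
by exists n, n1.
Qed.

Lemma path_pth n ys n' : path n ys n' -> pth n.1 (flatten ys) n'.1.
Proof.
elim: ys n => [|z ys IH] n /=; first by move=> ->.
by move=> [n1 [[_ _ Hz _ _] /IH Hp]]; apply/pth_cat; exists n1.1.
Qed.

Lemma path_S n ys n' c : c \in Gamma_S A -> path n ys n' -> ys <> [::] ->
  Sok l (c \in n.2) (ac c (flatten ys)) (c \in n'.2).
Proof.
move=> Hc; elim: ys n => // z ys IH n [n1 [[_ _ _ _ /(_ c Hc) Hz] Hp]] _.
case: ys IH Hp => [|y ys] IH Hp; first by rewrite /= cats0; rewrite /= in Hp; rewrite -Hp.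
by rewrite [flatten _]/= ac_cat; apply: Sok_cat Hz (IH _ Hp _).
Qed.

Lemma path_has n ys n' : path n ys n' -> forall c,
  [/\ c \in m.2 -> all hasr (map (ac c) ys),
      c \notin m.2 -> all (fun u : seq action => ~~ hasr u) (map (ac c) ys),
      c \in m.1 -> all hasi (map (ac c) ys)
    & c \in Gamma_B A -> all (allB k) (map (ac c) ys)].
Proof.
move=> Hp c; split=> Hc; apply/allP => w /mapP[y Hy ->];
  have [n1 [n2 [y0 ty_y pth_y HB HS]]] := path_mem Hp Hy.
- by rewrite -(ty_reset c ty_y).
- by rewrite -(ty_reset c ty_y).
- by rewrite -(ty_incr c ty_y).
- exact: HB.
Qed.

(** Three cases: a counter reset by every factor costs a factor 2, one incremented and never reset
    multiplies the bound by the number of factors, one never incremented stays at 0. *)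
Lemma path_B n ys n' K c : path n ys n' -> c \in Gamma_B A -> 2 * k <= K ->
  (c \in m.1 -> c \notin m.2 -> size ys * k <= K) -> allB K (ac c (flatten ys)).
Proof.
move=> Hp Hc H2 Hs; have [R1 R2 _ /(_ Hc) HB] := path_has Hp c.
rewrite ac_flatten; case Hc2 : (c \in m.2).
  by have [H _] := allB_flatten_reset (R1 Hc2) HB; apply: allB_mono H.
have {}R2 := R2 (negbT Hc2).
have Hn : ~~ hasr (flatten (map (ac c) ys)).
  by rewrite hasr_flatten -all_predC.
rewrite allB_nohasr //; case Hc1 : (c \in m.1).
  apply: leq_trans (pre_flatten_noreset R2 HB) _.
  by rewrite size_map; apply: Hs; rewrite ?Hc2.
rewrite pre0 // -ac_flatten /hasi; apply/negP => /hasP[a /mapP[x /flattenP[y Hy Hx] ->]] Ha.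
have [n1 [n2 [_ ty_y _ _ _]]] := path_mem Hp Hy.
move/negP: Hc1; apply; rewrite (ty_incr c ty_y); apply/hasP.
by exists (act x.2 c) => //; apply: map_f.
Qed.

Lemma path_G n ys n' K : path n ys n' -> ys <> [::] ->
  (forall c, c \in Gamma_B A -> allB K (ac c (flatten ys))) ->
  (forall c, c \in Gamma_S A -> Sok l (c \in n.2) (ac c (flatten ys)) (c \in n'.2)) ->
  G m n n' K l (flatten ys).
Proof.
move=> Hp H0 HB HS; split=> //; last exact: path_pth.
  case: ys H0 Hp {HB HS} => // y ys _ [n1 [[y0 _ _ _ _] _]].
  by case: y y0.
by apply: ty_flatten => // y /(path_mem Hp)[n1 [n2 []]].
Qed.
End Paths.

Lemma loops_sound b m n n' : gle (loops b m n n') (G m n n').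
Proof.
rewrite /loops; case Hd : (bounds_length m) => k.
  (* Each factor has bound k + 1, and there are at most k factors; the constant also exceeds 2(k +
     1) for the counters that are reset. *)
  exists ((k + 1) * (k + 2)) => l u [ys [H0 Hs Hp ->]].
  have {}Hp := mxp_sub (fun a1 a2 u => @step_sound m a1 a2 k l u) Hp.
  apply: path_G (Hp) _ _ _ => // c Hc; last exact: path_S Hp _.
  apply: (path_B Hp Hc) => [|_ _]; first by nia.
  have {}Hs : size ys <= k by [].
  by nia.
exists (2 * (k + 1)) => l u [[ys [H0 Hs Hp ->]]|[[_ Hlong] [ys [H0 Hs Hp ->]]]];
  have {}Hp := mxp_sub (fun a1 a2 u => @step_sound m a1 a2 k l u) Hp.
  apply: path_G (Hp) _ _ _ => // c Hc; last exact: path_S Hp _.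
  apply: (path_B Hp Hc) => // H1 H2; have/negP[] := negbT Hd.
  by apply/existsP; exists c; rewrite Hc H1.
suff : G m (restr m n) (restr m n') (2 * (k + 1)) l (flatten ys).
  case=> ? ? ? HB HS; split=> // c Hc; have := HS c Hc; rewrite !SokE !inE.
  have [R1 R2 R3 _] := path_has Hp c.
  rewrite -(@ty_reset c (flatten ys) m) //; case Hc2 : (c \in m.2); rewrite ?andbT //.
  move=> /andP[-> _] /=; apply/implyP => /andP[Hn Hn'].
  have := pre_flatten_ge (R2 (negbT Hc2)) (R3 (Hlong c Hc (negbT Hc2) Hn Hn')).
  by rewrite size_map -ac_flatten; apply: leq_trans.
apply: path_G (Hp) _ _ _ => // c Hc; last exact: path_S Hp _.
apply: (path_B Hp Hc) => // H1 H2; have/negP[] := negbT Hd.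
by rewrite /bounds_length; apply/existsP; exists c; rewrite Hc H1.
Qed.

Definition children m u := exists us, [/\ us <> [::], forall x, x \in us -> child m x
  & u = flatten us].

(** The number of factors is unbounded here. For counters in [m.2], [Sok_claims] sets all claims at
    once for a single factor 2; for the others all claims are set to the right, which is vacuous for
    words without reset. *)
Lemma G_split_long m n n' k l us : us <> [::] ->
  (forall u, u \in us -> child m u) ->
  G m n n' k (2 * l) (flatten us) ->
  mxp (fun n n' => gwith (child m) (G m n n')) k l (restr m n) us (restr m n').
Proof.
move=> us0 Hus [_ _ Hp HB HS].
have /fin_all_exists [bs Hbs] : forall c, exists bs,
    c \in Gamma_S A -> c \in m.2 -> [/\ size bs = size us,
     last (c \in n.2) bs = (c \in n'.2) & forall i, i < size us ->
      Sok l (nth (c \in n.2) ((c \in n.2) :: bs) i) (ac c (nth [::] us i))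
        (nth (c \in n.2) bs i)].
  move=> c; have [HcS|HcS] := boolP (c \in Gamma_S A); last by exists [::].
  have [Hc|Hc] := boolP (c \in m.2); last by exists [::].
  have [|||bs [B1 B2 B3]] := @Sok_claims l (c \in n.2) (map (ac c) us) (c \in n'.2).
  - by case: us us0 {Hus Hp HB HS}.
  - apply/allP => x /mapP[y Hy ->]; have [_ ty_y] := child_G (Hus y Hy).
    by rewrite -(ty_reset c ty_y).
  - by rewrite -ac_flatten; apply: HS.
  exists bs => _ _; rewrite size_map in B1 B3; split=> // i Hi.
  by have := B3 i Hi; rewrite (nth_map [::]).
have {}HB c : c \in Gamma_B A -> forall u, u \in us -> allB k (ac c u).
  move=> /HB; rewrite ac_flatten => {}HB u Hu.
  have : ac c u \in map (ac c) us by apply: map_f.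
  elim: (map _ us) HB => //= x s IH; rewrite allB_cat => /and3P[Hx Hs _].
  by rewrite inE => /predU1P[->|/(IH Hs)].
pose cutset i := [set c | [&& c \in m.2 & nth (c \in n.2) ((c \in n.2) :: bs c) i]] :&: Gamma_S A.
have main : forall d i q, i + d = size us -> pth q (flatten (drop i us)) n'.1 ->
    forall X : {set Gamma}, (forall c, c \in Gamma_S A -> (c \in X) = (c \in cutset i)) ->
    (0 < d \/ X = (restr m n').2) ->
    mxp (fun n n' => gwith (child m) (G m n n')) k l (q, X) (drop i us) (restr m n').
  elim=> [|d IH] i q Hi; first by rewrite addn0 in Hi; rewrite Hi drop_size /= => /eqP -> X _ [|->].
  have Hi' : i < size us by rewrite -Hi addnS ltnS leq_addr.
  rewrite (drop_nth [::] Hi') /= => /pth_cat[q1 [Hp1 Hp2]] X HX _.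
  have Hin := mem_nth [::] Hi'.
  (* [cutset] agrees with the prescribed last node on S-counters only, so that node itself is used
     at the last cut. *)
  pose X' := if d is 0 then (restr m n').2 else cutset i.+1.
  have HX' c : c \in Gamma_S A -> (c \in X') = (c \in cutset i.+1).
    rewrite /X'; case: d {IH} Hi @X' => // Hi X' Hc; rewrite !inE Hc andbT andbC.
    case Hc2 : (c \in m.2) => //=; have [B1 B2 B3] := Hbs c Hc Hc2.
    by rewrite -B2 (last_nth (c \in n.2)) B1 -Hi addn1.
  exists (q1, X'); split; last first.
    apply: IH Hp2 _ _ _ => //; first by rewrite addSnnS.
    by rewrite /X'; case: (d); [right|left].
  split; first exact: Hus.
  have [x0 tx] := child_G (Hus _ Hin); split=> // c Hc; first exact: HB.
  rewrite /= HX // HX' // !inE Hc !andbT.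
  case Hc2 : (c \in m.2) => /=.
    by have [_ _ B3] := Hbs c Hc Hc2; apply: B3.
  have Hn : ~~ hasr (ac c (nth [::] us i)) by rewrite -(ty_reset c tx) Hc2.
  by rewrite SokE inS_nohasr // (negbTE Hn).
have := main (size us) 0 n.1 erefl; rewrite drop0 => /(_ Hp (restr m n).2); apply.
  move=> c Hc; rewrite !inE Hc andbT /= andbC.
  by case: (c \in m.2).
by left; rewrite lt0n size_eq0; apply/eqP.
Qed.

Lemma G_noS m n n' k l l' u : Gamma_S A = set0 -> G m n n' k l u -> G m n n' k l' u.
Proof. by move=> H [? ? ? ? _]; split=> // c; rewrite H inE. Qed.

(** Boundedly many factors are separated by successive cuts, each halving the level. More factors
    than that make a path long enough for the S-exponent; without S-counters the levels are no
    constraint and any number of cuts is free. *)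
Lemma loops_complete (b : bool) m n n' : (b \/ Gamma_S A = set0) ->
  gev (gwith (children m) (G m n n')) (loops b m n n').
Proof.
move=> Hb k.
have [k' Hk'] := @gev_union _ _ (fun p : node * node => gwith (child m) (G m p.1 p.2))
  (fun p => step m p.1 p.2) (fun p => @step_complete m p.1 p.2) k.
(* Asking for [l.+1] keeps [l1] positive, so that an obligation at a positive multiple of [l1]
   forces an increment. *)
exists (maxn k k') => l; have [l1 [Hl Hl1]] := Hk' l.+1.
have conv a ys a' : mxp (fun n n' => gwith (child m) (G m n n')) k l1 a ys a' ->
    mxp (step m) (maxn k k') l a ys a'.
  apply: mxp_sub => a1 a2 u /(Hl1 (a1, a2)); apply: gl_mono => //; exact: leq_maxr.
(* Enough for max(k, l + 1) successive cuts: k covers the bounded case, l + 1 the threshold beyond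
   which the path counts as long and also an exponent of at least 1. *)
exists (2 ^ maxn k l.+1 * l1) => u [[us [us0 Hus ->]] H].
have Hus' x : x \in us -> [/\ x <> [::], ty x = m & child m x].
  by move=> /[dup] /Hus Hx /Hus /child_G[].
have short : size us <= maxn k l.+1 -> mxp (step m) (maxn k k') l n us n'.
  move=> Hs; apply/conv/(G_splits (m' := m)) => //; apply: gl_mono H => //.
  by rewrite leq_mul2r leq_exp2l ?Hs ?orbT.
rewrite /loops; case Hd : (bounds_length m).
  have Hs : size us <= k.
    have/existsP[c /and3P[HcB Hc1 Hc2]] := Hd; case: H => _ _ _ /(_ c HcB) HB _.
    have Hr : all (fun u : seq action => ~~ hasr u) (map (ac c) us).
      apply/allP => x /mapP[y /Hus' [_ ty_y _] ->].
      by rewrite -(ty_reset c ty_y).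
    have Hi : all hasi (map (ac c) us).
      apply/allP => x /mapP[y /Hus' [_ ty_y _] ->].
      by rewrite -(ty_incr c ty_y).
    have := pre_flatten_ge Hr Hi; rewrite size_map -ac_flatten => H.
    exact: leq_trans H (allB_pre HB).
  exists us; split=> //=; first by rewrite leq_max Hs.
  by apply: short; rewrite leq_max Hs.
case: (leqP (size us) (maxn k l.+1)) => Hs.
  by left; exists us; split=> //; apply: short.
case: Hb => [Hb|HS0]; last first.
  left; exists us; split=> //; apply/conv/(G_splits (m' := m)) => //.
  exact: G_noS H.
right; split.
  split=> // c Hc Hc2 Hcn Hcn'; case: (H) => _ tm _ _ /(_ c Hc).
  rewrite SokE -(ty_reset c tm) (negbTE Hc2) Hcn Hcn' /= => /andP[_ H1].
  rewrite (ty_incr c tm); apply/negPn/negP => Hi.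
  by move: H1; rewrite pre0 // leqn0 muln_eq0 expn_eq0 /= => /eqP l0; rewrite l0 in Hl.
exists us; split=> //.
  by rewrite /=; move: Hs; rewrite gtn_max => /andP[_ /ltnW /ltnW].
apply/conv/G_split_long => //; apply: gl_mono H => //.
by rewrite leq_mul2r; apply/orP; right; rewrite -{1}(expn1 2) leq_exp2l // leq_max orbT.
Qed.

(** The greedy cutting leaves a rest whose type is contained in m and differs from it, hence of
    smaller rank. *)
Lemma G_loops (b : bool) m n n' : (b \/ Gamma_S A = set0) ->
  approx (gor (loops b m n n') (gunion (fun p : ttype * node =>
     gwhen (p.1 <> m /\ tjoin m p.1 = m) (gcat (loops b m n p.2) (G p.1 p.2 n')))))
   (G m n n').
Proof.
move=> Hb; split=> k.
  have [k1 H1] := loops_sound b m n n' k.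
  have [k2 H2] := @gle_union _ _ (fun p => loops b m n p) (fun p => G m n p)
    (fun p => loops_sound b m n p) k.
  exists (maxn k1 (k2 + k)) => l u [/H1|[[m1 n1] [[_ Hm] [y [z [/(H2 _ n1) Hy Hz ->]]]]]].
    by apply: gl_mono => //; apply: leq_maxl.
  by rewrite -Hm; apply: gl_mono (G_cat Hy Hz) => //; apply: leq_maxr.
have [k1 H1] := @gev_union _ _ (fun p => gwith (children m) (G m n p)) (fun p => loops b m n p)
    (fun p => @loops_complete b m n p Hb) k.
exists (maxn k1 k) => l; have [l1 [Hl Hl1]] := H1 l.
exists (2 * l1) => u H; have [us [rest [E Hus Hrest]]] := chop m u.
(* The whole word has type m; with no factor it would be its own rest, of another type or empty. *)
have us0 : us <> [::].
  move=> us0; move: E Hrest; rewrite us0 /= => <-; case: H => u0 tu _ _ _.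
  by case.
case: rest E Hrest => [|x rest] E Hrest.
  left; apply: (@gl_mono _ (loops b m n n') k1 _ l _); rewrite ?leq_maxl //.
  apply: Hl1; split; first by exists us; split=> //; rewrite E cats0.
  by apply: gl_mono H => //; lia.
have {}Hrest : ty (x :: rest) <> m by case: Hrest.
have f0 : flatten us <> [::].
  case: us us0 Hus {E} => // y us _ /(_ y (mem_head _ _)) /child_G[].
  by case: y.
have tf : ty (flatten us) = m by apply: ty_flatten => // y /Hus /child_G[].
have tm : tjoin m (ty (x :: rest)) = m.
  by case: H => _ tu _ _ _; rewrite -{2}tu E ty_cat tf.
move: H; rewrite E => /G_split[//|//|n1 [Hf Hr]].
right; exists (ty (x :: rest), n1); split=> //.
exists (flatten us), (x :: rest); split=> //.
  apply: (@gl_mono _ (loops b m n n1) k1 _ l _); rewrite ?leq_maxl //.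
  by apply: Hl1; split; [exists us|rewrite -{1}tf].
by apply: gl_mono Hr; rewrite ?leq_maxr.
Qed.

Definition trank m := #|m.1| + #|m.2|.

Lemma trank_lt m1 m : m1 <> m -> tjoin m m1 = m -> trank m1 < trank m.
Proof.
case: m => a b; case: m1 => a1 b1 Hne [Ha Hb]; rewrite /trank /=.
have Sa : a1 \subset a by rewrite -Ha subsetUr.
have Sb : b1 \subset b by rewrite -Hb subsetUr.
case: (eqVneq a1 a) => [Ea|Na]; last first.
  rewrite -addSn leq_add ?subset_leq_card //; apply: proper_card.
  by rewrite properEneq Na.
rewrite Ea -addnS leq_add2l; apply: proper_card; rewrite properEneq Sb andbT.
by apply/eqP => Eb; apply: Hne; rewrite Ea Eb.
Qed.

Lemma tjoinC m1 m2 : tjoin m1 m2 = tjoin m2 m1.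
Proof. by rewrite /tjoin setUC [m1.2 :|: _]setUC. Qed.

Lemma tjoinA m1 m2 m3 : tjoin m1 (tjoin m2 m3) = tjoin (tjoin m1 m2) m3.
Proof. by rewrite /tjoin /= !setUA. Qed.

(** Induction on [trank]. B-exponents appear only where a B-counter exists, and S-exponents are
    dispensed with when there is no S-counter, so the kind T is respected. *)
Theorem Expr_G T m n n' : is_T_automaton A T -> Expr T (G m n n').
Proof.
move=> HT.
have HB : Gamma_B A <> set0 -> allows_B T by case: T HT.
have HS : allows_S T \/ Gamma_S A = set0 by case: T HT {HB}; [left|right|left].
have [r] := ubnP (trank m); elim: r m n n' => // r IH m n n' Hr.
have Hstep a a' : Expr T (step m a a').
  apply: Expr_or; apply: Expr_union.
    by move=> x; apply: Expr_when => _; apply: Expr_letter.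
  move=> [[m1 n1] x]; apply: Expr_when => -[/= H1 H2 _]; apply: Expr_cat (Expr_letter _ _).
  apply: IH; apply: (@leq_trans (trank m)) => //; apply: trank_lt => //.
  by rewrite -H2 tjoinC tjoinA tjoinxx.
have Hloops a a' : Expr T (loops (allows_S T) m a a').
  rewrite /loops; case: ifP => Hd.
    apply: Expr_gmx => // _; apply: HB => HB0.
    by have/existsP[c] := Hd; rewrite HB0 inE.
  by apply: Expr_or; [apply: Expr_gmx|apply: Expr_when => -[? _]; apply: Expr_gmx].
apply: Expr_approx (G_loops m n n' HS) _; apply: Expr_or => //.
apply: Expr_union => -[m1 n1]; apply: Expr_when => -[/= H1 H2].
by apply: Expr_cat => //; apply: IH; apply: (@leq_trans (trank m)) => //; apply: trank_lt.
Qed.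
End AutomatonWords.

(** * Projection of expressions along a letter map *)

Fixpoint bmap (A B : finType) (f : A -> B) (e : bsexp A) : bsexp B :=
  match e with
  | BSempty => BSempty
  | BSeps => BSeps
  | BSepsbar => BSepsbar
  | BSletter a => BSletter (f a)
  | BSconcat e1 e2 => BSconcat (bmap f e1) (bmap f e2)
  | BSmix e1 e2 => BSmix (bmap f e1) (bmap f e2)
  | BSstar e1 => BSstar (bmap f e1)
  | BSexpB e1 => BSexpB (bmap f e1)
  | BSexpS e1 => BSexpS (bmap f e1)
  end.

Lemma bmap_regular (A B : finType) (f : A -> B) T e :
  T_regular T (bmap f e) = T_regular T e.
Proof. by elim: e => //= [e1 -> e2 ->|e1 -> e2 ->|e ->|e ->]. Qed.

Lemma sem_bmap (A B : finType) (f : A -> B) e k l w :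
  sem (bmap f e) k l w <-> exists2 u, sem e k l u & w = map f u.
Proof.
have lists (X : glang A) (Y : glang B) c :
    (forall w, Y k l w <-> exists2 u, X k l u & w = map f u) ->
    forall w, gexp c Y k l w <-> exists2 u, gexp c X k l u & w = map f u.
  move=> H {}w; split=> [[ys [H1 H2 ->]]|[u [ys [H1 H2 ->]] ->]]; last first.
    exists (map (map f) ys); split; rewrite ?size_map ?map_flatten //.
    by move=> y /mapP[z /H2 Hz ->]; apply/H; exists z.
  suff [zs [Z1 Z2]] : exists zs, (forall z, z \in zs -> X k l z) /\ ys = map (map f) zs.
    exists (flatten zs); last by rewrite Z2 map_flatten.
    by exists zs; split=> //; move: H1; rewrite Z2 size_map.
  elim: ys H2 {H1} => [|y ys IH] H2; first by exists [::].
  have [z Hz Ez] := proj1 (H y) (H2 y (mem_head _ _)).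
  have [|zs [Z1 ->]] := IH; first by move=> y' Hy'; apply: H2; rewrite inE Hy' orbT.
  exists (z :: zs); split; last by rewrite Ez.
  by move=> z' /predU1P[->|/Z1].
elim: e w => [|||a|e1 IH1 e2 IH2|e1 IH1 e2 IH2|e1 IH1|e1 IH1|e1 IH1] w /=.
- by split=> // -[].
- by split=> [->|[u -> ->]] //; exists [::].
- by split=> [[-> ->]|[u [-> ->] ->]] //; exists [::].
- by split=> [->|[u -> ->]] //; exists [:: a].
- split=> [[y [z [/IH1[y' Hy ->] /IH2[z' Hz ->] ->]]]|[u [y [z [Hy Hz ->]]] ->]].
    by exists (y' ++ z'); rewrite ?map_cat //; exists y', z'.
  exists (map f y), (map f z); rewrite map_cat; split=> //.
    by apply/IH1; exists y.
  by apply/IH2; exists z.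
- split=> [[/IH1[u Hu ->]|/IH2[u Hu ->]]|[u [Hu|Hu] ->]].
  + by exists u => //; left.
  + by exists u => //; right.
  + by left; apply/IH1; exists u.
  + by right; apply/IH2; exists u.
- exact: (lists _ _ AnyCount IH1).
- exact: (lists _ _ AtMost IH1).
- exact: (lists _ _ AtLeast IH1).
Qed.

Lemma map_nil (A B : eqType) (f : A -> B) u : (map f u == [::]) = (u == [::]).
Proof. by case: u. Qed.

Lemma om_bmap (A B : finType) (f : A -> B) e (w : omega_word A) :
  om (sem e) w -> om (sem (bmap f e)) (fun i => f (w i)).
Proof.
move=> [u [[k [H0 H]] Hn Hp]]; exists (fun i => map f (u i)); split=> [|n|n].
- exists k; split=> [i Hi|l]; first by apply/sem_bmap; exists (u i) => //; apply: H0.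
  have [N HN] := H l; exists N => i Ni Hi; apply/sem_bmap; exists (u i) => //.
  exact: HN.
- by have [i Hi ui] := Hn n; exists i; rewrite ?map_nil.
- have := Hp n; rewrite /prefix_of => /(congr1 (map f)).
  rewrite !mkseq_seg map_seg -map_seg map_flatten map_seg !size_flatten /shape.
  by rewrite !map_seg => <-; rewrite /seg; congr map; congr index_iota; congr sumn;
    apply: eq_map => i; rewrite /= size_map.
Qed.

(** * Counter sequences along infinite runs *)

Section CounterStreams.
Implicit Types (s : nat -> action).

Definition infinite_resets s := forall n, exists2 i, n <= i & s i = Reset.

Lemma pre_seg_sum s a b : ~~ hasr (seg s a b) ->
  \sum_(a <= t < b) (s t == Incr) = pre (seg s a b).
Proof.
rewrite /seg; elim: (index_iota a b) => [|t r IH]; first by rewrite big_nil.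
rewrite map_cons hasr_cons negb_or big_cons => /andP[Ht /IH ->].
by rewrite -isiE /=; case: (s t) Ht.
Qed.

Lemma allB_seg s K a b : (forall i, a <= i -> pre (seg s i b) <= K) ->
  allB K (seg s a b).
Proof.
move: {2}(b - a) (leqnn (b - a)) => d; elim: d a => [|d IH] a Hd H.
  by rewrite seg_nil // -subn_eq0 -leqn0.
case: (leqP b a) => ab; first by rewrite seg_nil.
have := H a (leqnn a); rewrite seg_cons //= => ->.
by apply: IH => [|i Hi]; [lia|apply/H/ltnW].
Qed.

Lemma inS_seg s l a b :
  (forall i, a <= i -> s i = Reset -> hasr (seg s i.+1 b) -> l <= pre (seg s i.+1 b)) ->
  inS l (seg s a b).
Proof.
move: {2}(b - a) (leqnn (b - a)) => d; elim: d a => [|d IH] a Hd H.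
  by rewrite seg_nil // -subn_eq0 -leqn0.
case: (leqP b a) => ab; first by rewrite seg_nil.
rewrite seg_cons //= IH ?andbT; [|by lia|by move=> i Hi; apply/H/ltnW].
by apply/implyP => /andP[Ha Hr]; apply: H => //; case: (s a) Ha.
Qed.

Lemma hasr_segP s a b : hasr (seg s a b) <-> exists2 i, a <= i < b & s i = Reset.
Proof.
split=> [/hasP[x /mapP[i]]|[i Hi si]]; first rewrite mem_index_iota => Hi -> Hr.
  by exists i => //; case: (s i) Hr.
by apply/hasP; exists (s i); [apply: map_f; rewrite mem_index_iota|rewrite si].
Qed.

Section Enumeration.
Variables (s : nat -> action) (n : nat -> nat).
Hypothesis n_incr : forall j, n j < n j.+1.
Hypothesis n_reset : forall k, s k = Reset <-> exists j, n j = k.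

Let start j := if j is j'.+1 then (n j').+1 else 0.

Lemma noreset_interval j : ~~ hasr (seg s (start j) (n j)).
Proof.
apply/negP => /hasr_segP[i /andP[Hi1 Hi2] /n_reset[j' Ej]]; subst i.
have : j' < j by rewrite ltnNge; apply/negP => /(strict_mono_le n_incr); rewrite leqNgt Hi2.
case: j {Hi2} Hi1 => //= j Hi1; rewrite ltnS => /(strict_mono_le n_incr).
by rewrite leqNgt Hi1.
Qed.

Lemma interval_of i : exists j, start j <= i <= n j.
Proof.
have [j [Hj Hm]] := @nat_minimal (fun j => i <= n j)
  (ex_intro _ i (strict_mono_ge n_incr i)).
exists j; rewrite Hj andbT; case: j Hj Hm => //= j _ Hm.
by rewrite ltnNge; apply/negP => /Hm; rewrite ltnn.
Qed.

Lemma start_le j : start j <= n j.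
Proof. by case: j => //= j. Qed.

Lemma seg_next j b : n j < b -> forall i, start j <= i <= n j ->
  pre (seg s i b) = pre (seg s i (n j)) /\ hasr (seg s i b).
Proof.
move=> Hb i /andP[Hi1 Hi2]; have sn : s (n j) = Reset by apply/n_reset; exists j.
have Hn : ~~ hasr (seg s i (n j)).
  by have := noreset_interval j; rewrite (seg_cat s Hi1 Hi2) hasr_cat negb_or => /andP[].
by rewrite (seg_cat s Hi2 (ltnW Hb)) (seg_cons s Hb) sn pre_cat hasr_cat (negbTE Hn) addn0.
Qed.

Lemma pre_interval_le i j b : start j <= i <= n j ->
  pre (seg s i b) <= pre (seg s (start j) (n j)).
Proof.
move=> /andP[Hi1 Hi2]; have := noreset_interval j.
rewrite (seg_cat s Hi1 Hi2) hasr_cat negb_or => /andP[H1 H2].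
rewrite pre_nohasr_cat //; case: (leqP b (n j)) => Hb; last first.
  have [|-> _] := seg_next Hb (i := i); first by rewrite Hi1.
  exact: leq_addl.
case: (leqP b i) => Hib; first by rewrite [seg s i b]seg_nil.
move: H2; rewrite (seg_cat s (ltnW Hib) Hb) hasr_cat negb_or => /andP[H2 _].
by rewrite pre_nohasr_cat //; lia.
Qed.

Variable x : nat -> nat.
Hypothesis xE : forall j, x j = pre (seg s (start j) (n j)).

Lemma enum_infinite_resets : infinite_resets s.
Proof.
move=> i; exists (n i); first exact: strict_mono_ge.
by apply/n_reset; exists i.
Qed.

Lemma enum_bounded : bounded x -> exists K, forall a b, allB K (seg s a b).
Proof.
(* The limsup condition leaves finitely many intervals free; their maximum makes the bound uniform
   from position 0 on. *)
move=> [K [N HK]]; exists (maxn K (\max_(j < N) x j)) => a b; apply: allB_seg => i _.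
have [j Hj] := interval_of i; apply: leq_trans (pre_interval_le b Hj) _.
rewrite -xE leq_max; case: (leqP N j) => HN; first by rewrite HK.
by rewrite (leq_bigmax (Ordinal HN)) orbT.
Qed.

Lemma enum_unbounded : strongly_unbounded x ->
  forall l, exists N, forall b, inS l (seg s N b).
Proof.
move=> H l; have [N HN] := H l; exists (n N) => b; apply: inS_seg => i Hi.
move=> /n_reset[j Ej]; subst i; case: (leqP b (n j.+1)) => Hb.
  case: (leqP b (n j).+1) => Hb'; first by rewrite seg_nil.
  have := noreset_interval j.+1; rewrite (seg_cat s (ltnW Hb') Hb) hasr_cat negb_or.
  by move=> /andP[/negbTE ->].
have [|-> _ _] := @seg_next j.+1 b Hb (n j).+1; first by rewrite /= leqnn n_incr.
rewrite -[X in pre X]/(seg s (start j.+1) (n j.+1)) -xE; apply: HN.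
rewrite leqNgt; apply/negP => Hlt; have := strict_mono_le n_incr Hlt.
have := n_incr j; have := n_incr j.+1; lia.
Qed.

Lemma enum_bounded_conv : (exists K N, forall b, allB K (seg s N b)) -> bounded x.
Proof.
move=> [K [N H]]; exists K, N => j Hj; have Hs : N <= start j.
  case: j Hj => //= j Hj; apply: leq_trans Hj _; rewrite ltnS.
  exact: strict_mono_ge.
have := H (n j); rewrite (seg_cat s Hs (start_le j)) allB_cat xE => /and3P[_ /allB_pre ? _].
by [].
Qed.

Lemma enum_unbounded_conv : (forall l, exists N, forall b, inS l (seg s N b)) ->
  strongly_unbounded x.
Proof.
move=> H l; have [N HN] := H l; exists N.+1 => -[|j] // Hj.
have Hs : N <= n j by apply: leq_trans (strict_mono_ge n_incr j).
have := HN (n j.+1).+1; rewrite (seg_cat s Hs (leqW (ltnW (n_incr j)))).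
rewrite inS_cat => /and3P[_ + _].
rewrite (seg_cons s (leqW (n_incr j))).
have /n_reset -> : exists j', n j' = n j by exists j.
have [|E Hr] := @seg_next j.+1 (n j.+1).+1 (ltnSn _) (n j).+1; first by rewrite /= leqnn n_incr.
by rewrite /= Hr E xE /= => /andP[].
Qed.
End Enumeration.
End CounterStreams.

Section RunCounters.
Variables (Sigma Gamma : finType) (A : automaton Sigma Gamma).
Variables (rho : nat -> transition (state A) Gamma) (c : Gamma).
Local Notation s := (fun t => act (rho t) c).

Lemma counter_values x : infinite_counter_seq rho c x ->
  [/\ infinite_resets s, bounded x -> exists K, forall a b, allB K (seg s a b)
    & strongly_unbounded x -> forall l, exists N, forall b, inS l (seg s N b)].
Proof.
move=> [n [n_incr n_reset xE]].
have xE' j : x j = pre (seg s (if j is j'.+1 then (n j').+1 else 0) (n j)).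
  by rewrite xE pre_seg_sum //; apply: noreset_interval.
split; first exact: (enum_infinite_resets n_incr n_reset).
  exact: (enum_bounded n_incr n_reset xE').
exact: (enum_unbounded n_incr n_reset xE').
Qed.

(** Together with [counter_values] this replaces counter sequences by conditions on the factors of a
    run, which are stable under cutting. *)
Lemma counter_exists : infinite_resets s -> exists x, [/\ infinite_counter_seq rho c x,
    (exists K N, forall b, allB K (seg s N b)) -> bounded x
  & (forall l, exists N, forall b, inS l (seg s N b)) -> strongly_unbounded x].
Proof.
move=> /enum_infinite[n [n_incr n_D n_reset]].
pose x j := pre (seg s (if j is j'.+1 then (n j').+1 else 0) (n j)).
exists x; split.
- by exists n; split=> // j; rewrite pre_seg_sum //; apply: noreset_interval.
- exact: (@enum_bounded_conv _ _ n_incr x).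
- exact: (@enum_unbounded_conv _ _ n_incr n_reset x).
Qed.
End RunCounters.

Section RunStreams.
Variables (Sigma Gamma : finType) (A : automaton Sigma Gamma).
Local Notation letter := (Sigma * transition (state A) Gamma)%type.
Implicit Types (u : seq letter) (sg : nat -> letter).

Lemma run_pth (w : omega_word Sigma) rho a b : is_run w rho -> a <= b ->
  pth (A := A) (source (rho a)) (seg (fun t => (w t, rho t)) a b) (source (rho b)).
Proof.
move=> Hr /subnKC <-; elim: (b - a) => [|d IH]; first by rewrite addn0 seg_nil //=.
rewrite addnS seg_rcons ?leq_addr // -cats1; apply/pth_cat; exists (source (rho (a + d))).
by have [H1 H2] := Hr (a + d); split=> //=; rewrite H1 H2 !eqxx.
Qed.

Lemma stream_run q sg : (forall n, exists2 N, n <= N & exists q', pth (A := A) q (seg sg 0 N) q') ->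
  is_run (fun t => (sg t).1) (fun t => (sg t).2) /\ source (sg 0).2 = q.
Proof.
move=> H; split=> [j|].
  have [N HN [q']] := H j.+2; rewrite (@seg_cat _ sg 0 j N) //; last lia.
  have [j1 j2] : j < N /\ j.+1 < N by lia.
  case/pth_cat=> q1 [_]; rewrite (seg_cons _ j1) (seg_cons _ j2).
  by move=> /= /and5P[-> _ _ /eqP -> _].
have [N HN [q']] := H 1; rewrite seg_cons //= => /and3P[_ /eqP] //.
Qed.

Lemma ac_seg sg (c : Gamma) a b : ac c (seg sg a b) = seg (fun t => act (sg t).2 c) a b.
Proof. by rewrite /ac map_seg. Qed.
End RunStreams.

Section AcceptingBounds.
Variables (Sigma Gamma : finType) (A : automaton Sigma Gamma).
Variable rho : nat -> transition (state A) Gamma.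
Local Notation s c := (fun t => act (rho t) c).

Lemma accepting_bounds : accepting (A := A) rho ->
  [/\ forall c, infinite_resets (s c),
      exists K, forall c, c \in Gamma_B A -> forall a b, allB K (seg (s c) a b)
    & forall l, exists N, forall c, c \in Gamma_S A ->
        forall a b, N <= a -> inS l (seg (s c) a b)].
Proof.
move=> [_ Hacc]; split=> [c||l].
- by have [x [/counter_values[]]] := Hacc c.
- have /fin_all_exists [f Hf] : forall c, exists K, c \in Gamma_B A ->
      forall a b, allB K (seg (s c) a b).
    move=> c; have [HcB|HcB] := boolP (c \in Gamma_B A); last by exists 0.
    have [x [/counter_values[_ H _] Hb _]] := Hacc c.
    by have [K HK] := H (Hb HcB); exists K.
  exists (\max_c f c) => c Hc a b; apply: allB_mono (Hf c Hc a b).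
  exact: leq_bigmax.
have /fin_all_exists [f Hf] : forall c, exists N, c \in Gamma_S A ->
    forall b, inS l (seg (s c) N b).
  move=> c; have [HcS|HcS] := boolP (c \in Gamma_S A); last by exists 0.
  have [x [/counter_values[_ _ H] _ Hb]] := Hacc c.
  by have [N HN] := H (Hb HcS) l; exists N.
exists (\max_c f c) => c Hc a b Ha.
have fa : f c <= a by apply: leq_trans Ha; apply: leq_bigmax.
case: (leqP b a) => ab; first by rewrite seg_nil.
by have := Hf c Hc b; rewrite (seg_cat _ fa (ltnW ab)) inS_cat => /and3P[].
Qed.
End AcceptingBounds.

Lemma Sok_flatten l b us : (forall u, u \in us -> Sok l b u b) -> Sok l b (flatten us) b.
Proof.
elim: us => [|u us IH] H; first by rewrite SokE; case: b H.
apply: Sok_cat (H u (mem_head _ _)) (IH _) => v Hv; apply: H.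
by rewrite inE Hv orbT.
Qed.

Lemma Sok_inS l b u b' : Sok l b u b' -> inS l u.
Proof. by rewrite SokE => /andP[]. Qed.

Lemma allB_seg_sub (s : nat -> action) k a b b' : b <= b' ->
  allB k (seg s a b') -> allB k (seg s a b).
Proof.
move=> Hb; case: (leqP a b) => ab; last by rewrite (seg_nil _ (ltnW ab)).
by rewrite (seg_cat s ab Hb) allB_cat => /and3P[].
Qed.

Lemma inS_seg_sub (s : nat -> action) l a b b' : b <= b' ->
  inS l (seg s a b') -> inS l (seg s a b).
Proof.
move=> Hb; case: (leqP a b) => ab; last by rewrite (seg_nil _ (ltnW ab)).
by rewrite (seg_cat s ab Hb) inS_cat => /and3P[].
Qed.

Section FlattenedStream.
Variables (A : eqType) (V : nat -> seq A) (sg : nat -> A).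
Hypothesis V_inf : forall n, exists2 i, n <= i & V i != [::].
Hypothesis sgE : forall n, seg sg 0 (cut V n) = flatten (seg V 0 n).

Lemma cut_unbounded j : exists n, j <= cut V n.
Proof.
elim: j => [|j [n Hn]]; first by exists 0.
have [i Hi Vi] := V_inf n; exists i.+1; rewrite cutS -addn1 leq_add //.
  exact: leq_trans Hn (leq_cut V Hi).
by case: (V i) Vi.
Qed.

Lemma seg_cut m n : m <= n -> seg sg (cut V m) (cut V n) = flatten (seg V m n).
Proof.
move=> mn; have := sgE n; rewrite (@seg_cat _ V 0 m) // flatten_cat -sgE.
rewrite (@seg_cat _ sg 0 (cut V m)) ?leq_cut // => /eqP.
by rewrite eqseq_cat // => /andP[_ /eqP].
Qed.
End FlattenedStream.

Lemma map_flatten_prefix (A B : finType) (f : A -> B) (V : nat -> seq A) sg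
   (w : omega_word B) :
  (forall n, exists2 i, n <= i & V i != [::]) ->
  (forall n, seg sg 0 (cut V n) = flatten (seg V 0 n)) ->
  (forall n, prefix_of (flatten (seg (fun i => map f (V i)) 0 n)) w) ->
  forall t, w t = f (sg t).
Proof.
move=> Vi Hs Hp t; have [n Hn] := cut_unbounded Vi t.+1.
have E : map f (seg sg 0 (cut V n)) = seg w 0 (cut V n).
  have := Hp n; rewrite -map_seg -map_flatten -Hs /prefix_of size_map size_seg subn0.
  by rewrite mkseq_seg.
have := congr1 (fun s => nth (f (sg t)) s t) E.
rewrite (nth_map (sg t)) ?size_seg ?subn0 // !nth_seg ?subn0 //.
Qed.

(** * Accepting runs as omega-powers of loops *)

Section AutomatonToExpression.
Variables (T : kind) (Sigma Gamma : finType) (A : automaton Sigma Gamma).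
Hypothesis HT : is_T_automaton A T.
Local Notation letter := (Sigma * transition (state A) Gamma)%type.
Local Notation node := (state A * {set Gamma})%type.

(** Loops at n that reset every counter: their omega-powers are the tails of accepting runs. *)
Definition full (n : node) : glang letter :=
  gunion (fun I : {set Gamma} => G (I, [set: Gamma]) n n).

Lemma fullE n k l u : full n k l u <-> [/\ u <> [::], forall c, hasr (ac c u),
  pth n.1 u n.1, forall c, c \in Gamma_B A -> allB k (ac c u)
  & forall c, c \in Gamma_S A -> Sok l (c \in n.2) (ac c u) (c \in n.2)].
Proof.
split=> [[I [u0 tu ? ? ?]]|[u0 Hr ? ? ?]].
  by split=> // c; rewrite -(ty_reset c tu) inE.
exists (ty u).1; split=> //; congr (_, _); apply/setP => c.
by rewrite !inE Hr.
Qed.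

(** Kleene's theorem as a by-product: with single letters as matrix entries and no counting, the
    expression for paths is erased to a regular one. The empty path is added apart, since matrix
    paths have positive length. *)
Lemma prefix_regexp q : exists r : regexp Sigma, forall x, reg_lang r x <->
  exists2 u, map fst u = x & pth (A := A) (init A) u q.
Proof.
pose X q q' : glang letter := gunion (fun a : letter =>
  gwhen (pth q [:: a] q') (gconst (fun u => u = [:: a]))).
have HX q1 q2 k l u : X q1 q2 k l u <-> exists2 a, u = [:: a] & pth q1 [:: a] q2.
  by split=> [[a [Ha ->]]|[a -> Ha]]; exists a.
have mxpX k l ys q1 q2 : mxp X k l q1 ys q2 -> pth q1 (flatten ys) q2.
  elim: ys q1 => [|y ys IH] q1 /=; first by move=> ->.
  move=> [q3 [Hy /IH Hp]]; apply/pth_cat; exists q3; split=> //.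
  by have [a -> Ha] := proj1 (HX q1 q3 k l y) Hy.
have mxpX' k l u q1 q2 : pth q1 u q2 -> mxp X k l q1 [seq [:: a] | a <- u] q2.
  elim: u q1 => [|a u IH] q1; first by move=> /eqP.
  move=> /and3P[H1 H2 H3]; exists (target a.2); split; last exact: IH.
  by apply/(HX _ _ k l); exists a => //=; rewrite H1 H2 /=.
have [//|//|q1 q2|e [_ [E1 E2]]] := @Expr_gmx letter (state A) KindBS AnyCount X (init A) q.
  by apply: Expr_union => a; apply: Expr_when => _; apply: Expr_letter.
exists (Rplus (if q == init A then Reps else Rempty) (erase (bmap fst e))) => x.
have -> : reg_lang (Rplus (if q == init A then Reps else Rempty) (erase (bmap fst e))) x <->
   (x = [::] /\ q = init A) \/ exists k, sem (bmap fst e) k 0 x.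
  have [H1 H2] := reg_lang_erase (bmap fst e) x.
  split=> [[Hx|/H1 Hx]|[[-> ->]|/H2 Hx]].
  - by left; move: Hx; case: eqP.
  - by right.
  - by left; rewrite eqxx.
  - by right.
split=> [[[-> ->]|[k /sem_bmap[u Hu ->]]]|[u <- Hu]]; first by exists [::] => //=.
  have [k' Hk] := E1 k; have [ys [_ _ Hp ->]] := Hk _ _ Hu.
  by exists (flatten ys) => //; apply: mxpX Hp.
case: u Hu => [|a u] Hu; first by left; split=> //; rewrite (eqP Hu).
right; have [k Hk] := E2 0; have [l Hl] := Hk 0; exists k.
apply/sem_bmap; exists (a :: u) => //; apply: Hl.
exists [seq [:: b] | b <- a :: u]; split=> //; first exact: mxpX'.
by elim: (a :: u) => //= b v {1}->.
Qed.

(** The claims at both ends of every loop are the same, so the loops compose at each level; each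
    counter is reset in each loop, hence infinitely often. *)
Lemma full_accepting n u0 (v : nat -> seq letter) k lv w :
  pth (A := A) (init A) u0 n.1 -> strongly_unbounded lv ->
  (forall i, full n k (lv i) (v i)) ->
  (forall m, prefix_of (map fst (u0 ++ flatten (seg v 0 m))) w) ->
  exists rho, is_run w rho /\ accepting (A := A) rho.
Proof.
move=> Hp0 Hlv Hv Hp.
pose V i := if i is i'.+1 then v i' else u0.
have V_inf m : exists2 i, m <= i & V i != [::].
  exists m.+1 => //; have /fullE[v0 _ _ _ _] := Hv m.
  exact/eqP.
have segV m m' : seg V m.+1 m'.+1 = seg v m m'.
  by rewrite -add1n -[m'.+1]add1n -seg_shift.
have [|sg sgE] := @flatten_stream _ (w 0, (init A, [ffun=> NoAct], init A)) V.
  by move=> m; have [i Hi Vi] := V_inf m; exists i => //; rewrite lt0n size_eq0.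
have w_sg : forall t, w t = (sg t).1.
  apply: (map_flatten_prefix V_inf sgE) => -[|m]; first by rewrite seg_nil.
  by rewrite -map_seg -map_flatten seg_cons //= segV; apply: Hp.
have full_mem y m m' : y \in seg v m m' -> exists2 i, m <= i & full n k (lv i) y.
  by move=> /mapP[i]; rewrite mem_index_iota => /andP[Hi _] ->; exists i => //.
have [run_sg src] : is_run (fun t => (sg t).1) (fun t => (sg t).2) /\ source (sg 0).2 = init A.
  apply: stream_run => m; have [j Hj] := cut_unbounded V_inf m.
  exists (cut V j.+1); first exact: leq_trans Hj (leq_cut V (leqnSn j)).
  exists n.1; rewrite sgE seg_cons // [flatten _]/=; apply/pth_cat; exists n.1; split=> //.
  rewrite segV; elim: j {Hj} => [|j IH]; first by rewrite seg_nil //=.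
  rewrite seg_rcons // flatten_rcons; apply/pth_cat; exists n.1; split=> //.
  by have /fullE[] := Hv j.
exists (fun t => (sg t).2); split.
  by move=> j; have := run_sg j; rewrite w_sg.
split=> // c; have [|y [y1 y2 y3]] := @counter_exists _ _ A (fun t => (sg t).2) c.
  move=> m; have [j Hj] := cut_unbounded V_inf m.
  have : hasr (ac c (seg sg (cut V j.+1) (cut V j.+2))).
    rewrite (seg_cut sgE) // segV seg1 /= cats0.
    by have /fullE[] := Hv j.
  rewrite ac_seg => /hasr_segP[i /andP[Hi _] Hr]; exists i => //.
  exact: leq_trans Hj (leq_trans (leq_cut V (leqnSn j)) Hi).
exists y; split=> // Hc.
  (* Every loop resets the counter, so a stretch without reset meets at most two loops. The prefix
     is skipped by starting at [cut V 1]. *)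
  apply: y2; exists (2 * k), (cut V 1) => b.
  have [j Hj] := cut_unbounded V_inf b.
  have Hj' : b <= cut V j.+1 by apply: leq_trans Hj (leq_cut V (leqnSn j)).
  apply: allB_seg_sub Hj' _; rewrite -ac_seg (seg_cut sgE) // segV ac_flatten.
  have [||] // := @allB_flatten_reset k (map (ac c) (seg v 0 j)).
    by apply/allP => _ /mapP[z /full_mem[i _ /fullE[_ Hr _ _ _]] ->].
  by apply/allP => _ /mapP[z /full_mem[i _ /fullE[_ _ _ HB _]] ->]; apply: HB.
apply: y3 => l; have [N HN] := Hlv l; exists (cut V N.+1) => b.
have [j Hj] := cut_unbounded V_inf b.
have Hj' : b <= cut V (maxn j N).+1.
  by apply: leq_trans Hj (leq_cut V _); rewrite leqW // leq_maxl.
apply: inS_seg_sub Hj' _; rewrite -ac_seg (seg_cut sgE) ?ltnS ?leq_maxr // segV ac_flatten.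
apply: (@Sok_inS l (c \in n.2) _ (c \in n.2)); apply: Sok_flatten => _ /mapP[z /full_mem[i Hi /fullE[_ _ _ _ HS]] ->].
by apply: Sok_mono (HS c Hc); apply: HN.
Qed.

Lemma accepting_full w rho : is_run w rho -> accepting (A := A) rho ->
  exists (n : node) t0, pth (A := A) (init A) (seg (fun t => (w t, rho t)) 0 t0) n.1 /\
    eom (fun u => pth n.1 u n.1) (full n) (fun t => (w (t0 + t), rho (t0 + t))).
Proof.
move=> Hrun Hacc; have [Hinit _] := Hacc.
pose s c t := act (rho t) c.
have [HR [K HK] HS] := accepting_bounds Hacc.
have HSx l : exists N, forall c, c \in Gamma_S A -> forall a b, N <= a -> inS l (seg (s c) a b).
  exact: HS.
have /fun_choice [nr nrP] : forall t, exists t', t < t' /\ forall c, hasr (seg (s c) t t').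
  move=> t; have /fin_all_exists [f Hf] : forall c, exists t', hasr (seg (s c) t t').
    move=> c; have [i Hi si] := HR c t; exists i.+1; apply/hasr_segP.
    by exists i; rewrite // Hi /=.
  exists (maxn t.+1 (\max_c f c)); split=> [|c]; first exact: leq_maxl.
  have /hasr_segP[i /andP[H1 H2] Hs] := Hf c; apply/hasr_segP; exists i => //.
  rewrite H1 (leq_trans H2) // leq_max; apply/orP; right.
  exact: leq_bigmax.
(* On an infinite run the claim can be made independent of l: it designates the side with more
   increments. *)
pose cl t := [set c | pre (seg (s c) t (nr t)) <= suf (seg (s c) 0 t)].
have [n Hn] := @infinite_pigeonhole node (fun t => (source (rho t), cl t)) (fun _ => True)
  (fun n => ex_intro2 _ _ n (leqnn n) I).
have /fun_choice [nx nxP] : forall t, exists t', t <= t' /\ (source (rho t'), cl t') = n.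
  by move=> t; have [i ? []] := Hn t; exists i.
(* The cuts share the recurrent node n and are spaced so that every counter is reset between two of
   them. *)
pose g := fix g i := if i is i'.+1 then nx (nr (g i')) else nx 0.
have gn i : (source (rho (g i)), cl (g i)) = n by case: i => [|i] /=; [case: (nxP 0)|case: (nxP (nr (g i)))].
have gnr i : nr (g i) <= g i.+1 by rewrite /=; case: (nxP (nr (g i))).
clearbody g.
have gS i : g i < g i.+1 by apply: leq_trans (gnr i); case: (nrP (g i)).
have gsrc i : source (rho (g i)) = n.1 by rewrite -(gn i).
have gcl i c : (c \in n.2) = (pre (seg (s c) (g i) (nr (g i))) <= suf (seg (s c) 0 (g i))).
  by rewrite -(gn i) inE.
have hasr_ext c t t' : nr t <= t' -> hasr (seg (s c) t t').
  have [H1 H2] := nrP t; move=> Ht.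
  by rewrite (seg_cat _ (ltnW H1) Ht) hasr_cat H2.
have pre_ext c t t' : nr t <= t' -> pre (seg (s c) t t') = pre (seg (s c) t (nr t)).
  have [H1 H2] := nrP t; move=> Ht.
  by rewrite (seg_cat _ (ltnW H1) Ht) pre_cat H2.
have suf_ext c a t t' : a <= t -> nr t <= t' -> suf (seg (s c) a t') = suf (seg (s c) t t').
  move=> at' Ht; have [H1 _] := nrP t.
  by rewrite (@seg_cat _ _ a t t') // ?(leq_trans (ltnW H1)) // suf_cat hasr_ext.
exists n, (g 0); split.
  by rewrite -(gsrc 0) -Hinit; apply: run_pth.
pose sg t := (w (g 0 + t), rho (g 0 + t)).
have sgE a b : seg sg a b = seg (fun t => (w t, rho t)) (g 0 + a) (g 0 + b).
  by rewrite -seg_shift.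
have g0 i : g 0 <= g i by apply: (strict_mono_le gS).
pose u i := seg sg (g i - g 0) (g i.+1 - g 0).
have uE i : u i = seg (fun t => (w t, rho t)) (g i) (g i.+1).
  by rewrite /u sgE !subnKC.
have acE c a b : ac (A := A) c (seg (fun t => (w t, rho t)) a b) = seg (s c) a b by rewrite ac_seg.
have u0 i : u i <> [::] by rewrite uE seg_cons.
have flat m : flatten (seg u 0 m) = seg sg 0 (g m - g 0).
  elim: m => [|m IH]; first by rewrite subnn !seg_nil.
  rewrite seg_rcons // flatten_rcons IH -seg_cat //.
  by apply: leq_sub2r; apply: ltnW.
exists u, K; split=> [l|m|m]; last 2 first.
- by exists m => //; apply/eqP.
- rewrite flat; split; first exact: prefix_of_seg.
  by rewrite sgE addn0 subnKC // -{1}(gsrc 0) -(gsrc m); apply: run_pth.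
(* Past [nr N0] an interval crossing a cut begins after [N0], so it has at least 2l increments, and
   its larger part has at least l. *)
have [N0 HN0] := HSx (2 * l); exists (nr N0) => i Hi.
have HNi : nr N0 <= g i by apply: leq_trans Hi (strict_mono_ge gS i).
have N0i : N0 <= g i by apply: leq_trans HNi; case: (nrP N0) => /ltnW.
rewrite uE; apply/fullE; split.
- by rewrite -uE.
- by move=> c; rewrite acE hasr_ext.
- by rewrite -{1}(gsrc i) -(gsrc i.+1); apply: run_pth => //; apply: ltnW.
- by move=> c Hc; rewrite acE; apply: HK.
move=> c Hc; rewrite acE SokE hasr_ext //.
have H2l : l <= 2 * l by lia.
rewrite (inS_mono H2l) /=; last by apply: HN0.
have HI := HN0 c Hc N0 (nr (g i.+1)) (leqnn _).
move: HI; rewrite (@seg_cat _ _ N0 (g i)) //; last first.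
  by apply: leq_trans (ltnW (gS i)) _; case: (nrP (g i.+1)) => /ltnW.
rewrite (@seg_cat _ _ (g i) (g i.+1)) //; [|exact: ltnW|by case: (nrP (g i.+1)) => /ltnW].
rewrite !inS_cat !hasr_cat !hasr_ext // pre_cat hasr_ext // => /and3P[_ /and3P[_ _ +]].
move=> /= H2 H1.
apply/andP; split; apply/implyP => Hcl.
  have : suf (seg (s c) N0 (g i)) < pre (seg (s c) (g i) (g i.+1)).
    rewrite pre_ext // -(suf_ext c 0 N0) // ltnNge.
    by move: Hcl; rewrite (gcl i).
  by move: H1; lia.
move: Hcl; rewrite (gcl i.+1) (suf_ext c 0 (g i)) //.
by move: H2; lia.
Qed.

Theorem automaton_omega_regular (L : omega_word Sigma -> Prop) :
  recognizes A L -> omega_T_regular T L.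
Proof.
move=> HL.
have /fin_all_exists [r Hr] := prefix_regexp.
have /fin_all_exists [e He] : forall n : node, Expr T (full n).
  by move=> n; apply: Expr_union => I; apply: Expr_G.
exists #|{: node}|, (fun i => r (enum_val i).1), (fun i => bmap fst (e (enum_val i))).
split=> [i|w]; first by rewrite bmap_regular; case: (He (enum_val i)).
split=> [/HL[rho [Hrun Hacc]]|[i [x [Hx Hp /omega_power_om Hom]]]].
  have [n [t0 [Hpt Heom]]] := accepting_full Hrun Hacc.
  have [_ [_ Hev]] := He n.
  have [y [Hy1 Hy2 Hy3]] := eom_om (eom_le Hev Heom).
  exists (enum_rank n); rewrite !enum_rankK.
  exists (seg w 0 t0 ++ map fst y); split.
  - apply/Hr; exists (seg (fun t => (w t, rho t)) 0 t0 ++ y).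
      by rewrite map_cat map_seg.
    by apply/pth_cat; exists n.1.
  - apply/prefix_of_cat; split; first exact: prefix_of_seg.
    rewrite size_seg subn0 /prefix_of size_map -{2}Hy2 mkseq_seg mkseq_seg map_seg.
    by [].
  - apply/omega_power_om; have := om_bmap fst Hy3.
    rewrite size_cat size_map size_seg subn0.
    by apply: om_ext => i /=; rewrite addnA.
have [_ [Hle _]] := He (enum_val i).
have [u0 Hu0 Hp0] := proj1 (Hr _ _) Hx.
case: Hom => u [/gseqP[k [lv [Hlv Hu]]] _ Hpu].
have [k' Hk'] := Hle k.
have /fun_choice [v Hv] : forall j, exists v, full (enum_val i) k' (lv j) v /\ u j = map fst v.
  by move=> j; have /sem_bmap[v Hv Ev] := Hu j isT; exists v; split=> //; apply: Hk'.
apply/HL/(full_accepting Hp0 Hlv (fun j => proj1 (Hv j))) => m.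
rewrite map_cat Hu0 map_flatten map_seg; apply/prefix_of_cat; split=> //.
have -> : seg (fun j => map fst (v j)) 0 m = seg u 0 m.
  by apply: eq_map => j; case: (Hv j).
exact: Hpu.
Qed.
End AutomatonToExpression.

(** * Hierarchical counter operations *)

Definition rsum (A : finType) (I : finType) (f : I -> regexp A) : regexp A :=
  foldr (fun i => Rplus (f i)) Rempty (enum I).

Lemma reg_lang_rsum (A I : finType) (f : I -> regexp A) x :
  reg_lang (rsum f) x <-> exists i, reg_lang (f i) x.
Proof.
have : (exists i, reg_lang (f i) x) <-> exists2 i, i \in enum I & reg_lang (f i) x.
  by split=> [[i Hi]|[i _ Hi]]; exists i => //; rewrite mem_enum.
move=> ->; rewrite /rsum; elim: (enum I) => [|i s IH] /=; first by split=> // -[].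
split=> [[Hi|/IH[j Hj Hx]]|[j /predU1P[->|Hj] Hx]].
- by exists i; rewrite ?mem_head.
- by exists j; rewrite // inE Hj orbT.
- by left.
- by right; apply/IH; exists j.
Qed.

Section Goodness.
Implicit Types (u v : seq action) (k l : nat).

Definition isn (a : action) := if a is NoAct then true else false.
Definition core u := [seq a <- u | ~~ isn a].

Lemma core_cat u v : core (u ++ v) = core u ++ core v.
Proof. exact: filter_cat. Qed.

(** For an S-counter a virtual reset precedes the word, standing for the one that ends the previous
    word; the increments before the first actual reset are thus counted too. *)
Definition good1 (S : bool) k l u := if S then inS l (Reset :: u) else allB k u.

Lemma pre_core u : pre (core u) = pre u.
Proof. by elim: u => [|[] u IH] //=; rewrite IH. Qed.

Lemma hasr_core u : hasr (core u) = hasr u.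
Proof. by elim: u => [|[] u IH] //=; rewrite !hasr_cons IH. Qed.

Lemma good1_core S k l u : good1 S k l (core u) = good1 S k l u.
Proof.
rewrite /good1 /= hasr_core pre_core.
have -> : inS l (core u) = inS l u.
  by elim: u => [|[] u IH] //=; rewrite IH // hasr_core pre_core.
case: S => //; elim: u => [|[] u IH] //=; rewrite ?IH ?pre_core //.
by case E : (allB k u); rewrite ?andbF // andbT; apply/esym/allB_pre.
Qed.

Lemma suf_rcons_reset u : suf (rcons u Reset) = 0.
Proof. by rewrite /suf rev_rcons. Qed.

Lemma good1_resets S k l u v : good1 S k l (rcons u Reset ++ v) =
  good1 S k l (rcons u Reset) && good1 S k l v.
Proof.
rewrite /good1; case: S; last first.
  rewrite allB_cat suf_rcons_reset add0n; case E : (allB k v); rewrite ?andbF //.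
  by rewrite allB_pre.
rewrite -cat_cons inS_cat -rcons_cons suf_rcons_reset add0n.
have -> : hasr (rcons (Reset :: u) Reset) by rewrite hasr_cons.
have -> : inS l (Reset :: v) = (hasr v ==> (l <= pre v)) && inS l v by [].
by rewrite /=; case: (hasr v ==> _); rewrite ?andbT ?andbF.
Qed.

Lemma good1_nil S k l : good1 S k l [::].
Proof. by case: S. Qed.

Lemma good1_incrs (S : bool) k l s : good1 S k l (rcons (nseq s Incr) Reset) =
  if S then l <= s else s <= k.
Proof.
have E : pre (rcons (nseq s Incr) Reset) = s by elim: s => //= s ->.
rewrite /good1; case: S.
  have Hr : hasr (rcons (nseq s Incr) Reset) by rewrite -cats1 hasr_cat orbT.
  have Hi : inS l (rcons (nseq s Incr) Reset) by elim: (s).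
  by rewrite /= E Hr Hi andbT.
elim: s E => //= s IH [E]; rewrite E IH //.
by case: (ltnP s k) => // /ltnW.
Qed.

Lemma good1_mono S k k' l l' u : k <= k' -> l' <= l -> good1 S k l u -> good1 S k' l' u.
Proof. by move=> Hk Hl; case: S => [/(inS_mono Hl)|/(allB_mono Hk)]. Qed.
End Goodness.

(** * Regular languages with hierarchical counter operations *)

Section Levels.
Variables (Sigma : finType) (N : nat) (sk : nat -> bool).
Local Notation op := {ffun 'I_N -> action}.
Local Notation delta := (Sigma * {ffun 'I_N -> action})%type.
Implicit Types (v : seq delta) (X Y : glang Sigma) (p : nat).

Definition opf p (b : bool) : op :=
  [ffun c : 'I_N => if c < p then Reset else if (c == p :> nat) && b then Incr else NoAct].

Definition hierb (o : op) : bool :=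
  [forall k, forall j : 'I_N, ~~ isn (o k) && (j < k) ==> isr (o j)].

Lemma hierb_opf p b : hierb (opf p b).
Proof.
apply/forallP => k; apply/forallP => j; apply/implyP => /andP[+ Hjk]; rewrite !ffunE.
case: (ltnP k p) => [Hk _|Hk]; first by rewrite (ltn_trans Hjk Hk).
by case: eqP => [<-|] //=; rewrite Hjk.
Qed.

Definition oc (c : 'I_N) v : seq action := map (fun x : delta => x.2 c) v.

Definition good k l v := forall c : 'I_N, good1 (sk c) k l (oc c v).

Definition wfw p v := forall x : delta, x \in v ->
  hierb x.2 /\ forall c : 'I_N, p <= c -> x.2 c = NoAct.

Definition calm p v := forall x : delta, x \in v -> forall c : 'I_N, c.+1 = p -> x.2 c <> Reset.

Lemma wfw_cat p v v' : wfw p (v ++ v') <-> wfw p v /\ wfw p v'.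
Proof.
split=> [H|[H1 H2] x]; first by split=> x Hx; apply: H; rewrite mem_cat Hx ?orbT.
by rewrite mem_cat => /orP[/H1|/H2].
Qed.

Lemma wfw_le p p' v : p <= p' -> wfw p v -> wfw p' v.
Proof. by move=> Hp H x /H[? Hx]; split=> // c Hc; apply/Hx/(leq_trans Hp). Qed.

Lemma wfw_opf p (b : bool) (a : Sigma) p' : p + b <= p' -> wfw p' [:: (a, opf p b)].
Proof.
move=> Hp x; rewrite inE => /eqP ->; split=> [|c Hc]; first exact: hierb_opf.
rewrite ffunE ltnNge (leq_trans _ (leq_trans Hp Hc)) ?leq_addr //=.
by case: eqP => //= E; case: b Hp => // Hp; lia.
Qed.

Lemma core_quiet p v (c : 'I_N) : wfw p v -> p <= c -> core (oc c v) = [::].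
Proof.
move=> H Hc; elim: v H => //= x v IH H.
have [_ ->] := H x (mem_head _ _) => //.
by apply: IH => y Hy; apply: H; rewrite inE Hy orbT.
Qed.

Lemma oc_cat c v v' : oc c (v ++ v') = oc c v ++ oc c v'.
Proof. exact: map_cat. Qed.

Lemma oc_rcons c v x : oc c (rcons v x) = rcons (oc c v) (x.2 c).
Proof. exact: map_rcons. Qed.

(** The last letter stays outside the regular expression, without its operation: raising the level,
    concatenating and iterating all change what the last letter does to the counters. Words of this
    form are nonempty. *)
Definition lsem p (h : Sigma -> regexp delta) : glang Sigma.
Proof.
exists (fun k l u => exists a v, [/\ reg_lang (h a) v, u = rcons (map fst v) a
  & good k l (rcons v (a, opf p false))]).
move=> k k' l l' u Hk Hl [a [v [H1 H2 H3]]]; exists a, v; split=> // c.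
exact: good1_mono (H3 c).
Defined.

(* X is recognized with the counters below p, all of which are reset by the
   last letter of each word while the others are untouched. With [t], the
   counter p - 1 is moreover reset by the last letter only. *)
Definition lev (t : bool) p X := exists h : Sigma -> regexp delta,
  (forall a v, reg_lang (h a) v -> wfw p v /\ (t -> calm p v)) /\ approx (lsem p h) X.

Lemma lev_weaken t p X : lev t p X -> lev false p X.
Proof. by move=> [h [H1 H2]]; exists h; split=> // a v /H1[]. Qed.

Lemma lev_approx t p X Y : approx X Y -> lev t p X -> lev t p Y.
Proof. by move=> HXY [h [H1 H2]]; exists h; split=> //; apply: approx_trans H2 HXY. Qed.

Lemma lev_none p : lev false p (gconst (fun _ => False)).
Proof.
exists (fun _ => Rempty); split=> //.
by apply: approx_ext => k l u; split=> // -[a [v []]].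
Qed.

Lemma lev_union (I : finType) p (X : I -> glang Sigma) :
  (forall i, lev false p (X i)) -> lev false p (gunion X).
Proof.
move=> /fin_all_exists[h Hh]; exists (fun a => rsum (fun i => h i a)); split.
  by move=> a v /reg_lang_rsum[i Hi]; have [H _] := Hh i; apply: H Hi.
apply: (@approx_trans _ (gunion (fun i => lsem p (h i)))); last first.
  by apply: approx_gunion => i; case: (Hh i).
apply: approx_ext => k l u; split.
  by move=> [a [v [/reg_lang_rsum[i Hi] ? ?]]]; exists i, a, v.
by move=> [i [a [v [Hi ? ?]]]]; exists a, v; split=> //; apply/reg_lang_rsum; exists i.
Qed.

Lemma lev_or p X Y : lev false p X -> lev false p Y -> lev false p (gor X Y).
Proof.
move=> HX HY; suff : lev false p (gunion (fun b : bool => if b then X else Y)).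
  apply: lev_approx; apply: approx_ext => k l u; split=> [[[] H]|[H|H]].
  - by left.
  - by right.
  - by exists true.
  - by exists false.
by apply: lev_union => -[].
Qed.

Lemma lev_when p (P : Prop) X : (P -> lev false p X) -> lev false p (gwhen P X).
Proof.
move=> H; have [HP|HP] := classic P.
  by apply: lev_approx (H HP); apply: approx_ext => k l u /=; tauto.
by apply: lev_approx (lev_none p); apply: approx_ext => k l u /=; tauto.
Qed.

Lemma lev_letter a : lev false 0 (gconst (fun u => u = [:: a])).
Proof.
exists (fun b => if b == a then Reps else Rempty); split.
  by move=> b v; case: eqP => //= _ ->; split.
apply: approx_ext => k l u; split=> [[b [v [H -> _]]]|->].
  by move: H; case: eqP => //= -> ->.
exists a, [::]; rewrite eqxx; split=> // c.
by rewrite -good1_core /oc /= ffunE ltn0 andbF; apply: good1_nil.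
Qed.

(** Resetting an untouched B-counter records the value 0, which is within any bound; for an
    S-counter this would be fatal, hence the condition on the counters between p and p'. *)
Lemma good_raise p p' v a k l : p <= p' -> wfw p v ->
  (forall c, p <= c -> c < p' -> ~~ sk c) ->
  good k l (rcons v (a, opf p' false)) <-> good k l (rcons v (a, opf p false)).
Proof.
move=> Hp Hv Hs; suff H : forall c : 'I_N, good1 (sk c) k l (oc c (rcons v (a, opf p' false))) =
    good1 (sk c) k l (oc c (rcons v (a, opf p false))).
  by split=> Hg c; have := Hg c; rewrite H.
move=> c; rewrite -good1_core -[RHS]good1_core !oc_rcons !ffunE /= !andbF -!cats1 !core_cat.
case: (ltnP c p) => Hc; first by rewrite (leq_trans Hc).
rewrite (core_quiet Hv Hc); case: (ltnP c p') => Hc' //=.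
by rewrite (negbTE (Hs c Hc Hc')).
Qed.

Lemma lev_raise p p' X : p <= p' -> (forall c, p <= c -> c < p' -> ~~ sk c) ->
  lev false p X -> lev false p' X.
Proof.
move=> Hp Hs [h [H1 H2]]; exists h; split.
  by move=> a v /H1[Hv _]; split=> //; apply: wfw_le Hv.
apply: approx_trans H2; apply: approx_ext => k l u.
split=> -[a [v [Ha -> Hg]]]; exists a, v; split=> //; have [Hv _] := H1 _ _ Ha.
  by rewrite -good_raise //; exact: Hg.
by apply/(good_raise a k l Hp).
Qed.

(** A counter used by one factor only must be reset once, or an S-counter would record an empty
    interval. So the middle letter resets the counters common to both, and the last letter resets
    all. *)
Lemma good_cat p1 p2 v1 v2 b a k l : wfw p1 v1 -> wfw p2 v2 ->
  good k l (rcons ((v1 ++ [:: (b, opf (minn p1 p2) false)]) ++ v2)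
                  (a, opf (maxn p1 p2) false)) <->
  good k l (rcons v1 (b, opf p1 false)) /\ good k l (rcons v2 (a, opf p2 false)).
Proof.
move=> H1 H2.
suff H : forall c : 'I_N, good1 (sk c) k l (oc c (rcons ((v1 ++ [:: (b, opf (minn p1 p2) false)]) ++ v2)
                  (a, opf (maxn p1 p2) false))) =
    good1 (sk c) k l (oc c (rcons v1 (b, opf p1 false))) &&
    good1 (sk c) k l (oc c (rcons v2 (a, opf p2 false))).
  split=> [Hg|[Hg1 Hg2] c]; last by rewrite H Hg1 Hg2.
  by split=> c; have := Hg c; rewrite H => /andP[].
move=> c; rewrite -good1_core -[X in _ = X && _]good1_core -[X in _ = _ && X]good1_core.
rewrite !oc_rcons !oc_cat /= !ffunE /= !andbF -!cats1 !core_cat -catA.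
rewrite leq_min leq_max; case: (ltnP c p1) => Hc1; case: (ltnP c p2) => Hc2 /=.
- by rewrite !cats1 good1_resets.
- by rewrite (core_quiet H2 Hc2) /= !cats0 good1_nil andbT.
- by rewrite (core_quiet H1 Hc1) /= good1_nil.
- by rewrite (core_quiet H1 Hc1) (core_quiet H2 Hc2) /= good1_nil.
Qed.

Lemma lev_cat p1 p2 X Y : lev false p1 X -> lev false p2 Y ->
  lev false (maxn p1 p2) (gcat X Y).
Proof.
move=> [h1 [W1 A1]] [h2 [W2 A2]].
exists (fun a => Rconcat (rsum (fun b => Rconcat (h1 b) (Rletter (b, opf (minn p1 p2) false)))) (h2 a)).
split.
  move=> a v [y [v2 [/reg_lang_rsum[b [v1 [z [Hv1 -> ->]]]] Hv2 ->]]]; split=> //.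
  apply/wfw_cat; split; last by have [H _] := W2 _ _ Hv2; apply: wfw_le H; apply: leq_maxr.
  apply/wfw_cat; split; first by have [H _] := W1 _ _ Hv1; apply: wfw_le H; apply: leq_maxl.
  by apply: wfw_opf; rewrite addn0 geq_min leq_maxl.
apply: approx_trans (approx_gcat A1 A2); apply: approx_ext => k l u; split.
  move=> [a [v [[y [v2 [/reg_lang_rsum[b [v1 [z [Hv1 -> ->]]]] Hv2 ->]]] ->]]].
  have [[Hw1 _] [Hw2 _]] := (W1 _ _ Hv1, W2 _ _ Hv2).
  move/(good_cat b a k l Hw1 Hw2) => [G1 G2].
  exists (rcons (map fst v1) b), (rcons (map fst v2) a); split.
  - by exists b, v1.
  - by exists a, v2.
  - by rewrite !map_cat /= cats1 rcons_cat.
move=> [y [z [[b [v1 [Hv1 -> G1]]] [a [v2 [Hv2 -> G2]]] ->]]].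
have [[Hw1 _] [Hw2 _]] := (W1 _ _ Hv1, W2 _ _ Hv2).
exists a, ((v1 ++ [:: (b, opf (minn p1 p2) false)]) ++ v2); split.
- exists (v1 ++ [:: (b, opf (minn p1 p2) false)]), v2; split=> //.
  by apply/reg_lang_rsum; exists b, v1, [:: (b, opf (minn p1 p2) false)].
- by rewrite !map_cat /= cats1 rcons_cat.
- by apply/(good_cat b a k l Hw1 Hw2).
Qed.

Definition glue (o : op) (ps : seq (seq delta * Sigma)) : seq delta :=
  flatten [seq rcons q.1 (q.2, o) | q <- ps].

Lemma reg_lang_glue o (h : Sigma -> regexp delta) v :
  reg_lang (Rstar (rsum (fun b => Rconcat (h b) (Rletter (b, o))))) v <->
  exists ps, (forall q, q \in ps -> reg_lang (h q.2) q.1) /\ v = glue o ps.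
Proof.
split=> [[ys [H ->]]|[ps [H ->]]]; last first.
  exists [seq rcons q.1 (q.2, o) | q <- ps]; split=> // y /mapP[q Hq ->].
  apply/reg_lang_rsum; exists q.2, q.1, [:: (q.2, o)]; rewrite cats1.
  by split=> //; apply: H.
elim: ys H => [|y ys IH] H; first by exists [::].
have [|ps [P1 P2]] := IH; first by move=> z Hz; apply: H; rewrite inE Hz orbT.
have /reg_lang_rsum[b [v1 [z [Hv1 -> Ey]]]] := H y (mem_head _ _).
exists ((v1, b) :: ps); split; last by rewrite /= P2 Ey cats1.
by move=> q /predU1P[->|/P1].
Qed.

(** With t, the last letter of every factor but the final one increments counter p, and the final
    letter resets it: that counter reads [size ps]. Counters below p are reset after each factor,
    which separates the conditions. *)
Lemma good_glue (t : bool) p ps v a k l :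
  (forall q, q \in ps -> wfw p q.1) -> wfw p v -> (t -> p < N) ->
  good k l (rcons (glue (opf p t) ps ++ v) (a, opf (p + t) false)) <->
  [/\ forall q, q \in ps -> good k l (rcons q.1 (q.2, opf p false)),
      good k l (rcons v (a, opf p false))
    & t -> if sk p then l <= size ps else size ps <= k].
Proof.
move=> Hps Hv Hp.
have low (c : 'I_N) : c < p -> good1 (sk c) k l (oc c (rcons (glue (opf p t) ps ++ v) (a, opf (p + t) false))) =
    all (fun q => good1 (sk c) k l (oc c (rcons q.1 (q.2, opf p false)))) ps
    && good1 (sk c) k l (oc c (rcons v (a, opf p false))).
  move=> Hc; rewrite rcons_cat oc_cat /glue; elim: ps {Hps} => [|q ps IH].
    by rewrite /= !oc_rcons !ffunE Hc /= (leq_trans Hc (leq_addr _ _)).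
  rewrite /= oc_cat -catA oc_rcons {1}ffunE Hc good1_resets IH andbA.
  by rewrite (oc_rcons c q.1) /= ffunE Hc.
have quiet (c : 'I_N) : p <= c -> core (oc c (glue (opf p t) ps ++ v)) =
    nseq (size ps * (t && (c == p :> nat))) Incr.
  move=> Hc; rewrite oc_cat core_cat (core_quiet Hv Hc) cats0 /glue.
  elim: ps Hps {low} => //= q ps IH Hps.
  rewrite oc_cat core_cat IH; last by move=> q' Hq'; apply: Hps; rewrite inE Hq' orbT.
  rewrite oc_rcons -cats1 core_cat (core_quiet (Hps q (mem_head _ _)) Hc) /= ffunE ltnNge Hc /=.
  by rewrite mulSn; case: t {Hp Hps IH}; case: eqP.
have single w b (c : 'I_N) : wfw p w -> p <= c ->
    good1 (sk c) k l (oc c (rcons w (b, opf p false))).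
  move=> Hw Hc; rewrite -good1_core oc_rcons -cats1 core_cat (core_quiet Hw Hc) ffunE.
  by rewrite ltnNge Hc andbF /= good1_nil.
split=> [H|[H1 H2 H3] c].
  split=> [q Hq c|c|Ht].
  - case: (ltnP c p) => Hc; last exact: single (Hps q Hq) Hc.
    by have := H c; rewrite low // => /andP[/allP/(_ q Hq)].
  - case: (ltnP c p) => Hc; last exact: single Hv Hc.
    by have := H c; rewrite low // => /andP[].
  have := H (Ordinal (Hp Ht)); rewrite -good1_core oc_rcons -cats1 core_cat quiet //=.
  by rewrite Ht eqxx muln1 ffunE /= addn1 ltnSn /= cats1 good1_incrs.
case: (ltnP c p) => Hc.
  by rewrite low // H2 andbT; apply/allP => q Hq; apply: H1.
rewrite -good1_core oc_rcons -cats1 core_cat quiet // ffunE /= andbF.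
case: (eqVneq (c : nat) p) => [Ec|Nc]; last first.
  rewrite andbF muln0 /=; case: ltnP => Hc' /=; last exact: good1_nil.
  by case: t Hc' {Hp H3 low quiet} => Hc'; lia.
rewrite andbT Ec; case: t Hp H3 {low quiet} => Hp H3 /=; last first.
  by rewrite addn0 ltnn muln0 /= good1_nil.
by rewrite addn1 ltnSn muln1 /= cats1 good1_incrs; apply: H3.
Qed.

Definition dk p : arity := if sk p then AtLeast else AtMost.

Lemma lev_iter (t : bool) p X : (t -> p < N) -> lev false p X ->
  lev t (p + t) (gplus (if t then dk p else AnyCount) X).
Proof.
move=> Hp [h [W A]].
exists (fun a => Rconcat (Rstar (rsum (fun b => Rconcat (h b) (Rletter (b, opf p t))))) (h a)).
split.
  move=> a _ [y [v [/reg_lang_glue[ps [P ->]] Hv ->]]].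
  have mem_glue x : x \in glue (opf p t) ps ++ v -> (exists2 w, wfw p w & x \in w) \/ x.2 = opf p t.
    rewrite mem_cat => /orP[/flattenP[z /mapP[q Hq ->]]|Hx]; last first.
      by left; exists v => //; case: (W _ _ Hv).
    rewrite mem_rcons inE => /predU1P[->|Hx]; first by right.
    by left; exists q.1 => //; case: (W _ _ (P q Hq)).
  split.
    move=> x /mem_glue[[w Hw Hx]|Ex].
      by apply: (wfw_le (leq_addr t p) Hw).
    have [|H1 H2] := @wfw_opf p t x.1 (p + t) (leqnn _) x; last by split.
    by rewrite inE -Ex; case: (x).
  move=> Ht x Hx c; rewrite Ht addn1 => -[Ec].
  case: (mem_glue x Hx) => [[w Hw Hxw]|->].
    by have [_ ->] := Hw x Hxw; rewrite ?Ec.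
  by rewrite ffunE Ec ltnn eqxx Ht.
apply: (@approx_trans _ (gplus (if t then dk p else AnyCount) (lsem p h))); last exact: approx_gplus.
have key k l u : lsem (p + t) (fun a => Rconcat (Rstar (rsum (fun b =>
     Rconcat (h b) (Rletter (b, opf p t))))) (h a)) k l u <->
   exists ys y, [/\ forall z, z \in rcons ys y -> lsem p h k l z,
     u = flatten (rcons ys y) & t -> if sk p then l <= size ys else size ys <= k].
  split.
    move=> [a [v' [[y [v [/reg_lang_glue[ps [P ->]] Hv ->]]] ->]]].
    have Hps q : q \in ps -> wfw p q.1 by move=> /P /W[].
    have [Hv' _] := W _ _ Hv.
    move=> /(good_glue a k l Hps Hv' Hp)[G1 G2 G3].
    exists [seq rcons (map fst q.1) q.2 | q <- ps], (rcons (map fst v) a).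
    rewrite size_map; split=> //.
      move=> z; rewrite mem_rcons inE => /predU1P[->|/mapP[q Hq ->]]; first by exists a, v.
      by exists q.2, q.1; split=> //; [apply: P|apply: G1].
    rewrite flatten_rcons map_cat rcons_cat; congr (_ ++ _).
    rewrite /glue map_flatten -map_comp; congr flatten; apply: eq_map => q.
    by rewrite /= map_rcons.
  move=> [ys [y [Hys -> Hc]]].
  have [a [v [Hv Ey Gv]]] : lsem p h k l y by apply: Hys; rewrite mem_rcons mem_head.
  have [ps [P1 P2 P3]] : exists ps : seq (seq delta * Sigma),
     [/\ ys = [seq rcons (map fst q.1) q.2 | q <- ps],
      forall q, q \in ps -> reg_lang (h q.2) q.1
      & forall q, q \in ps -> good k l (rcons q.1 (q.2, opf p false))].
    elim: ys Hys {Hc} => [|z ys IH] Hys; first by exists [::].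
    have [|ps [P1 P2 P3]] := IH.
      by move=> z' Hz'; apply: Hys; rewrite rcons_cons inE Hz' orbT.
    have [b [w [Hw Ez Gw]]] := Hys z (mem_head _ _).
    exists ((w, b) :: ps); split=> [|q /predU1P[->|/P2]|q /predU1P[->|/P3]] //.
    by rewrite /= Ez P1.
  have [Hv' _] := W _ _ Hv.
  exists a, (glue (opf p t) ps ++ v); split.
  - by exists (glue (opf p t) ps), v; split=> //; apply/reg_lang_glue; exists ps.
  - rewrite flatten_rcons Ey P1 map_cat rcons_cat; congr (_ ++ _).
    rewrite /glue map_flatten -map_comp; congr flatten; apply: eq_map => q.
    by rewrite /= map_rcons.
  apply/good_glue => //; first by move=> q /P2 /W[].
  by split=> // /Hc; rewrite P1 size_map.
split=> k.
  (* The final factor is marked by the reset and not by an increment, so the counter reads one less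
     than the number of factors; hence [k.+1] here and [l.+1] in the converse. *)
  exists k.+1 => l u /key[ys [y [Hys -> Hc]]]; exists (rcons ys y); split=> //.
  - case: t Hc {key Hp} => //= /(_ isT); rewrite /dk size_rcons; case: (sk p) => //=.
    exact: leqW.
  - by case: ys {Hys Hc}.
  - by move=> z /Hys; apply: gl_mono.
exists k => l; exists l.+1 => u [ys [Hc H0 Hys ->]]; apply/key.
case/lastP: ys H0 Hc Hys => // ys y _ Hc Hys; exists ys, y; split=> //.
  by move=> z /Hys; apply: gl_mono.
move=> Ht; move: Hc; rewrite Ht /dk size_rcons; case: (sk p) => //=.
exact: ltnW.
Qed.

Lemma lev_plus p X : lev false p X -> lev false p (gplus AnyCount X).
Proof. by move=> H; have := @lev_iter false p X; rewrite addn0; apply. Qed.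

Lemma lev_count p X : p < N -> lev false p X -> lev true p.+1 (gplus (dk p) X).
Proof. by move=> Hp H; have := @lev_iter true p X; rewrite addn1; apply. Qed.
End Levels.

(** * Stratification by levels *)

Lemma mem_split (B : eqType) (x : B) s : x \in s -> exists s1 s2, s = s1 ++ x :: s2.
Proof. by case/splitPr => s1 s2; exists s1, s2. Qed.

Section Stratification.
Variable A : eqType.
Implicit Types (X Y : glang A) (ys zs : seq (seq A)).

Lemma split_runs (P Q : seq A -> Prop) ys : (forall y, y \in ys -> P y \/ Q y) ->
  exists (zs : seq (seq (seq A) * seq A)) (rs : seq (seq A)),
  [/\ flatten ys = flatten [seq flatten z.1 ++ z.2 | z <- zs] ++ flatten rs,
      forall z, z \in zs -> (forall y, y \in z.1 -> P y) /\ Q z.2,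
      forall r, r \in rs -> P r
    & size ys = sumn [seq (size z.1).+1 | z <- zs] + size rs].
Proof.
elim: ys => [|y ys IH] H; first by exists [::], [::].
have [|zs [rs [E1 E2 E3 E4]]] := IH; first by move=> z Hz; apply: H; rewrite inE Hz orbT.
case: (H y (mem_head _ _)) => Hy; last first.
  exists (([::], y) :: zs), rs; split=> //=; first by rewrite E1 catA.
    by move=> z /predU1P[->|/E2].
  by rewrite E4.
case: zs E1 E2 E4 => [|z zs] E1 E2 E4.
  exists [::], (y :: rs); split=> //=; first by rewrite E1.
    by move=> z /predU1P[->|/E3].
  by rewrite E4.
exists ((y :: z.1, z.2) :: zs), rs; split=> //=.
- by rewrite E1 /= !catA.
- move=> z' /predU1P[->|Hz']; last by apply: E2; apply/predU1P; right.
  have [H1 H2] := E2 z (mem_head _ _); split=> // y' /predU1P[->|] //.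
  exact: H1.
- by rewrite E4.
Qed.

Definition ends_in X Y : glang A := gor Y (gcat X Y).

Lemma sumn_bounds (zs : seq (seq (seq A) * seq A)) :
  size zs <= sumn [seq (size z.1).+1 | z <- zs] /\
  forall z, z \in zs -> size z.1 <= sumn [seq (size z.1).+1 | z <- zs].
Proof.
elim: zs => //= z zs [IH1 IH2]; split; first by lia.
by move=> z' /predU1P[->|/IH2]; lia.
Qed.

Lemma flatten_lists (P : seq A -> Prop) n (ws : seq (seq A)) :
  (forall w, w \in ws -> exists ys, [/\ size ys <= n, ys <> [::], forall y, y \in ys -> P y & w = flatten ys]) ->
  exists ys, [/\ flatten ws = flatten ys, forall y, y \in ys -> P y, size ws <= size ys
    & size ys <= size ws * n].
Proof.
elim: ws => [|w ws IH] H; first by exists [::].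
have [|ys [E1 E2 E3 E4]] := IH; first by move=> z Hz; apply: H; rewrite inE Hz orbT.
have [zs [Z1 Z2 Z3 Ew]] := H w (mem_head _ _).
exists (zs ++ ys); split; rewrite ?size_cat ?flatten_cat /= ?Ew ?E1 //.
- by move=> y; rewrite mem_cat => /orP[/Z3|/E2].
- by case: zs Z2 {Z1 Z3 Ew} => //= *; lia.
- by rewrite mulSn; lia.
Qed.

Lemma ends_in_list c X Y k l w : ends_in (gplus c X) Y k l w ->
  exists n ys, [/\ size ys <= n, ys <> [::], forall y, y \in ys -> gor X Y k l y,
   w = flatten ys & c = AtMost -> n = k.+1].
Proof.
case=> [Hw|[y [z [[ys [H1 H2 H3 ->]] Hz ->]]]].
  exists k.+1, [:: w]; split=> //=; rewrite ?cats0 //.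
  by move=> y; rewrite inE => /eqP ->; right.
exists (if c is AtMost then k.+1 else (size ys).+1), (rcons ys z); split.
- by rewrite size_rcons; case: c H1.
- by case: (ys).
- by move=> x; rewrite mem_rcons inE => /predU1P[->|/H3 ?]; [right|left].
- by rewrite flatten_rcons.
- by move=> ->.
Qed.

(* (X + Y)^+ = X^+ + (X^* Y)^+ + (X^* Y)^+ X^+ *)
Lemma gplus_stratify c X Y : c <> AtLeast ->
  approx (gor (gplus c X) (gor (gplus c (ends_in (gplus c X) Y))
                         (gcat (gplus c (ends_in (gplus c X) Y)) (gplus c X))))
   (gplus c (gor X Y)).
Proof.
move=> Hc; set Z := ends_in _ _; split=> k.
  (* At most k blocks, each of at most k words of [X] followed by one of [Y], and a trailing run of
     at most k words. *)
  exists (k * k.+1 + k).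
  have HX l u : gplus c X k l u -> exists ys, [/\ ys <> [::], u = flatten ys,
      forall y, y \in ys -> gor X Y k l y & c = AtMost -> size ys <= k].
    move=> [ys [H1 H2 H3 ->]]; exists ys; split=> // [y /H3|E]; [by left|by move: H1; rewrite E].
  have HZ l u : gplus c Z k l u -> exists ys, [/\ ys <> [::], u = flatten ys,
      forall y, y \in ys -> gor X Y k l y & c = AtMost -> size ys <= k * k.+1].
    move=> [ws [H1 H2 H3 ->]].
    have [n Hn] : exists n, forall w, w \in ws -> exists ys, [/\ size ys <= n, ys <> [::],
       forall y, y \in ys -> gor X Y k l y & w = flatten ys] /\ (c = AtMost -> n = k.+1).
      have [i a b ab H Hi|i Hi|n Hn] := @nat_bound (fun i n => i < size ws -> exists ys,
          [/\ size ys <= (if c is AtMost then k.+1 else n), ys <> [::],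
          forall y, y \in ys -> gor X Y k l y & nth [::] ws i = flatten ys]) (size ws).
      - have [ys [Y1 Y2 Y3 Y4]] := H Hi; exists ys; split=> //.
        by case: c {H HX Hc H1 H2 H3 Z} Y1 => // Y1; apply: leq_trans ab.
      - have [n [ys [Y1 Y2 Y3 Y4 Y5]]] := ends_in_list (H3 _ (mem_nth [::] Hi)).
        by exists n => _; exists ys; split=> //; case: c Y5 {H1 H2 H3 Z HX Hc} => // <-.
      exists (if c is AtMost then k.+1 else n) => w /(nthP [::])[i Hi <-].
      by have [ys HY] := Hn i Hi Hi; exists ys; split=> // ->.
    have [|ys [E1 E2 E3 E4]] := @flatten_lists (gor X Y k l) n ws.
      by move=> w /Hn[ys [? _]]; exists ys.
    exists ys; split=> //; first by case: ys E3 {E1 E2 E4} => //; case: ws H2 {H1 H3 Hn}.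
    move=> Ec; apply: leq_trans E4 _; move: H1; rewrite Ec /= => H1.
    case: ws H2 Hn H1 {H3 E1 E3} => // w ws _ /(_ w (mem_head _ _))[_ [_ ->]] // H1.
    by rewrite leq_mul2r H1 orbT.
  have fin l ys : ys <> [::] -> (forall y, y \in ys -> gor X Y k l y) ->
     (c = AtMost -> size ys <= k * k.+1 + k) -> gplus c (gor X Y) (k * k.+1 + k) l (flatten ys).
    move=> H0 H1 H2; exists ys; split=> //; last by move=> y /H1; apply: gl_mono => //; lia.
    by case: c Hc H2 {Z HX HZ} => //= _ H2; apply: H2.
  move=> l u [/HX[ys [H0 -> H1 H2]]|[/HZ[ys [H0 -> H1 H2]]|[y [z [/HZ[ys [H0 -> H1 H2]] /HX[zs [H0' -> H1' H2']] ->]]]]].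
  - by apply: fin => // /H2; lia.
  - by apply: fin => // /H2; lia.
  - rewrite -flatten_cat; apply: fin.
    + by case: (ys) H0.
    + by move=> x; rewrite mem_cat => /orP[/H1|/H1'].
    + by rewrite size_cat => Ec; have := H2 Ec; have := H2' Ec; lia.
exists k => l; exists l => u [ys [H1 H2 H3 ->]].
have [zs [rs [E1 E2 E3 E4]]] := split_runs H3.
have [B1 B2] := sumn_bounds zs.
have ok n : n <= size ys -> count_ok c k l n.
  by case: c Hc H1 {Z} => //= _ H1 Hn; apply: leq_trans Hn H1.
have okz : zs <> [::] -> gplus c Z k l (flatten [seq flatten z.1 ++ z.2 | z <- zs]).
  move=> z0; exists [seq flatten z.1 ++ z.2 | z <- zs]; split=> //.
  - by rewrite size_map; apply: ok; lia.
  - by case: (zs) z0.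
  move=> _ /mapP[z Hz ->]; have [P1 P2] := E2 z Hz.
  case Ez : z.1 => [|r rs']; first by left.
  right; exists (flatten z.1), z.2; rewrite Ez; split=> //; exists (r :: rs'); split=> //.
    by rewrite -Ez; apply: ok; apply: (leq_trans (B2 z Hz)); rewrite E4 leq_addr.
  by rewrite -Ez.
have okr : rs <> [::] -> gplus c X k l (flatten rs).
  by move=> r0; exists rs; split=> //; apply: ok; lia.
rewrite E1; case: zs E1 E2 E4 okz {B1 B2} => [|z zs] E1 E2 E4 okz.
  by left; apply: okr => r0; move: E4; rewrite r0 /=; case: (ys) H2.
case: rs E1 E3 E4 okr => [|r rs] E1 E3 E4 okr; first by right; left; rewrite cats0; apply: okz.
right; right; exists (flatten [seq flatten z.1 ++ z.2 | z <- z :: zs]), (flatten (r :: rs)).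
by split=> //; [apply: okz|apply: okr].
Qed.

Definition around X Y : glang A :=
  gor (gor Y (gcat X Y)) (gcat (gor Y (gcat X Y)) X).

Lemma around_intro X k l ys (Y : glang A) w zs :
  (forall y, y \in ys -> X k l y) -> (forall z, z \in zs -> X k l z) ->
  Y k l w -> around (gplus AnyCount X) Y k l (flatten ys ++ w ++ flatten zs).
Proof.
move=> Hy Hz Hw.
have left_part : gor Y (gcat (gplus AnyCount X) Y) k l (flatten ys ++ w).
  case: ys Hy => [|y ys] Hy; first by left.
  by right; exists (flatten (y :: ys)), w; split=> //; exists (y :: ys).
rewrite catA; case: zs Hz => [|z zs] Hz; first by left; rewrite cats0.
right; exists (flatten ys ++ w), (flatten (z :: zs)); split=> //.
by exists (z :: zs).
Qed.

Lemma around_elim X k l (Y : glang A) w : around (gplus AnyCount X) Y k l w ->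
  exists ys zs v, [/\ forall y, y \in ys -> X k l y, forall z, z \in zs -> X k l z,
   Y k l v & w = flatten ys ++ v ++ flatten zs].
Proof.
have HL u : gor Y (gcat (gplus AnyCount X) Y) k l u ->
    exists ys v, [/\ forall y, y \in ys -> X k l y, Y k l v & u = flatten ys ++ v].
  case=> [Hu|[y [z [[ys [_ _ H ->]] Hz ->]]]]; first by exists [::], u.
  by exists ys, z.
case=> [/HL[ys [v [H1 H2 ->]]]|[y [z [/HL[ys [v [H1 H2 ->]]] [zs [_ _ H3 ->]] ->]]]].
  by exists ys, [::], v; rewrite cats0.
by exists ys, zs, v; rewrite catA.
Qed.

(** A long list over two languages either has many words of [Y] or contains a long run of words of
    [X]; what surrounds the counted part is left uncounted. *)
Lemma gplus_stratify_atleast X Y : let Z := ends_in (gplus AnyCount X) Y in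
  approx (gor (around (gplus AnyCount (gor X Y)) (gplus AtLeast Z))
              (around (gplus AnyCount (gor X Y)) (gplus AtLeast X)))
   (gplus AtLeast (gor X Y)).
Proof.
move=> Z; split=> k.
  exists k => l u.
  have fin ys zs ws : ws <> [::] -> l <= size ws -> (forall y, y \in ys ++ ws ++ zs -> gor X Y k l y) ->
      gplus AtLeast (gor X Y) k l (flatten ys ++ flatten ws ++ flatten zs).
    move=> H0 Hl H; exists (ys ++ ws ++ zs); rewrite !flatten_cat; split=> //=.
      by rewrite !size_cat; lia.
    by case: (ys) => //; case: (ws) H0.
  case=> /around_elim[ys [zs [v [H1 H2 [ws [H3 H4 H5 ->]] ->]]]].
    have [ws' [W1 W2 W3]] : exists ws', [/\ flatten ws = flatten ws', size ws <= size ws'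
        & forall y, y \in ws' -> gor X Y k l y].
      elim: ws H5 {H3 H4} => [|w ws IH] H5; first by exists [::].
      have [|ws' [W1 W2 W3]] := IH; first by move=> y Hy; apply: H5; rewrite inE Hy orbT.
      have [n [vs [_ V1 V2 V3 _]]] := ends_in_list (H5 w (mem_head _ _)).
      exists (vs ++ ws'); split; rewrite /= ?flatten_cat ?size_cat ?V3 ?W1 //.
        by case: vs V1 {V2 V3} => //= *; lia.
      by move=> y; rewrite mem_cat => /orP[/V2|/W3].
    rewrite W1; apply: fin.
    - by case: (ws') W2 => //; case: (ws) H4.
    - exact: leq_trans H3 W2.
    - by move=> y; rewrite !mem_cat => /or3P[/H1|/W3|/H2].
  apply: fin => // y; rewrite !mem_cat => /or3P[/H1|/H5 ?|/H2] //; by left.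
(* With at most l blocks ending in [Y] and all runs of length at most l, there would be at most l(l
   + 1) + l words, one fewer than (l + 1)(l + 1). *)
exists k => l; exists (l.+1 * l.+1) => u [ys [H1 H2 H3 ->]].
have {}H3 y : y \in ys -> gor X Y k l y by move=> /H3; apply: gl_mono => //; nia.
have [zs [rs [E1 E2 E3 E4]]] := split_runs H3.
have mid (zs' : seq (seq (seq A) * seq A)) : {subset zs' <= zs} -> forall y, y \in flatten [seq rcons z.1 z.2 | z <- zs'] -> gor X Y k l y.
  move=> Hsub y /flattenP[_ /mapP[z /Hsub Hz ->]]; rewrite mem_rcons inE.
  have [Z1 Z2] := E2 z Hz; by move=> /predU1P[->|/Z1]; [right|left].
have flat (zs' : seq (seq (seq A) * seq A)) : flatten [seq flatten z.1 ++ z.2 | z <- zs'] =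
    flatten (flatten [seq rcons z.1 z.2 | z <- zs']).
  by elim: zs' => //= z zs' ->; rewrite flatten_cat flatten_rcons.
have rsXY r : r \in rs -> gor X Y k l r by move=> /E3; left.
case: (leqP l.+1 (size zs)) => Hz.
  left; rewrite E1 -[flatten _ ++ _]/(flatten [::] ++ flatten _ ++ flatten rs).
  apply: around_intro => //; exists [seq flatten z.1 ++ z.2 | z <- zs]; split=> //=.
  - by rewrite size_map; apply: ltnW.
  - by case: (zs) Hz.
  move=> _ /mapP[z Hzz ->]; have [Z1 Z2] := E2 z Hzz.
  case Ez : z.1 => [|r rs']; first by left.
  by right; exists (flatten z.1), z.2; rewrite Ez; split=> //; exists z.1; rewrite Ez; split=> //; rewrite -Ez.
right; rewrite E1; case: (leqP l.+1 (size rs)) => Hr.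
  rewrite flat -[X in around _ _ _ _ X]cats0 -catA -[[::]]/(flatten [::]).
  apply: around_intro => //; first exact: mid.
  by exists rs; split=> //=; [apply: ltnW|case: (rs) Hr].
have [z Hzz Hzl] : exists2 z, z \in zs & l < size z.1.
  apply: NNPP => Hno.
  have Hs : sumn [seq (size z.1).+1 | z <- zs] <= size zs * l.+1.
    have : forall z, z \in zs -> size z.1 <= l.
      by move=> z Hzz; rewrite leqNgt; apply/negP => Hlt; apply: Hno; exists z.
    elim: (zs) => //= z zs' IH H; rewrite mulSn leq_add ?ltnS ?H ?mem_head //.
    by apply: IH => z' Hz'; apply: H; rewrite inE Hz' orbT.
  by move: H1; rewrite /= E4; nia.
have [Z1 Z2] := E2 z Hzz.
have [zs1 [zs2 Ezs]] := mem_split Hzz.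
have Hsub1 : {subset zs1 <= zs} by move=> x Hx; rewrite Ezs mem_cat Hx.
have Hsub2 : {subset zs2 <= zs} by move=> x Hx; rewrite Ezs mem_cat inE Hx !orbT.
have -> : flatten [seq flatten z.1 ++ z.2 | z <- zs] ++ flatten rs =
   flatten (flatten [seq rcons z.1 z.2 | z <- zs1]) ++ flatten z.1 ++
   flatten (z.2 :: flatten [seq rcons z.1 z.2 | z <- zs2] ++ rs).
  by rewrite Ezs map_cat flatten_cat /= !flatten_cat !flat -!catA.
apply: around_intro; first exact: mid.
  move=> y; rewrite inE mem_cat => /or3P[/eqP ->|/(mid _ Hsub2)|/rsXY] //.
  by right.
by exists z.1; split=> //=; [apply: ltnW|case: (z.1) Hzl].
Qed.
End Stratification.

(** * Removal of the empty word *)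

Section EmptyWord.
Variable A : finType.
Implicit Types (X Y : glang A).

Definition has_nil X := forall k l, X k l [::].
Definition no_nil X := exists l, forall k, ~ X k l [::].

Lemma no_nil_le X l l' k : (forall k, ~ X k l [::]) -> l <= l' -> ~ X k l' [::].
Proof. by move=> H Hl HX; apply: (H k); apply: gl_mono HX. Qed.

(** The languages [lsem] have no empty word, so it must be split off. This dichotomy makes the
    splitting uniform: the empty word is present at all thresholds or absent from some l on. *)
Lemma sem_nil (e : bsexp A) : has_nil (sem e) \/ no_nil (sem e).
Proof.
elim: e => [|||a|e1 IH1 e2 IH2|e1 IH1 e2 IH2|e IH|e IH|e IH] /=.
- by right; exists 0 => k.
- by left=> k l.
- by right; exists 1 => k [].
- by right; exists 0 => k.
- case: IH1 => [H1|[l H1]]; last first.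
    right; exists l => k [y [z [Hy Hz E]]]; apply: (H1 k).
    by case: y Hy E.
  case: IH2 => [H2|[l H2]]; last first.
    right; exists l => k [y [z [Hy Hz E]]]; apply: (H2 k).
    by case: y Hy E => // _ E; rewrite /= in E; rewrite E.
  by left=> k l; exists [::], [::].
- case: IH1 => [H1|[l1 H1]]; first by left=> k l; left.
  case: IH2 => [H2|[l2 H2]]; first by left=> k l; right.
  right; exists (maxn l1 l2) => k [] H.
    by apply: (no_nil_le H1 (leq_maxl _ _) H).
  by apply: (no_nil_le H2 (leq_maxr _ _) H).
- by left=> k l; exists [::].
- by left=> k l; exists [::].
case: IH => [H|[l0 H]].
  left=> k l; exists (nseq l [::]); split=> /=; first by rewrite size_nseq.
    by move=> y /nseqP[-> _].
  by elim: l.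
right; exists l0.+1 => k [[|y ys] [Hs Hy E]] //.
have y0 : y = [::] by case: y {Hs Hy} E.
apply: (no_nil_le (k := k) H (leqnSn l0)); apply: Hy.
by rewrite y0 mem_head.
Qed.

Lemma gne_gcat X Y : has_nil X \/ no_nil X -> has_nil Y \/ no_nil Y ->
  approx (gor (gcat (gne X) (gne Y))
     (gor (gwhen (has_nil X) (gne Y)) (gwhen (has_nil Y) (gne X)))) (gne (gcat X Y)).
Proof.
move=> HX HY; split=> k; exists k.
  move=> l u [[y [z [[y0 Hy] [z0 Hz] ->]]]|[[H [u0 Hu]]|[H [u0 Hu]]]].
  - by split; [case: (y) y0|exists y, z].
  - by split=> //; exists [::], u.
  - by split=> //; exists u, [::]; rewrite cats0.
move=> l; have [lX HX'] : exists lX, has_nil X \/ forall k, ~ X k lX [::].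
  by case: HX => [?|[lX ?]]; [exists 0; left|exists lX; right].
have [lY HY'] : exists lY, has_nil Y \/ forall k, ~ Y k lY [::].
  by case: HY => [?|[lY ?]]; [exists 0; left|exists lY; right].
exists (l + lX + lY) => u [u0 [y [z [Hy Hz Eu]]]].
have Hy' : X k l y by apply: gl_mono Hy => //; lia.
have Hz' : Y k l z by apply: gl_mono Hz => //; lia.
case: y Hy Hy' Eu => [|a y] Hy Hy' Eu.
  right; left; rewrite Eu; split; last by split=> //; rewrite -Eu.
  by case: HX' => // H; case: (no_nil_le H (l' := l + lX + lY) _ Hy); lia.
case: z Hz Hz' Eu => [|b z] Hz Hz' Eu.
  right; right; rewrite Eu cats0; split=> //.
  by case: HY' => // H; case: (no_nil_le H (l' := l + lX + lY) _ Hz); lia.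
by left; exists (a :: y), (b :: z).
Qed.

Lemma flatten_nonempty (ys : seq (seq A)) :
  flatten [seq y <- ys | y != [::]] = flatten ys.
Proof. by elim: ys => //= -[|a y] ys IH /=; rewrite IH. Qed.

Lemma gplus_ne c X k l u : gplus c (gne X) k l u -> gne (gexp c X) k l u.
Proof.
move=> [ys [H1 H2 H3 ->]]; split; last first.
  by exists ys; split=> // y /H3[].
case: ys H2 H3 {H1} => // y ys _ /(_ y (mem_head _ _))[y0 _].
by case: y y0.
Qed.

Lemma nonempty_parts X k l ys : (forall y, y \in ys -> X k l y) -> flatten ys <> [::] ->
  [/\ [seq y <- ys | y != [::]] <> [::],
     forall y, y \in [seq y <- ys | y != [::]] -> gne X k l y
   & flatten ys = flatten [seq y <- ys | y != [::]]].
Proof.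
move=> H u0; rewrite flatten_nonempty; split=> //.
  by move=> E; apply: u0; rewrite -flatten_nonempty E.
by move=> y; rewrite mem_filter => /andP[/eqP y0 /H].
Qed.

Lemma gne_gexp c X : c <> AtLeast -> approx (gplus c (gne X)) (gne (gexp c X)).
Proof.
move=> Hc; apply: approx_ext => k l u; split; first exact: gplus_ne.
move=> [u0 [ys [H1 H2 Eu]]]; rewrite Eu in u0 *.
have [P1 P2 ->] := nonempty_parts H2 u0.
exists [seq y <- ys | y != [::]]; split=> //.
case: c Hc H1 => //= _; apply: leq_trans; rewrite size_filter; exact: count_size.
Qed.

(** Empty factors can pad any list to length l, so the S-exponent then imposes nothing on the
    nonempty factors. *)
Lemma gne_gexp_nil X : has_nil X ->
  approx (gplus AnyCount (gne X)) (gne (gexp AtLeast X)).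
Proof.
move=> HX; apply: approx_ext => k l u; split.
  move=> /gplus_ne[u0 [ys [_ H2 E]]]; split=> //.
  exists (ys ++ nseq l [::]); split.
  - by rewrite /= size_cat size_nseq leq_addl.
  - by move=> y; rewrite mem_cat => /orP[/H2 //|/nseqP[-> _]].
  - by rewrite E flatten_cat; elim: (l) => [|l' IH]; rewrite /= ?cats0.
move=> [u0 [ys [H1 H2 Eu]]]; rewrite Eu in u0 *.
by have [P1 P2 ->] := nonempty_parts H2 u0; exists [seq y <- ys | y != [::]].
Qed.

(** Beyond the level from which the empty word is absent, every factor is nonempty and genuinely
    counts. *)
Lemma gne_gexp_nonil X : no_nil X ->
  approx (gplus AtLeast (gne X)) (gne (gexp AtLeast X)).
Proof.
move=> [lX HX]; split=> k; exists k; first by move=> l u /gplus_ne.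
move=> l; exists (maxn l lX) => u [u0 [ys [H1 H2 Eu]]]; exists ys; split=> //.
- by apply: leq_trans H1; apply: leq_maxl.
- by move=> E; apply: u0; rewrite Eu E.
move=> y /H2 Hy; split; last by apply: gl_mono Hy => //; apply: leq_maxl.
by move=> y0; apply: (no_nil_le HX (leq_maxr l lX)); rewrite -y0; apply: Hy.
Qed.
End EmptyWord.

Fixpoint sdepth (A : finType) (e : bsexp A) : nat :=
  match e with
  | BSconcat e1 e2 | BSmix e1 e2 => maxn (sdepth e1) (sdepth e2)
  | BSstar e1 | BSexpB e1 => sdepth e1
  | BSexpS e1 => (sdepth e1).+1
  | _ => 0
  end.

Fixpoint bdepth (A : finType) (e : bsexp A) : nat :=
  match e with
  | BSconcat e1 e2 | BSmix e1 e2 => maxn (bdepth e1) (bdepth e2)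
  | BSstar e1 | BSexpS e1 => bdepth e1
  | BSexpB e1 => (bdepth e1).+1
  | _ => 0
  end.

(** * Expressions as unions of layered languages *)

Section Representation.
Variables (Sigma : finType) (T : kind) (m D : nat).
Implicit Types (X Y : glang Sigma) (i j d : nat).

(* Counter i * (m + 1) + j is a B-counter for j < m, an S-counter for j = m:
   the counters are layered as B^m S B^m S ... *)
Definition pos i j := i * m.+1 + j.
Definition ctop := pos D 0.
Definition skind (c : nat) : bool := allows_S T && (c %% m.+1 == m).

Local Notation lv := (@lev Sigma ctop skind false).

Lemma skind_B i j : j < m -> ~~ skind (pos i j).
Proof.
move=> Hj; rewrite /skind /pos modnMDl modn_small ?leqW // negb_and.
by rewrite [_ == m]ltn_eqF // orbT.
Qed.

Lemma skind_S i : skind (pos i m) = allows_S T.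
Proof. by rewrite /skind /pos modnMDl modn_small // eqxx andbT. Qed.

Lemma lv_raise i j j' X : j <= j' -> j' <= m -> lv (pos i j) X -> lv (pos i j') X.
Proof.
move=> Hj Hm; apply: lev_raise; first by rewrite /pos leq_add2l.
rewrite /pos => c H1 H2; have -> : c = pos i (c - i * m.+1) by rewrite /pos; lia.
by apply: skind_B; lia.
Qed.

Lemma pos_lt i j d : i < d -> j <= m -> pos i j < pos d 0.
Proof. by rewrite /pos => *; nia. Qed.

Lemma pos_last i : (pos i m).+1 = pos i.+1 0.
Proof. by rewrite /pos; lia. Qed.

Definition gU d (Xs : nat -> glang Sigma) := gunion (fun i : 'I_d => Xs i).

(** The words of X are sorted by the number i of S-counters they use, with the first j B-counters of
    layer i available above them. *)
Definition rep d j X := exists Xs : nat -> glang Sigma,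
  (forall i, i < d -> lv (pos i j) (Xs i)) /\ approx (gU d Xs) X.

Lemma rep_approx d j X Y : approx X Y -> rep d j X -> rep d j Y.
Proof. by move=> H [Xs [H1 H2]]; exists Xs; split=> //; apply: approx_trans H2 H. Qed.

Lemma rep_gU d j Xs : (forall i, i < d -> lv (pos i j) (Xs i)) -> rep d j (gU d Xs).
Proof. by move=> H; exists Xs; split=> //; apply: approx_refl. Qed.

Lemma rep_raise d d' j j' X : d <= d' -> j <= j' -> j' <= m -> rep d j X -> rep d' j' X.
Proof.
move=> Hd Hj Hm [Xs [H1 H2]]; exists (fun i => gwhen (i < d) (Xs i)); split.
  by move=> i _; apply: lev_when => /H1; apply: lv_raise.
apply: approx_trans H2; apply: approx_ext => k l u; split.
  by move=> [i [Hi Hu]]; exists (Ordinal Hi).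
by move=> [i Hu]; exists (widen_ord Hd i); split=> /=.
Qed.

Lemma rep_lv i d j X : i < d -> lv (pos i j) X -> rep d j X.
Proof.
move=> Hi H; exists (fun i' => gwhen (i' = i) X); split.
  by move=> i' _; apply: lev_when => ->.
apply: approx_ext => k l u; split; first by move=> [i' []].
by move=> Hu; exists (Ordinal Hi).
Qed.

Lemma rep_or d j X Y : rep d j X -> rep d j Y -> rep d j (gor X Y).
Proof.
move=> [Xs [X1 X2]] [Ys [Y1 Y2]]; exists (fun i => gor (Xs i) (Ys i)); split.
  by move=> i Hi; apply: lev_or; auto.
apply: approx_trans (approx_gor X2 Y2); apply: approx_ext => k l u; split.
  by move=> [i [H|H]]; [left|right]; exists i.
by move=> [[i H]|[i H]]; exists i; [left|right].
Qed.

Lemma rep_when d j (P : Prop) X : (P -> rep d j X) -> rep d j (gwhen P X).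
Proof.
move=> H; have [HP|HP] := classic P.
  by apply: rep_approx (H HP); apply: approx_ext => k l u /=; tauto.
exists (fun _ => gconst (fun _ => False)); split=> [i _|]; first exact: lev_none.
by apply: approx_ext => k l u /=; split=> [[]|[]].
Qed.

Lemma rep_cat d j X Y : rep d j X -> rep d j Y -> rep d j (gcat X Y).
Proof.
move=> [Xs [X1 X2]] [Ys [Y1 Y2]].
exists (fun i => gunion (fun p : 'I_d * 'I_d =>
  gwhen (maxn p.1 p.2 = i) (gcat (Xs p.1) (Ys p.2)))); split.
  move=> i _; apply: lev_union => -[i1 i2]; apply: lev_when => /= <-.
  have -> : pos (maxn i1 i2) j = maxn (pos i1 j) (pos i2 j).
    rewrite /pos; case: (leqP i1 i2) => Hi.
      by rewrite (maxn_idPr _) // leq_add2r leq_mul2r Hi orbT.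
    by rewrite (maxn_idPl _) // leq_add2r leq_mul2r (ltnW Hi) orbT.
  by apply: lev_cat; [apply: X1|apply: Y1].
apply: approx_trans (approx_gcat X2 Y2); apply: approx_ext => k l u; split.
  move=> [_ [[i1 i2] [_ [y [z [Hy Hz ->]]]]]]; exists y, z.
  by split=> //; [exists i1|exists i2].
move=> [y [z [[i1 Hy] [i2 Hz] ->]]].
have Hi : maxn i1 i2 < d by rewrite gtn_max !ltn_ord.
by exists (Ordinal Hi), (i1, i2); split=> //; exists y, z.
Qed.

Lemma gU_S d Xs : approx (gor (gU d Xs) (Xs d)) (gU d.+1 Xs).
Proof.
apply: approx_ext => k l u; split.
  by move=> [[i H]|H]; [exists (widen_ord (leqnSn d) i)|exists ord_max].
move=> [i]; case: (ltnP i d) => Hi H; first by left; exists (Ordinal Hi).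
by right; have <- : i = d :> nat by apply/eqP; rewrite eqn_leq Hi -ltnS ltn_ord.
Qed.

Lemma lv_cat_low d j j' W X : j' <= m -> rep d j' W -> lv (pos d j) X ->
  lv (pos d j) (gcat W X).
Proof.
move=> Hj' [Ws [W1 W2]] HX.
suff : lv (pos d j) (gcat (gU d Ws) X).
  by apply: lev_approx; apply: approx_gcat => //; apply: approx_refl.
have : lv (pos d j) (gunion (fun i : 'I_d => gcat (Ws i) X)).
  apply: lev_union => i.
  have -> : pos d j = maxn (pos i j') (pos d j).
    by rewrite (maxn_idPr _) //; have := @pos_lt i j' d (ltn_ord i) Hj'; rewrite /pos; lia.
  by apply: lev_cat => //; apply: W1.
apply: lev_approx; apply: approx_ext => k l u; split.
  by move=> [i [y [z [Hy Hz ->]]]]; exists y, z; split=> //; exists i.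
by move=> [y [z [[i Hy] Hz ->]]]; exists i, y, z.
Qed.

Lemma lv_ends_in d j j' W X : j' <= m -> rep d j' W -> lv (pos d j) X ->
  lv (pos d j) (ends_in W X).
Proof. by move=> Hj HW HX; apply: lev_or => //; apply: lv_cat_low HW HX. Qed.

(** Induction on the number of layers with [gplus_stratify]: words of lower layers are grouped with
    a following word of the top layer, so that all counted factors lie in one layer and a single
    B-counter of that layer suffices. *)
Lemma rep_iter c d j j' X : (c = AnyCount /\ j' = j) \/ (c = AtMost /\ j' = j.+1) ->
  j' <= m -> d <= D -> rep d j X -> rep d j' (gplus c X).
Proof.
move=> Hc Hj Hd [Xs [H1 H2]].
have cL : c <> AtLeast by case: Hc => -[->].
suff : rep d j' (gplus c (gU d Xs)) by apply: rep_approx; apply: approx_gplus.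
elim: d Hd H1 {H2} => [|d IH] Hd H1.
  exists (fun _ => gconst (fun _ => False)); split=> //.
  apply: approx_ext => k l u; split; first by case=> -[].
  by move=> [[|y ys] [_ // _ H _]]; case: (H y (mem_head _ _)) => -[].
have HW : rep d j' (gplus c (gU d Xs)).
  by apply: IH => [|i Hi]; [exact: ltnW|apply/H1/ltnW].
have HW' : rep d.+1 j' (gplus c (gU d Xs)) by apply: rep_raise HW.
have HY : lv (pos d j) (ends_in (gplus c (gU d Xs)) (Xs d)).
  by apply: lv_ends_in HW _ => //; apply: H1.
have HZ : rep d.+1 j' (gplus c (ends_in (gplus c (gU d Xs)) (Xs d))).
  apply: (@rep_lv d) => //; case: Hc => -[Ec Ej]; subst c j'; first exact: lev_plus.
  have Hp : pos d j < ctop by apply: pos_lt => //; apply: ltnW.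
  have := lev_count Hp HY; rewrite /dk (negbTE (skind_B d Hj)) /pos addnS.
  exact: lev_weaken.
apply: rep_approx (approx_gplus c (gU_S d Xs)) _.
apply: rep_approx (gplus_stratify (gU d Xs) (Xs d) cL) _.
by apply: rep_or => //; apply: rep_or => //; apply: rep_cat.
Qed.

Lemma rep_plus d j X : j <= m -> d <= D -> rep d j X -> rep d j (gplus AnyCount X).
Proof. by move=> Hj Hd; apply: rep_iter => //; left. Qed.

Lemma rep_around d j X Y : rep d j X -> rep d j Y -> rep d j (around X Y).
Proof.
move=> HX HY; have HZ : rep d j (gor Y (gcat X Y)) by apply: rep_or => //; apply: rep_cat.
by apply: rep_or => //; apply: rep_cat.
Qed.

(** If factors ending in the top layer are counted, the next S-counter counts them and they move up
    one layer; if lower factors are counted, the induction hypothesis applies. *)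
Lemma rep_atleast d j X : allows_S T -> j <= m -> d.+1 <= D -> rep d j X ->
  rep d.+1 j (gplus AtLeast X).
Proof.
move=> HT Hj Hd [Xs [H1 H2]].
suff : rep d.+1 j (gplus AtLeast (gU d Xs)) by apply: rep_approx; apply: approx_gplus.
elim: d Hd H1 {H2} => [|d IH] Hd H1.
  exists (fun _ => gconst (fun _ => False)); split=> [i _|]; first exact: lev_none.
  apply: approx_ext => k l u; split; first by case.
  by move=> [[|y ys] [_ // _ H _]]; case: (H y (mem_head _ _)) => -[].
have Hlow : rep d j (gU d Xs) by apply: rep_gU => i Hi; apply/H1/ltnW.
have HY : lv (pos d j) (ends_in (gplus AnyCount (gU d Xs)) (Xs d)).
  by apply: lv_ends_in (rep_plus Hj _ Hlow) _ => //; [lia|apply: H1].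
have HZ : rep d.+2 j (gplus AtLeast (ends_in (gplus AnyCount (gU d Xs)) (Xs d))).
  apply: (@rep_lv d.+1) => //; apply: (@lv_raise _ 0) => //.
  have Hp : pos d m < ctop by apply: pos_lt; rewrite // ltnW.
  have := lev_count Hp (lv_raise Hj (leqnn m) HY); rewrite /dk skind_S HT pos_last.
  exact: lev_weaken.
have HX : rep d.+2 j (gplus AnyCount (gor (gU d Xs) (Xs d))).
  apply: (@rep_raise d.+1 _ j) => //; apply: rep_plus => //; first exact: ltnW.
  by apply: rep_or; [apply: rep_raise Hlow|apply: (@rep_lv d) => //; apply: H1].
apply: rep_approx (approx_gplus AtLeast (gU_S d Xs)) _.
apply: rep_approx (gplus_stratify_atleast (gU d Xs) (Xs d)) _.
apply: rep_or; apply: rep_around => //; apply: (@rep_raise d.+1 _ j) => //.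
by apply: IH => [|i Hi]; [lia|apply/H1/ltnW].
Qed.

Lemma rep_none d j : rep d j (gconst (fun _ => False)).
Proof.
exists (fun _ => gconst (fun _ => False)); split=> [i _|]; first exact: lev_none.
by apply: approx_ext => k l u; split=> // -[].
Qed.

(** The nesting of S-exponents gives the number of layers, that of B-exponents the number of
    B-counters needed in each layer. *)
Theorem rep_sem (e : bsexp Sigma) : T_regular T e -> sdepth e < D -> bdepth e <= m ->
  rep (sdepth e).+1 (bdepth e) (gne (sem e)).
Proof.
have none (X : glang Sigma) d j : (forall k l u, ~ gne X k l u) -> rep d j (gne X).
  by move=> H; apply: rep_approx (rep_none d j); apply: approx_ext => k l u; split=> // /H.
elim: e => [|||a|e1 IH1 e2 IH2|e1 IH1 e2 IH2|e IH|e IH|e IH] HT Hs Hb.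
- by apply: none => k l u [].
- by apply: none => k l u [].
- by apply: none => k l u [? []].
- apply: (@rep_lv 0) => //; apply: lev_approx (lev_letter _ _ a).
  by apply: approx_ext => k l u; split=> [->|[]].
- move: HT Hs Hb => /= /andP[T1 T2]; rewrite gtn_max geq_max => /andP[S1 S2] /andP[B1 B2].
  have Mm : maxn (bdepth e1) (bdepth e2) <= m by rewrite geq_max B1.
  have {}IH1 := rep_raise (leq_maxl _ (sdepth e2).+1) (leq_maxl _ (bdepth e2)) Mm (IH1 T1 S1 B1).
  have {}IH2 := rep_raise (leq_maxr (sdepth e1).+1 _) (leq_maxr (bdepth e1) _) Mm (IH2 T2 S2 B2).
  rewrite maxnSS in IH1 IH2.
  apply: rep_approx (gne_gcat (sem_nil e1) (sem_nil e2)) _.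
  apply: rep_or; first exact: rep_cat.
  by apply: rep_or; apply: rep_when.
- move: HT Hs Hb => /= /andP[T1 T2]; rewrite gtn_max geq_max => /andP[S1 S2] /andP[B1 B2].
  have Mm : maxn (bdepth e1) (bdepth e2) <= m by rewrite geq_max B1.
  have {}IH1 := rep_raise (leq_maxl _ (sdepth e2).+1) (leq_maxl _ (bdepth e2)) Mm (IH1 T1 S1 B1).
  have {}IH2 := rep_raise (leq_maxr (sdepth e1).+1 _) (leq_maxr (bdepth e1) _) Mm (IH2 T2 S2 B2).
  rewrite maxnSS in IH1 IH2.
  apply: rep_approx (rep_or IH1 IH2); apply: approx_ext => k l u /=; tauto.
- apply: rep_approx (gne_gexp (sem e) _) _; first by [].
  by apply: rep_plus => //; apply: IH.
- move: HT => /= /andP[_ HT]; apply: rep_approx (gne_gexp (sem e) _) _; first by [].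
  by apply: (@rep_iter AtMost _ (bdepth e)) => //; [right|apply: IH => //; apply: ltnW].
move: HT Hs => /= /andP[HS HT] Hs.
have {}IH := IH HT (ltnW Hs) Hb.
case: (sem_nil e) => He.
  apply: rep_approx (gne_gexp_nil He) _.
  by apply: (@rep_raise (sdepth e).+1 _ (bdepth e)) => //; apply: rep_plus => //; apply: ltnW.
by apply: rep_approx (gne_gexp_nonil He) _; apply: rep_atleast.
Qed.
End Representation.

(** * Recurrent layers in an omega-power *)

Section EventualPowers.
Variable A : finType.
Implicit Types (X Y : glang A) (w : omega_word A) (R : seq A -> Prop).

Lemma flatten_nils (u : nat -> seq A) a b : (forall i, a <= i < b -> u i = [::]) ->
  flatten (seg u a b) = [::].
Proof.
move=> H; rewrite /seg; have : forall i, i \in index_iota a b -> u i = [::].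
  by move=> i; rewrite mem_index_iota => /H.
elim: (index_iota a b) => //= i s IH Hs; rewrite Hs ?mem_head //=.
by apply: IH => j Hj; apply: Hs; rewrite inE Hj orbT.
Qed.

Lemma enum_between (g : nat -> nat) (P : nat -> Prop) i t :
  (forall j, g j < g j.+1) -> (forall t, P t <-> exists j, g j = t) ->
  g i < t < g i.+1 -> ~ P t.
Proof.
move=> gS gP /andP[H1 H2] /gP[j Ej]; subst t.
have : i < j by rewrite ltnNge; apply/negP => /(strict_mono_le gS); rewrite leqNgt H1.
by move=> /(strict_mono_le gS); rewrite leqNgt H2.
Qed.

(** Merging from each nonempty factor up to the next one absorbs the empty factors and leaves the
    nonempty ones unchanged. *)
Lemma eom_ne R X w : eom R X w -> eom R (gne X) w.
Proof.
move=> [u [k [HX Hn HR]]].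
have [|g [gS gD gP]] := @enum_infinite (fun i => u i != [::]).
  by move=> n; have [i ? ?] := Hn n; exists i.
apply: (@eom_group _ R (gne X) w u k g) => // l.
have [N HN] := HX l; exists N => i Hi.
have -> : flatten (seg u (g i) (g i.+1)) = u (g i).
  rewrite seg_cons //= flatten_nils ?cats0 // => t Ht.
  by apply/eqP/negPn/negP => ut; case: (enum_between (i := i) gS gP Ht).
by split; [apply/eqP|apply/HN/(leq_trans Hi)/strict_mono_ge].
Qed.

(** For [AtMost] each factor is a group of its own; for [AtLeast] the i-th group has i + 1 factors,
    so the group sizes tend to infinity. *)
Lemma eom_gplus c R X w : c <> AnyCount -> eom R X w -> eom R (gplus c X) w.
Proof.
move=> Hc [u [k [HX Hn HR]]].
pose sz i := if c is AtLeast then i.+1 else 1.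
pose g := fix g i := if i is i'.+1 then g i' + sz i' else 0.
have szpos i : 0 < sz i by rewrite /sz; case: (c).
have gS i : g i < g i.+1 by rewrite /= -[X in X < _]addn0 ltn_add2l.
apply: (@eom_group _ R (gplus c X) w u k.+1 g) => // l.
have [N HN] := HX l; exists (maxn N l) => i; rewrite geq_max => /andP[Hi Hil].
exists (seg u (g i) (g i.+1)); split=> //.
- rewrite size_seg /= addKn /sz; case: (c) Hc => //= _; exact: leqW.
- by rewrite seg_cons.
move=> y /mapP[t]; rewrite mem_index_iota => /andP[Ht _] ->.
apply: (@gl_mono _ X k _ l) (HN t _) => //.
exact: leq_trans Hi (leq_trans (strict_mono_ge gS i) Ht).
Qed.

Definition last_level (Xs : nat -> glang A) i :=
  ends_in (gplus AnyCount (gunion (fun j : 'I_i => Xs j))) (Xs i).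

(** Let c be the greatest layer met infinitely often. Past the last occurrence of higher layers,
    cutting after each factor of layer c gives groups of lower factors followed by one of layer
    c. *)
Lemma eom_last_level d (Xs : nat -> glang A) R w :
  eom R (gunion (fun i : 'I_d => Xs i)) w -> exists i : 'I_d, eom R (last_level Xs i) w.
Proof.
move=> [u [k [HX Hn HR]]]; have [N0 HN0] := HX 0.
have [|l|lv Hlv Hu] := @eventual_levels A k (gunion (fun i : 'I_d => Xs i)) (fun i => N0 <= i) u.
- exact: HN0.
- by have [N HN] := HX l; exists N => i Hi _; apply: HN.
have [i0 _] := Hu N0 (leqnn _).
have /fun_choice [lam Hlam] : forall i, exists j : 'I_d, N0 <= i -> Xs j k (lv i) (u i).
  by move=> i; case: (leqP N0 i) => [/Hu[j Hj]|Hi]; [exists j|exists i0].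
pose inf (c : 'I_d) := forall n, exists2 i, n <= i & lam i = c.
have [c0 Hc0] : exists c, inf c.
  have [c Hc] := @infinite_pigeonhole 'I_d lam (fun _ => True) (fun n => ex_intro2 _ _ n (leqnn n) I).
  by exists c => n; have [i ? []] := Hc n; exists i.
(* Minimizing d - c selects the greatest recurrent layer. *)
have [_ [[c [-> Hc]] Hmax]] := @nat_minimal (fun n => exists c : 'I_d, n = d - c /\ inf c)
  (ex_intro _ (d - c0) (ex_intro _ c0 (conj erefl Hc0))).
have [N1 HN1] : exists N1, forall i, N1 <= i -> lam i <= c.
  have /fin_all_exists [f Hf] : forall c' : 'I_d, exists n, c < c' -> forall i, n <= i -> lam i <> c'.
    move=> c'; case: (ltnP c c') => Hcc; last by exists 0.
    have Hninf : ~ inf c'.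
      by move=> /(fun h => Hmax _ (ex_intro _ c' (conj erefl h))); have := ltn_ord c'; lia.
    apply: NNPP => Hno; apply: Hninf => n; apply: NNPP => Hno'; apply: Hno; exists n => _ i Hi E.
    by apply: Hno'; exists i.
  exists (\max_c' f c') => i Hi; rewrite leqNgt; apply/negP => Hlt.
  by apply: (Hf (lam i) Hlt i) => //; apply: leq_trans Hi; apply: leq_bigmax.
have [|g [gS gD gP]] := @enum_infinite (fun i => maxn N0 N1 <= i /\ lam i = c).
  move=> n; have [i Hi Ei] := Hc (maxn n (maxn N0 N1)).
  by move: Hi; rewrite geq_max => /andP[? ?]; exists i.
exists c; apply: (@eom_group _ R (last_level Xs c) w u k (fun i => (g i).+1)) => // l.
have [N HN] := Hlv l; exists N => i Hi.
have gi : N <= g i by apply: leq_trans (strict_mono_ge gS i).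
have mem t : g i < t <= g i.+1 -> Xs (lam t) k l (u t).
  move=> /andP[Ht _]; have [Hg _] := gD i; move: Hg; rewrite geq_max => /andP[Hg _].
  apply: gl_mono (Hlam t _) => //; last exact: leq_trans Hg (ltnW Ht).
  exact/HN/(leq_trans gi)/ltnW.
have Hlast : Xs c k l (u (g i.+1)).
  by have [_ E] := gD i.+1; have := mem (g i.+1); rewrite E leqnn andbT; apply.
rewrite seg_rcons // flatten_rcons.
case: (leqP (g i.+1) (g i).+1) => Hg; first by rewrite seg_nil //; left.
right; exists (flatten (seg u (g i).+1 (g i.+1))), (u (g i.+1)); split=> //.
exists (seg u (g i).+1 (g i.+1)); split=> //; first by rewrite seg_cons.
move=> y /mapP[t]; rewrite mem_index_iota => /andP[H1 H2] ->.
have Hlt : lam t < c.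
  have [Hm _] := gD i; have Ht : maxn N0 N1 <= t by apply: leq_trans Hm (ltnW H1).
  rewrite ltn_neqAle HN1 ?andbT; last by apply: leq_trans Ht; apply: leq_maxr.
  apply/eqP => /val_inj E; case: (@enum_between g (fun i => maxn N0 N1 <= i /\ lam i = c) i t) => //.
  by rewrite H1 H2.
by exists (Ordinal Hlt); apply: mem; rewrite H1 ltnW.
Qed.

Lemma om_last_level d (Xs : nat -> glang A) (i : 'I_d) w :
  om (last_level Xs i) w -> om (gunion (fun i : 'I_d => Xs i)) w.
Proof.
move=> H; apply: (@om_ungroup _ AnyCount); apply: om_le H => k; exists k => l u.
case=> [Hu|[y [z [[ys [_ _ Hys ->]] Hz ->]]]].
  exists [:: u]; split=> //=; rewrite ?cats0 // => y; rewrite inE => /eqP ->.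
  by exists i.
exists (rcons ys z); split=> //; last by rewrite flatten_rcons.
move=> y'; rewrite mem_rcons inE => /predU1P[->|/Hys[j Hj]]; first by exists i.
by exists (widen_ord (ltnW (ltn_ord i)) j).
Qed.
End EventualPowers.

Section Components.
Variables (Sigma : finType) (T : kind) (m D : nat).
Local Notation ctop := (ctop m D).
Local Notation skind := (skind T m).
Local Notation delta := (Sigma * {ffun 'I_ctop -> action})%type.

Definition kcount : arity := if allows_S T then AtLeast else AtMost.

(** Each further iteration puts the last counter of the next layer to use, until every counter is
    reset at the end of each word; the topmost one is reset there only and thus marks the
    factors. *)
Lemma lev_top i (X : glang Sigma) : i < D -> @lev Sigma ctop skind false (pos m i m) X ->
  exists n, @lev Sigma ctop skind true ctop (iter n.+1 (gplus kcount) X).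
Proof.
move=> Hi; have [d Hd] := ubnP (D - i); elim: d i X Hi Hd => // d IH i X Hi Hd HX.
have Hp : pos m i m < ctop by apply: pos_lt.
have {}HX := lev_count Hp HX; rewrite /dk skind_S pos_last -/kcount in HX.
case: (ltnP i.+1 D) => Hi'; last first.
  have Ei : i.+1 = D by apply/eqP; rewrite eqn_leq Hi Hi'.
  by exists 0; move: HX; rewrite Ei.
have {}HX := lv_raise (leq0n m) (leqnn m) (lev_weaken HX).
have [|n Hn] := IH i.+1 _ Hi' _ HX; first by lia.
by exists n.+1; rewrite iterSr.
Qed.

(** The factors lost by eventual approximations are words of the erased f, so they are absorbed by
    the star appended to e; conversely [om_prepend] puts them back into the omega-power. *)
Lemma component (e : regexp Sigma) (f : bsexp Sigma) :
  T_regular T f -> sdepth f < D -> bdepth f <= m ->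
  exists h : 'I_D -> Sigma -> regexp delta,
    (forall i a v, reg_lang (h i a) v -> wfw ctop v /\ calm ctop v) /\
    forall w, omega_concat (reg_lang e) (om (sem f)) w <->
      exists i, omega_concat (reg_lang (Rconcat e (Rstar (erase f))))
                  (om (lsem skind ctop (h i))) w.
Proof.
move=> Hf Hs Hb.
have [Xs [X1 [X2 X3]]] : rep T m D D m (gne (sem f)).
  exact: rep_raise Hs Hb (leqnn m) (rep_sem Hf Hs Hb).
have /fin_all_exists [n Hn] : forall i : 'I_D, exists n,
    @lev Sigma ctop skind true ctop (iter n.+1 (gplus kcount) (last_level Xs i)).
  move=> i; apply: (@lev_top i) => //.
  apply: lv_ends_in (leqnn m) _ _; last exact: X1.
  apply: rep_plus => //; first exact: ltnW.
  by apply: rep_gU => j Hj; apply: X1; apply: ltn_trans (ltn_ord i).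
have /fin_all_exists [h Hh] := Hn.
exists h; split=> [i a v Hv|w].
  by have [H _] := Hh i; have [H1 H2] := H a v Hv; split=> //; apply: H2.
have star_eq x : reg_lang (Rstar (erase f)) x <-> gstar0 (sem f) x.
  exact: (reg_lang_erase (BSstar f)).
split=> [[x [Hx Hp Hom]]|[i [_ [[x [y [Hx /star_eq Hy ->]]] Hp Hom]]]].
  have := eom_le X3 (eom_ne (om_eom Hom)); move=> /eom_last_level[i Hi].
  have {}Hi : eom (gstar0 (sem f)) (iter (n i).+1 (gplus kcount) (last_level Xs i))
      (fun t => w (size x + t)).
    elim: (n i).+1 => // n' IH; apply: eom_gplus IH.
    by rewrite /kcount; case: ifP.
  have [_ [_ Hev]] := Hh i.
  have [y [Hy1 Hy2 Hy3]] := eom_om (eom_le Hev Hi).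
  exists i, (x ++ y); split.
  - by exists x, y; split=> //; apply/star_eq.
  - by apply/prefix_of_cat.
  - by apply: om_ext Hy3 => t /=; rewrite size_cat addnA.
exists x; have [Hp1 Hp2] := proj1 (prefix_of_cat _ _ _) Hp; split=> //.
apply: om_prepend; exists y; split=> //.
have {}Hom : om (lsem skind ctop (h i)) (fun t => w (size x + (size y + t))).
  by apply: om_ext Hom => t /=; rewrite size_cat addnA.
have [_ [Hle _]] := Hh i; have {}Hom := om_le Hle Hom.
have {}Hom : om (last_level Xs i) (fun t => w (size x + (size y + t))).
  move: Hom; elim: (n i).+1 => // n' IH H; apply: IH.
  by apply: om_ungroup; apply: om_le H; apply: gplus_gexp.
have {}Hom := om_le X2 (om_last_level Hom).
by apply: om_le Hom => k; exists k => l u [].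
Qed.
End Components.

(** * Automata for regular expressions *)

Lemma flatten_rcons_last (A : eqType) (ys : seq (seq A)) w a :
  flatten ys = rcons w a -> exists zs v, [/\ {subset zs <= ys}, rcons v a \in ys
    & w = flatten zs ++ v].
Proof.
elim/last_ind: ys => [|ys y IH]; first by case: w.
rewrite flatten_rcons; case/lastP: y => [|v b].
  rewrite cats0 => /IH[zs [v [H1 H2 ->]]]; exists zs, v; split=> //.
    by move=> z /H1; rewrite mem_rcons inE orbC => ->.
  by rewrite mem_rcons inE H2 orbT.
rewrite -rcons_cat => /rcons_inj[<- <-]; exists ys, v; split=> //.
  by move=> z Hz; rewrite mem_rcons inE Hz orbT.
by rewrite mem_rcons mem_head.
Qed.

Section Determinization.
Variable A : finType.
Implicit Types (r : regexp A) (w : seq A).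

Definition recognized r := exists (S : finType) (d : S -> A -> S) (s0 : S) (F : S -> bool),
  forall w, reg_lang r w <-> F (foldl d s0 w).

(** Subset construction: one run of the first automaton, and the set of runs of the second one
    started at each accepted prefix. *)
Lemma recognized_concat r1 r2 :
  recognized r1 -> recognized r2 -> recognized (Rconcat r1 r2).
Proof.
move=> [S1 [d1 [s1 [F1 H1]]]] [S2 [d2 [s2 [F2 H2]]]].
pose st (p : S1 * {set S2}) a : S1 * {set S2} := let s := d1 p.1 a in
  (s, [set d2 x a | x in p.2] :|: (if F1 s then [set s2] else set0)).
pose i0 : S1 * {set S2} := (s1, if F1 s1 then [set s2] else set0).
exists (S1 * {set S2})%type, st, i0, (fun p : S1 * {set S2} => [exists x in p.2, F2 x]).
have inv w : (foldl st i0 w).1 = foldl d1 s1 w /\ forall x,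
    (x \in (foldl st i0 w).2) <-> exists u v, [/\ w = u ++ v, F1 (foldl d1 s1 u)
      & x = foldl d2 s2 v].
  elim/last_ind: w => [|w a [IH1 IH2]].
    split=> // x /=; split=> [|[u [v [E Fu ->]]]]; last first.
      by case: u v E Fu => [|//] [|//] _ /= ->; rewrite inE.
    by case: ifP => F; rewrite inE // => /eqP ->; exists [::], [::].
  rewrite !foldl_rcons; split=> [|x]; first by rewrite /= IH1.
  rewrite /st IH1 inE; split.
    case/orP=> [/imsetP[y /IH2[u [v [-> Fu ->]]] ->]|].
      by exists u, (rcons v a); rewrite rcons_cat foldl_rcons.
    case: ifP => F; rewrite inE // => /eqP ->; exists (rcons w a), [::].
    by rewrite cats0 foldl_rcons.
  move=> [u [v [E Fu ->]]]; case/lastP: v E => [|v b].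
    by rewrite cats0 => E; rewrite -foldl_rcons E Fu inE orbC eqxx.
  rewrite -rcons_cat => /rcons_inj[E <-]; rewrite foldl_rcons.
  by apply/orP; left; apply: imset_f; apply/IH2; exists u, v.
move=> w; have [_ Hx] := inv w; split.
  move=> [u [v [/H1 Fu /H2 Fv ->]]]; apply/exists_inP; exists (foldl d2 s2 v) => //.
  by apply/(proj2 (inv _)); exists u, v.
by move=> /exists_inP[x /Hx[u [v [-> Fu ->]]] Fx]; exists u, v; split=> //; [apply/H1|apply/H2].
Qed.

(** The set holds the runs started after each prefix in the star, and the boolean records whether
    the word read so far lies in the star; initially it does, by the empty word. *)
Lemma recognized_star r : recognized r -> recognized (Rstar r).
Proof.
move=> [S [d [s0 [F H]]]].
pose ext (X : {set S}) a : {set S} := [set d x a | x in X].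
pose acc (X : {set S}) := [exists x in X, F x].
pose st (p : {set S} * bool) a : {set S} * bool := let X := ext p.1 a in
  (if acc X then s0 |: X else X, acc X).
pose i0 : {set S} * bool := ([set s0], true).
exists ({set S} * bool)%type, st, i0, (fun p => p.2).
have nil_star : reg_lang (Rstar r) [::] by exists [::].
have cat_star u v : reg_lang (Rstar r) u -> reg_lang r v -> reg_lang (Rstar r) (u ++ v).
  move=> [ys [Hys ->]] Hv; exists (rcons ys v); rewrite flatten_rcons; split=> //.
  by move=> y; rewrite mem_rcons inE => /predU1P[->|/Hys].
have inv w : (reg_lang (Rstar r) w <-> (foldl st i0 w).2) /\ forall x,
    (x \in (foldl st i0 w).1) <-> exists u v, [/\ w = u ++ v, reg_lang (Rstar r) u
      & x = foldl d s0 v].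
  elim/last_ind: w => [|w a [IH1 IH2]].
    split=> // x; rewrite inE; split=> [/eqP ->|[u [v [E _ ->]]]].
      by exists [::], [::].
    by case: u v E => [|//] [|//].
  rewrite !foldl_rcons /st; set p := foldl st i0 w in IH1 IH2 *.
  have extP x : x \in ext p.1 a <-> exists u v, [/\ w = u ++ v, reg_lang (Rstar r) u
      & x = foldl d s0 (rcons v a)].
    split=> [/imsetP[y /IH2[u [v [E Hu ->]]] ->]|[u [v [E Hu ->]]]].
      by exists u, v; rewrite foldl_rcons.
    by rewrite foldl_rcons; apply: imset_f; apply/IH2; exists u, v.
  have accP : reg_lang (Rstar r) (rcons w a) <-> acc (ext p.1 a).
    split=> [[ys [Hys /esym/flatten_rcons_last[zs [v [Z1 Z2 Z3]]]]]|].
      apply/exists_inP; exists (foldl d s0 (rcons v a)); last exact/H/Hys.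
      by apply/extP; exists (flatten zs), v; split=> //; exists zs; split=> // z /Z1 /Hys.
    move=> /exists_inP[x /extP[u [v [E Hu Ex]]] Fx]; rewrite E rcons_cat.
    by apply: cat_star => //; apply/H; rewrite -Ex.
  split=> [//|x] /=.
  have -> : (x \in (if acc (ext p.1 a) then s0 |: ext p.1 a else ext p.1 a)) <->
      (acc (ext p.1 a) /\ x = s0) \/ x \in ext p.1 a.
    case: ifP => Hacc; last by split=> [|[[]|]] //; right.
    by rewrite !inE; split=> [/orP[/eqP|]|[[_ ->]|->]]; rewrite ?eqxx ?orbT //; [left|right].
  split=> [[[/accP Hw ->]|/extP[u [v [-> Hu ->]]]]|[u [v [E Hu ->]]]].
  - by exists (rcons w a), [::]; rewrite cats0.
  - by exists u, (rcons v a); rewrite rcons_cat.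
  case/lastP: v E => [|v b]; first by rewrite cats0 => E; left; rewrite -accP E.
  rewrite -rcons_cat => /rcons_inj[E <-]; right; apply/extP; by exists u, v.
by move=> w; case: (inv w).
Qed.

Lemma regexp_recognized r : recognized r.
Proof.
elim: r => [||a|r1 H1 r2 H2|r1 [S1 [d1 [s1 [F1 H1]]]] r2 [S2 [d2 [s2 [F2 H2]]]]|r H].
- by exists unit, (fun s _ => s), tt, (fun _ => false) => w; split.
- exists bool, (fun _ _ => false), true, (fun s => s) => w.
  by elim/last_ind: w => [|w b _]; rewrite ?foldl_rcons; split=> //; case: w.
- pose st (s : option bool) b := if s == Some false then (if b == a then Some true else None) else None.
  exists (option bool), st, (Some false), (fun s => s == Some true) => w.
  have dead u : foldl st None u = None by elim: u.
  case: w => [|b [|c w]] /=; rewrite /st /=; split=> //.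
  + by move=> [->]; rewrite eqxx.
  + by case: (b =P a) => // ->.
  + by case: (b =P a) => //= _; rewrite ?dead.
- exact: recognized_concat.
- exists (S1 * S2)%type, (fun p a => (d1 p.1 a, d2 p.2 a)), (s1, s2),
    (fun p => F1 p.1 || F2 p.2) => w.
  have -> : foldl (fun p a => (d1 p.1 a, d2 p.2 a)) (s1, s2) w = (foldl d1 s1 w, foldl d2 s2 w).
    by elim: w s1 s2 {H1 H2} => //= a w IH s1 s2; rewrite IH.
  by rewrite /= H1 H2; split=> [[]->|/orP[]]; rewrite ?orbT; auto.
- exact: recognized_star.
Qed.

Lemma family_recognized (I : finType) (r : I -> regexp A) :
  exists (S : finType) (d : S -> A -> S) (s0 : S) (F : I -> S -> bool),
  forall i w, reg_lang (r i) w <-> F i (foldl d s0 w).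
Proof.
suff [S [d [s0 [F HF]]]] : exists (S : finType) (d : S -> A -> S) (s0 : S) (F : I -> S -> bool),
    forall i, i \in enum I -> forall w, reg_lang (r i) w <-> F i (foldl d s0 w).
  by exists S, d, s0, F => i; apply: HF; rewrite mem_enum.
elim: (enum I) => [|i s [S [d [s0 [F HF]]]]].
  by exists unit, (fun s _ => s), tt, (fun _ _ => true).
have [S1 [d1 [s1 [F1 H1]]]] := regexp_recognized (r i).
exists (S1 * S)%type, (fun p a => (d1 p.1 a, d p.2 a)), (s1, s0),
  (fun j p => if j == i then F1 p.1 else F j p.2) => j Hj w.
have -> : foldl (fun p a => (d1 p.1 a, d p.2 a)) (s1, s0) w = (foldl d1 s1 w, foldl d s0 w).
  by elim: w s1 s0 {H1 HF} => //= a w IH s1 s0; rewrite IH.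
case: eqP => [->|/eqP Nj] //=; apply: HF.
by move: Hj; rewrite inE (negbTE Nj).
Qed.
End Determinization.

(** * From expressions to hierarchical automata *)

Section OmegaAutomaton.
Variables (Sigma : finType) (N : nat) (sk : nat -> bool) (I : finType).
Hypothesis N_pos : 0 < N.
Local Notation delta := (Sigma * {ffun 'I_N -> action})%type.
Variables (P : I -> regexp Sigma) (h : I -> Sigma -> regexp delta).
Hypothesis h_wf : forall i a v, reg_lang (h i a) v -> wfw N v /\ calm N v.
Variables (S1 S2 : finType) (d1 : S1 -> Sigma -> S1) (d2 : S2 -> delta -> S2).
Variables (s1 : S1) (s2 : S2) (F1 : I -> S1 -> bool) (F2 : I * Sigma -> S2 -> bool).
Hypothesis F1P : forall i w, reg_lang (P i) w <-> F1 i (foldl d1 s1 w).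
Hypothesis F2P : forall p w, reg_lang (h p.1 p.2) w <-> F2 p (foldl d2 s2 w).

Let top : 'I_N := Ordinal (ltac:(by rewrite prednK) : N.-1 < N).
Let reset_all : {ffun 'I_N -> action} := opf N N false.
Let no_action : {ffun 'I_N -> action} := opf N 0 false.

Definition ostate : finType := option (I * (S1 + S2)).

(* In state q the automaton may continue the prefix of component i from s
   (left) or a factor of its omega-power (right); reaching the end of the
   prefix allows starting the first factor. *)
Definition resolves (q : ostate) (i : I) (s : S1 + S2) : bool :=
  match q, s with
  | None, inl s => s == s1
  | None, inr s => (s == s2) && F1 i s1
  | Some (j, inl t), inl s => (j == i) && (s == t)
  | Some (j, inl t), inr s => [&& j == i, F1 i t & s == s2]
  | Some (j, inr t), inr s => (j == i) && (s == t)
  | Some (_, inr _), inl _ => false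
  end.

(** Counters rest during the prefix. In a factor any operation not resetting [top] is read as a
    letter, and a letter that completes a factor resets all counters; resets of [top] therefore
    delimit the factors. *)
Definition moves (q : ostate) (a : Sigma) (o : {ffun 'I_N -> action}) (q' : ostate) : bool :=
  [exists i, exists s, resolves q i s && match s with
    | inl s => (o == no_action) && (q' == Some (i, inl (d1 s a)))
    | inr s => (~~ isr (o top) && (q' == Some (i, inr (d2 s (a, o))))) ||
               [&& o == reset_all, F2 (i, a) s & q' == Some (i, inr s2)]
    end].

Lemma kinds_disjoint : [disjoint [set c : 'I_N | ~~ sk c] & [set c : 'I_N | sk c]].
Proof. by rewrite -setI_eq0; apply/eqP/setP => c; rewrite !inE; case: (sk c). Qed.

Lemma kinds_cover : [set c : 'I_N | ~~ sk c] :|: [set c : 'I_N | sk c] = [set: 'I_N].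
Proof. by apply/setP => c; rewrite !inE; case: (sk c). Qed.

Definition oaut : automaton Sigma 'I_N := @Automaton Sigma 'I_N ostate None
  [set c : 'I_N | ~~ sk c] [set c : 'I_N | sk c] kinds_disjoint kinds_cover
  (fun a => [set t : transition ostate 'I_N | moves t.1.1 a t.1.2 t.2 && hierb t.1.2]).

Lemma action_isn (a : action) : a = Incr \/ a = Reset -> ~~ isn a.
Proof. by case=> ->. Qed.

Lemma oaut_hierarchical : hierarchical oaut.
Proof.
move=> a t; rewrite inE => /andP[_ /forallP Ht] k Hk j jk.
have /forallP/(_ j) := Ht k; rewrite jk andbT => /implyP/(_ (action_isn Hk)).
by rewrite isrE => /eqP.
Qed.

Local Notation letter := (Sigma * transition (state oaut) 'I_N)%type.
Implicit Types (W : seq letter).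

Definition lab (t : letter) : delta := (t.1, t.2.1.2).

Lemma ac_lab c W : ac (A := oaut) c W = oc c (map lab W).
Proof. by rewrite /ac /oc -map_comp. Qed.

Lemma fst_lab W : map fst (map lab W) = map fst W.
Proof. by rewrite -map_comp. Qed.

Lemma path_step (q : state oaut) (t : letter) W (q' : state oaut) :
  moves q t.1 t.2.1.2 (target (A := oaut) t.2) -> hierb t.2.1.2 ->
  source (A := oaut) t.2 = q -> pth (A := oaut) (target (A := oaut) t.2) W q' ->
  pth (A := oaut) q (t :: W) q'.
Proof.
case: t => a [[q1 o] q2] /= Hm Hh E HW; subst q.
by rewrite HW eqxx !andbT inE; apply/andP.
Qed.

Lemma path_prefix q i s x : resolves q i (inl s) ->
  exists W q', [/\ map fst W = x, pth (A := oaut) q W q' & resolves q' i (inl (foldl d1 s x))].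
Proof.
elim: x q s => [|a x IH] q s Hq; first by exists [::], q; split=> //=.
have [|W [q' [H1 H2 H3]]] := IH (Some (i, inl (d1 s a))) (d1 s a).
  by rewrite /= !eqxx.
pose t : transition (state oaut) 'I_N := (q : state oaut, no_action, Some (i, inl (d1 s a)) : state oaut).
exists ((a, t) :: W), q'; split=> //=; first by rewrite H1.
apply: (@path_step q (a, t)) => //=; last exact: hierb_opf.
apply/existsP; exists i; apply/existsP; exists (inl s); by rewrite Hq !eqxx.
Qed.

Lemma path_factor q i s v : resolves q i (inr s) -> wfw N v -> calm N v ->
  exists W q', [/\ map lab W = v, pth (A := oaut) q W q' & resolves q' i (inr (foldl d2 s v))].
Proof.
elim: v q s => [|[a o] v IH] q s Hq Hw Hc; first by exists [::], q; split=> //=.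
have [||| W [q' [H1 H2 H3]]] := IH (Some (i, inr (d2 s (a, o)))) (d2 s (a, o)).
- by rewrite /= !eqxx.
- by move=> x Hx; apply: Hw; rewrite inE Hx orbT.
- by move=> x Hx; apply: Hc; rewrite inE Hx orbT.
pose t : transition (state oaut) 'I_N := (q : state oaut, o, Some (i, inr (d2 s (a, o))) : state oaut).
exists ((a, t) :: W), q'; split=> //=; first by rewrite H1.
apply: (@path_step q (a, t)) => //=; last by have [] := Hw (a, o) (mem_head _ _).
apply/existsP; exists i; apply/existsP; exists (inr s); rewrite Hq eqxx andbT /=.
have /= := Hc (a, o) (mem_head _ _) top; rewrite prednK // => /(_ erefl).
by case: (o top).
Qed.

Lemma path_last q i s a : resolves q i (inr s) -> F2 (i, a) s ->
  exists W, map lab W = [:: (a, reset_all)] /\ pth (A := oaut) q W (Some (i, inr s2)).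
Proof.
move=> Hq HF.
pose t : transition (state oaut) 'I_N := (q : state oaut, reset_all, Some (i, inr s2) : state oaut).
exists [:: (a, t)]; split=> //.
apply: (@path_step q (a, t)) => //=; last exact: hierb_opf.
apply/existsP; exists i; apply/existsP; exists (inr s); rewrite Hq HF !eqxx /=.
by rewrite orbT.
Qed.

Lemma path_word q i a v : resolves q i (inr s2) -> reg_lang (h i a) v ->
  exists W, map lab W = rcons v (a, reset_all) /\ pth (A := oaut) q W (Some (i, inr s2)).
Proof.
move=> Hq Hv; have [Hw Hc] := h_wf Hv.
have [W [q' [H1 H2 H3]]] := path_factor Hq Hw Hc.
have HF : F2 (i, a) (foldl d2 s2 v) by apply/(F2P (i, a)).
have [W' [H4 H5]] := path_last H3 HF.
exists (W ++ W'); rewrite map_cat H1 H4 cats1; split=> //.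
by apply/pth_cat; exists q'.
Qed.

Lemma reset_all_top : reset_all top = Reset.
Proof. by rewrite ffunE ltn_ord. Qed.

Lemma no_action_top : no_action top = NoAct.
Proof. by rewrite ffunE ltn0 andbF. Qed.

Lemma movesP q a o q' : moves q a o q' -> exists i,
  (exists s, [/\ resolves q i (inl s), o = no_action & q' = Some (i, inl (d1 s a))]) \/
  (exists s, resolves q i (inr s) /\
     ((o top <> Reset /\ q' = Some (i, inr (d2 s (a, o)))) \/
      [/\ o = reset_all, F2 (i, a) s & q' = Some (i, inr s2)])).
Proof.
move=> /existsP[i /existsP[[s|s] /andP[Hr H]]]; exists i.
  by left; exists s; case/andP: H => /eqP -> /eqP ->.
right; exists s; split=> //; case/orP: H => [/andP[H /eqP ->]|/and3P[/eqP -> ? /eqP ->]].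
  by left; split=> // E; move: H; rewrite E.
by right.
Qed.

Lemma calm_prefix W q' : pth (A := oaut) None W q' -> ~~ hasr (ac top W) ->
  forall i s, resolves q' i (inr s) -> exists W1 W2,
    [/\ W = W1 ++ W2, reg_lang (P i) (map fst W1) & s = foldl d2 s2 (map lab W2)].
Proof.
move=> HW HW'; suff [H _] : (forall i s, resolves q' i (inr s) -> exists W1 W2,
    [/\ W = W1 ++ W2, reg_lang (P i) (map fst W1) & s = foldl d2 s2 (map lab W2)]) /\
    (forall i s, resolves q' i (inl s) -> s = foldl d1 s1 (map fst W)) by [].
elim/last_ind: W q' HW HW' => [|W t IH] q'.
  move=> /eqP <- _; split=> [i s /andP[/eqP -> HF]|i s /eqP //].
  by exists [::], [::]; split=> //; apply/F1P.
rewrite -cats1 ac_cat hasr_cat negb_or => /pth_cat[q1 [H1 H2]] /andP[N1 N2].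
have [IH1 IH2] := IH q1 H1 N1.
case: t H2 N2 => a [[q o] q2] /= /and3P[]; rewrite inE /= => /andP[Hm _] /eqP Eq /eqP E2 N2.
rewrite /source /target /= in Eq E2; subst q q2.
move: Hm => /movesP[i [[s [Hr Eo E']]|[s [Hr [[Ho E']|[Eo _ _]]]]]]; try subst q'.
- have Es := IH2 _ _ Hr.
  split=> [j s' /and3P[/eqP <- HF /eqP ->]|j s' /andP[/eqP _ /eqP ->]].
    exists (W ++ [:: (a, (q1, o, Some (i, inl (d1 s a))))]), [::]; rewrite cats0; split=> //.
    by apply/F1P; rewrite map_cat foldl_cat -Es.
  by rewrite map_cat foldl_cat -Es.
- have [W1 [W2 [EW HP Es]]] := IH1 _ _ Hr.
  split=> [j s' /andP[/eqP <- /eqP ->]|//].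
  exists W1, (W2 ++ [:: (a, (q1, o, Some (i, inr (d2 s (a, o)))))]); split=> //; first by rewrite EW catA.
  by rewrite map_cat foldl_cat -Es.
- by move: N2; rewrite /hasr /= /act /= Eo reset_all_top.
Qed.

Lemma calm_factor i s W q' : pth (A := oaut) (Some (i, inr s)) W q' -> ~~ hasr (ac top W) ->
  q' = Some (i, inr (foldl d2 s (map lab W))).
Proof.
elim: W s => [|t W IH] s; first by move=> /eqP <-.
case: t => a [[q o] q2] /= /and3P[]; rewrite inE /= => /andP[Hm _] /eqP Eq HW.
rewrite negb_or => /andP[Ho HW'].
rewrite /source /target /= in Eq HW; subst q.
move: Hm HW => /movesP[j [[s' [//]]|[s' [/andP[/eqP <- /eqP ->] [[_ ->]|[Eo _ _]]]]]].
  by move=> /IH/(_ HW').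
by move: Ho; rewrite /act /= Eo reset_all_top.
Qed.

Lemma reset_step (q : state oaut) (t : letter) (q' : state oaut) : t.2 \in Defs.delta oaut t.1 ->
  source (A := oaut) t.2 = q -> target (A := oaut) t.2 = q' ->
  t.2.1.2 top = Reset -> exists i s,
  [/\ resolves q i (inr s), t.2.1.2 = reset_all, F2 (i, t.1) s & q' = Some (i, inr s2)].
Proof.
case: t => a [[q1 o] q2] /=; rewrite inE /= => /andP[Hm _] <- <- Ho.
move: Hm => /movesP[i [[s [_ Eo _]]|[s [Hr [[] //|[Eo HF E]]]]]].
  by move: Ho; rewrite Eo no_action_top.
by exists i, s.
Qed.

(** With the empty set of claims, [Sok] places a virtual reset before the word and none after, which
    is exactly [good1] for S-counters. *)
Lemma good_full i W k l : pth (A := oaut) (Some (i, inr s2)) W (Some (i, inr s2)) ->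
  (forall c, hasr (ac c W)) -> good sk k l (map lab W) ->
  full (A := oaut) (Some (i, inr s2), set0) k l W.
Proof.
move=> HW Hr Hg; apply/fullE; split=> //.
- by move=> E; have := Hr top; rewrite E.
- by move=> c; rewrite inE => Hc; have := Hg c; rewrite (negbTE Hc) /= ac_lab.
- move=> c; rewrite !inE => Hc; have := Hg c; rewrite Hc /= /Sok /= ac_lab cats0.
  by [].
Qed.

Lemma oaut_complete i w : omega_concat (reg_lang (P i)) (om (lsem sk N (h i))) w ->
  exists rho, is_run w rho /\ accepting (A := oaut) rho.
Proof.
move=> [x [Hx Hp [u [/gseqP[k [lv [Hlv Hu]]] _ Hpu]]]].
have /fun_choice [av Hav] : forall j, exists av : Sigma * seq delta,
    [/\ reg_lang (h i av.1) av.2, u j = rcons (map fst av.2) av.1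
      & good sk k (lv j) (rcons av.2 (av.1, reset_all))].
  by move=> j; have [a [v [H1 H2 H3]]] := Hu j isT; exists (a, v).
have HF : F1 i (foldl d1 s1 x) by apply/F1P.
have [W0 [q0 [E0 Hp0 Hq0]]] := @path_prefix None i s1 x (eqxx _).
have Hq0' : resolves q0 i (inr s2).
  case: q0 Hq0 {Hp0} => [[j [t|t]]|] //=; first by move=> /andP[-> /eqP <-]; rewrite HF eqxx.
  by rewrite eqxx => /eqP E; rewrite -E.
have [Hh0 _ _] := Hav 0.
have [W1 [E1 Hp1]] := path_word Hq0' Hh0.
have /fun_choice [V HV] : forall j, exists W, map lab W = rcons (av j.+1).2 ((av j.+1).1, reset_all)
    /\ pth (A := oaut) (Some (i, inr s2)) W (Some (i, inr s2)).
  move=> j; have [Hh _ _] := Hav j.+1; apply: path_word Hh.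
  by rewrite /= !eqxx.
(* The first factor starts where the prefix ends, not in the looping state, so it joins the
   prefix. *)
apply: (@full_accepting _ _ oaut (Some (i, inr s2), set0) (W0 ++ W1) V k (fun j => lv j.+1)).
- by apply/pth_cat; exists q0.
- by move=> l; have [M HM] := Hlv l; exists M => j Hj; apply: HM; apply: leqW.
- move=> j; have [E Hpj] := HV j; have [_ _ Hg] := Hav j.+1.
  apply: good_full => //; last by rewrite E.
  by move=> c; rewrite ac_lab E oc_rcons -cats1 hasr_cat /= ffunE ltn_ord orbT.
move=> M; rewrite -catA map_cat E0; apply/prefix_of_cat; split=> //.
have fst_u j W : map lab W = rcons (av j).2 ((av j).1, reset_all) -> map fst W = u j.
  by move=> E; have [_ -> _] := Hav j; rewrite -fst_lab E map_rcons.
have := Hpu M.+1; rewrite seg_cons // map_cat (fst_u 0 _ E1) [flatten _]/= map_flatten map_seg.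
suff -> : seg (fun j => map fst (V j)) 0 M = seg u 1 M.+1 by [].
rewrite -[RHS](seg_shift u 1 0 M); apply: eq_map => j.
by have [E _] := HV j; rewrite (fst_u j.+1).
Qed.

Lemma inS0 u : inS 0 u.
Proof. by elim: u => //= a u ->; rewrite leq0n implybT. Qed.

(** The resets of [top] cut the run into factors; each of them completes a factor, resets all
    counters and keeps the component i. Before the first of them, [calm_prefix] recovers where the
    prefix ended. *)
Lemma oaut_sound w rho : is_run w rho -> accepting (A := oaut) rho ->
  exists i, omega_concat (reg_lang (P i)) (om (lsem sk N (h i))) w.
Proof.
move=> Hrun Hacc; have [Hinit _] := Hacc.
have [Hres [K HB] HS] := accepting_bounds Hacc.
pose s c t := act (rho t) c.
have Hs t c : s c t = (rho t).1.2 c by [].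
have [g [gS gD gP]] := enum_infinite (Hres top).
pose sg t : letter := (w t, rho t).
have quiet a b : (forall t, a <= t < b -> forall j, g j <> t) -> ~~ hasr (ac top (seg sg a b)).
  move=> H; rewrite ac_seg; apply/negP => /hasr_segP[t Ht /gP[j Ej]]; exact: H Ht j Ej.
have step j : exists i s', [/\ resolves (source (rho (g j))) i (inr s'), (rho (g j)).1.2 = reset_all,
   F2 (i, w (g j)) s' & target (rho (g j)) = Some (i, inr s2)].
  have [Hd _] := Hrun (g j); apply: (@reset_step _ (sg (g j))) => //.
  exact: gD.
have nextq t : source (rho t.+1) = target (rho t) by have [_ ->] := Hrun t.
have quiet0 : ~~ hasr (ac top (seg sg 0 (g 0))).
  apply: quiet => t Ht j E; have := strict_mono_le gS (leq0n j); rewrite E.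
  by rewrite leqNgt; case/andP: Ht => _ ->.
have quietS j : ~~ hasr (ac top (seg sg (g j).+1 (g j.+1))).
  apply: quiet => t Ht j' E; apply: (@enum_between g (fun t => s top t = Reset) j t) => //.
  by rewrite -E; apply: gD.
have [i [q0 [Hr0 Eo0 HF0 Ht0]]] := step 0.
have Htgt j : target (rho (g j)) = Some (i, inr s2).
  elim: j => // j IH; have Hp := run_pth Hrun (gS j).
  rewrite nextq IH in Hp; have E := calm_factor Hp (quietS j).
  have [i' [q' [Hr' _ _ ->]]] := step j.+1.
  by move: Hr'; rewrite E => /andP[/eqP ->].
have Hp0 := run_pth Hrun (leq0n (g 0)); rewrite Hinit in Hp0.
have [W1 [W2 [EW HP Eq0]]] := calm_prefix Hp0 quiet0 Hr0.
pose t0 := size W1.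
have t0g : t0 <= g 0 by have := congr1 size EW; rewrite size_seg size_cat subn0 => ->; apply: leq_addr.
have [EW1 EW2] : seg sg 0 t0 = W1 /\ seg sg t0 (g 0) = W2.
  move: EW; rewrite (seg_cat sg (leq0n t0) t0g) => /eqP.
  by rewrite eqseq_cat ?size_seg ?subn0 // => /andP[/eqP -> /eqP ->].
pose b j := if j is j'.+1 then (g j').+1 else t0.
have bS j : b j < b j.+1.
  by case: j => [|j]; rewrite /= ltnS //; apply: leq_trans (gS j).
have bg j : b j <= g j by case: j.
have resets c j : s c (g j) = Reset.
  have [i' [q' [_ Eo _ _]]] := step j.
  by rewrite Hs Eo ffunE ltn_ord.
have HK (c : 'I_N) : ~~ sk c -> forall a d, allB K (seg (s c) a d).
  by move=> Hc; apply: HB; rewrite inE.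
have HSx l : exists M, forall c : 'I_N, sk c -> forall a d, M <= a -> inS l (seg (s c) a d).
  by have [M HM] := HS l; exists M => c Hc; apply: HM; rewrite inE.
have chunk k l j : (forall c : 'I_N, good1 (sk c) k l (seg (s c) (b j) (b j.+1))) ->
    lsem sk N (h i) k l (seg w (b j) (b j.+1)).
  move=> Hg; exists (w (g j)), (map lab (seg sg (b j) (g j))); split.
  - apply/(F2P (i, w (g j))); rewrite /=.
    case: j {Hg} => [|j]; first by rewrite /b EW2 -Eq0.
    have [i' [q' [Hr' _ HF _]]] := step j.+1.
    have Hp := run_pth Hrun (gS j); rewrite nextq Htgt in Hp.
    have E := calm_factor Hp (quietS j).
    by move: Hr'; rewrite E => /andP[/eqP Ei /eqP Eq']; rewrite -/sg -Eq' Ei.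
  - by rewrite fst_lab map_seg seg_rcons.
  - move=> c; have -> : oc c (rcons (map lab (seg sg (b j) (g j))) (w (g j), opf N N false)) =
        seg (s c) (b j) (b j.+1).
      rewrite oc_rcons -ac_lab ac_seg /= seg_rcons //; congr rcons.
      by rewrite resets ffunE ltn_ord.
    exact: Hg.
exists i, (seg w 0 t0); split.
- by move: HP; rewrite -EW1 map_seg.
- exact: prefix_of_seg.
rewrite size_seg subn0; exists (fun j => seg w (b j) (b j.+1)); split.
- exists K; split=> [j _|l].
    apply: chunk => c; rewrite /good1; case Hc : (sk c); first exact: inS0.
    by apply: HK; rewrite Hc.
  (* For chunk j + 1 the virtual reset of [good1] is the actual one at [g j]; chunk 0 has none
     before it and is only needed at level 0. *)
  have [M HM] := HSx l; exists M.+1 => -[|j] // Hj _; apply: chunk => c.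
  rewrite /good1; case Hc : (sk c); last by apply: HK; rewrite Hc.
  have -> : Reset :: seg (s c) (b j.+1) (b j.+2) = seg (s c) (g j) (b j.+2).
    by rewrite [RHS]seg_cons ?resets //= ltnS ltnW.
  by apply: HM => //; apply: leq_trans (strict_mono_ge gS j).
- by move=> j; exists j => //; rewrite seg_cons.
move=> M; have -> : flatten (seg (fun j => seg w (b j) (b j.+1)) 0 M) = seg w t0 (b M).
  elim: M => [|M IH]; first by rewrite !seg_nil.
  rewrite seg_rcons // flatten_rcons IH -seg_cat //; last exact/ltnW.
  by elim: M {IH} => [|M IH]; [|apply: leq_trans IH (ltnW _)].
have Hb : t0 <= b M by elim: M => [|M IH]; [|apply: leq_trans IH (ltnW _)].
have -> : seg w t0 (b M) = seg (fun t => w (t0 + t)) 0 (b M - t0).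
  by rewrite seg_shift addn0 subnKC.
exact: prefix_of_seg.
Qed.

Lemma oaut_recognizes (L : omega_word Sigma -> Prop) :
  (forall w, L w <-> exists i, omega_concat (reg_lang (P i)) (om (lsem sk N (h i))) w) ->
  recognizes oaut L.
Proof.
move=> HL w; split=> [/HL[i Hi]|[rho [Hrun Hacc]]]; first exact: oaut_complete Hi.
by apply/HL; apply: oaut_sound Hrun Hacc.
Qed.
End OmegaAutomaton.

Theorem omega_regular_hierarchical (T : kind) (Sigma : finType) (L : omega_word Sigma -> Prop) :
  omega_T_regular T L -> exists (n : nat) (A : automaton Sigma 'I_n),
    [/\ is_T_automaton A T, hierarchical A & recognizes A L].
Proof.
move=> [n [e [f [Hf HL]]]].
(* One counter layout shared by all summands. *)
pose D := (\max_(i < n) sdepth (f i)).+1; pose m := \max_(i < n) bdepth (f i).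
have /fin_all_exists [h Hh] : forall t : 'I_n, exists h : 'I_D -> Sigma ->
   regexp (Sigma * {ffun 'I_(ctop m D) -> action})%type,
   (forall i a v, reg_lang (h i a) v -> wfw (ctop m D) v /\ calm (ctop m D) v) /\
    forall w, omega_concat (reg_lang (e t)) (om (sem (f t))) w <->
      exists i, omega_concat (reg_lang (Rconcat (e t) (Rstar (erase (f t)))))
                  (om (lsem (skind T m) (ctop m D) (h i))) w.
  move=> t; apply: component => //; last exact: leq_bigmax.
  by rewrite ltnS; apply: leq_bigmax.
pose P (p : 'I_n * 'I_D) := Rconcat (e p.1) (Rstar (erase (f p.1))).
have [S1 [d1 [s1 [F1 HF1]]]] := family_recognized P.
have [S2 [d2 [s2 [F2 HF2]]]] := family_recognized (fun p : 'I_n * 'I_D * Sigma => h p.1.1 p.1.2 p.2).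
have Npos : 0 < ctop m D by rewrite /ctop /pos addn0 muln_gt0.
have HFP : forall (p : ('I_n * 'I_D) * Sigma) w, reg_lang (h p.1.1 p.1.2 p.2) w <-> F2 p (foldl d2 s2 w).
  exact: HF2.
exists (ctop m D), (oaut (skind T m) Npos d1 d2 s1 s2 F1 F2).
have Hwf : forall (i : 'I_n * 'I_D) a v, reg_lang (h i.1 i.2 a) v ->
    wfw (ctop m D) v /\ calm (ctop m D) v.
  by move=> i a v; case: (Hh i.1) => H _; apply: H.
split; last 2 first.
- exact: oaut_hierarchical.
- apply: (@oaut_recognizes _ _ _ _ Npos P (fun p => h p.1 p.2)) => // w.
  rewrite HL; split=> [[t Ht]|[[t i] Hi]].
    have {}Ht : omega_concat (reg_lang (e t)) (om (sem (f t))) w.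
      by apply: omega_concat_ext Ht => // w' /omega_power_om.
    by have [i Hi] := proj1 (proj2 (Hh t) w) Ht; exists (t, i).
  exists t; have : omega_concat (reg_lang (e t)) (om (sem (f t))) w.
    by apply/(proj2 (Hh t) w); exists i.
  by apply: omega_concat_ext => // w' /omega_power_om.
clear HL Hh Hwf HF1 HF2 HFP.
(* Without B-exponents every layer shrinks to its S-counter, so no B-counter remains. *)
have m0 : T = KindS -> m = 0.
  move=> ET; apply/eqP; rewrite -leqn0; apply/bigmax_leqP => i _; have := Hf i.
  rewrite ET; elim: (f i) => //= e1 IH1 e2 IH2 /andP[/IH1 H1 /IH2 H2];
  by rewrite geq_max H1.
rewrite /is_T_automaton; case ET : T => //; apply/setP => c; rewrite !inE /skind //=.
by move: (nat_of_ord c) => c'; rewrite m0 // modn1.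
Qed.

Theorem theorem3p3 (T : kind) (Sigma : finType) (L : omega_word Sigma -> Prop) :
  (omega_T_regular T L <->
   exists (n : nat) (A : automaton Sigma 'I_n),
     [/\ is_T_automaton A T, hierarchical A & recognizes A L]) /\
  ((exists (n : nat) (A : automaton Sigma 'I_n),
     [/\ is_T_automaton A T, hierarchical A & recognizes A L]) <->
   exists (Gamma : finType) (A : automaton Sigma Gamma),
     is_T_automaton A T /\ recognizes A L).
Proof.
split; split.
- exact: omega_regular_hierarchical.
- by move=> [n [A [HT _ HL]]]; apply: automaton_omega_regular HT L HL.
- by move=> [n [A [HT _ HL]]]; exists 'I_n, A.
- move=> [Gamma [A [HT HL]]]; apply: omega_regular_hierarchical.
  exact: automaton_omega_regular HT L HL.
Qed.
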